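(* Let $N\ge1$. For all $A\subseteq\mathbb{R}^N$ the following are equivalent: (i) $A$ is $\Delta^1_1$ and convexly generated; (ii) $A$ admits a $\Delta^1_1$ convexly generated code; (iii) $A$ is $\Delta^1_1$ and convex.
   Context: $\Delta^1_1$ is the lightface (effective) pointclass; a point of $\mathcal{N}=\omega^\omega$ is $\Delta^1_1$ if it is $\Delta^1_1$ as a function $\omega\to\omega$. For a finite sequence of naturals, $\langle u_0,\dots,u_{n-1}\rangle=p_0^{u_0+1}\cdots p_{n-1}^{u_{n-1}+1}$, where $(p_n)$ enumerates the primes in increasing order, $\langle\emptyset\rangle=1$. If $s=\langle u_0,\dots,u_{n-1}\rangle$ and $i<n$ then $(s)_i=u_i$; in all other cases $(s)_i=0$. Put $q(s)=(s)_0/((s)_1+1)$. For $\alpha\in\mathcal{N}$, $\alpha^*(t)=\alpha(t+1)$. A recursive Polish space $\mathcal{X}$ (such as $\omega$, $\mathcal{N}$, $\mathbb{R}$ and finite products) comes with a fixed complete metric $d_{\mathcal{X}}$ and a fixed recursive presentation $(r^{\mathcal{X}}_i)_{i\in\omega}$ (a dense sequence for which the relations $d(r_i,r_j)<q(k)$, $d(r_i,r_j)\le q(k)$ are recursive); finite products carry the maximum metric and $r^{\mathcal{X}_0\times\dots\times\mathcal{X}_n}_s=(r^{\mathcal{X}_0}_{(s)_0},\dots,r^{\mathcal{X}_n}_{(s)_n})$. $N(\mathcal{X},s)$ is the open ball with center $r^{\mathcal{X}}_{(s)_0}$ and radius $q((s)_1)$; $U^{\mathcal{X}}(\alpha)=\bigcup_nN(\mathcal{X},\alpha(n))$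 and $F^{\mathcal{X}}(\alpha)=\mathcal{X}\setminus U^{\mathcal{X}}(\alpha)$. For $\alpha\in\mathcal{N}$, $\{\alpha\}:\omega\rightharpoonup\mathcal{N}$ is the partial function such that $\{\alpha\}(n)$ is defined iff there is a unique $y\in\mathcal{N}$ with $y\in N(\mathcal{N},s)\iff(n,s)\in U^{\omega\times\omega}(\alpha)$ for all $s\in\omega$, and then $\{\alpha\}(n)=y$. A subset of $\mathbb{R}^N$ is convexly generated if it belongs to the least family that contains all compact convex sets and is closed under countable increasing unions and countable intersections. The codes $CGC^N_\xi$ and the coding map $\pi^N$ are defined simultaneously by recursion: $CGC^N_0=\{\alpha:\alpha(0)=0$ and $F^{\mathbb{R}^N}(\alpha^* )$ is compact and convex$\}$ with $\pi^N(\alpha)=F^{\mathbb{R}^N}(\alpha^* )$; for $\xi\ge1$, $\alpha\in CGC^N_\xi$ iff $\alpha(0)=1$, for all $i,j$ $\{\alpha^*\}(\langle i,j\rangle)$ is defined and belongs to $CGC^N_\eta$ for some $\eta<\xi$, and for all $i\le i'$, $\bigcap_j\pi^N(\{\alpha^*\}(\langle i,j\rangle))\subseteq\bigcap_j\pi^N(\{\alpha^*\}(\langle i',j\rangle))$; in this case $\pi^N(\alpha)=\bigcup_i\bigcap_j\pi^N(\{\alpha^*\}(\langle i,j\rangle))$. $CGC^N=\bigcup_{\xi<\omega_1}CGC^N_\xi$, and $\alpha\in CGC^N$ is a convexly generated code for $\pi^N(\alpha)$. *)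

(* Defs.v *)
From HB Require Import structures.
From mathcomp Require Import all_boot all_order all_algebra.
From mathcomp Require Import all_classical all_reals all_analysis.

Unset Printing Implicit Defensive.

Import Order.TTheory GRing.Theory Num.Theory.
Import numFieldNormedType.Exports.

Local Open Scope classical_set_scope.
Local Open Scope ring_scope.

Definition baire := nat -> nat.

Definition shift (a : baire) : baire := fun t => a t.+1.

Lemma prime_above_ex (n : nat) : exists p, ((n < p) && prime p)%N.
Proof. by have [p np pp] := prime_above n; exists p; rewrite np pp. Qed.

Definition next_prime (n : nat) : nat := ex_minn (prime_above_ex n).

Definition nth_prime (n : nat) : nat := iter n next_prime 2%N.

Definition seqcode (u : seq nat) : nat :=
  (\prod_(i < size u) nth_prime i ^ (nth 0 u i).+1)%N.

(* The number (s)_i, equal to 0 unless s codes a sequence of length > i. *)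
Definition coord (s i : nat) : nat :=
  xget 0%N [set v | exists u : seq nat,
    [/\ s = seqcode u, (i < size u)%N & v = nth 0%N u i]].

Inductive recursive : forall {k : nat}, (k.-tuple nat -> nat) -> Prop :=
| recursive_zero k : recursive (fun _ : k.-tuple nat => 0%N)
| recursive_succ : recursive (fun v : 1.-tuple nat => (thead v).+1)
| recursive_proj k (i : 'I_k) : recursive (fun v : k.-tuple nat => tnth v i)
| recursive_comp k m (g : m.-tuple nat -> nat)
    (h : 'I_m -> k.-tuple nat -> nat) :
    recursive g -> (forall i, recursive (h i)) ->
    recursive (fun v : k.-tuple nat => g [tuple h i v | i < m])
| recursive_primrec k (g : k.-tuple nat -> nat) (h : k.+2.-tuple nat -> nat)
    (f : k.+1.-tuple nat -> nat) :
    recursive g -> recursive h ->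
    (forall v : k.-tuple nat, f [tuple of 0%N :: v] = g v) ->
    (forall (n : nat) (v : k.-tuple nat), f [tuple of n.+1 :: v] =
       h [tuple of f [tuple of n :: v] :: n :: v]) ->
    recursive f
| recursive_mu k (g : k.+1.-tuple nat -> nat) (f : k.-tuple nat -> nat) :
    recursive g ->
    (forall v : k.-tuple nat, g [tuple of f v :: v] = 0%N) ->
    (forall (v : k.-tuple nat) (m : nat),
       (m < f v)%N -> g [tuple of m :: v] <> 0%N) ->
    recursive f.

Definition recursive1 (e : nat -> nat) : Prop :=
  recursive (fun v : 1.-tuple nat => e (thead v)).

(* A recursive Polish space is represented by the data on which the notions
   below depend: the points, the fixed metric and the fixed dense sequence. *)
Record space (R : realType) : Type := Space {
  point :> Type;
  dist : point -> point -> R;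
  pres : nat -> point
}.

Arguments dist {R s} _ _.
Arguments pres {R} s _.

Section Spaces.
Context {R : realType}.

Definition omega_space : space R :=
  @Space R nat (fun m n => (m != n)%:R) id.

(* 1 / (least n such that a n <> b n, plus 1), and 0 when a = b *)
Definition baire_dist (a b : baire) : R :=
  match pselect (exists n, a n != b n) with
  | left ab => ((ex_minn ab).+1%:R)^-1
  | right _ => 0
  end.

Definition baire_space : space R :=
  @Space R baire baire_dist (fun i j => coord i j).

Definition rat_pres (i : nat) : R :=
  (-1) ^+ coord i 0 * (coord i 1)%:R / (coord i 2).+1%:R.

(* The norm of 'rV[R]_N is the maximum norm. *)
Definition euclidean_space (N : nat) : space R :=
  @Space R 'rV[R]_N (fun x y => `|x - y|)
    (fun s => \row_(i < N) rat_pres (coord s i)).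

Definition prod_space (X Y : space R) : space R :=
  @Space R (X * Y)%type
    (fun p q => Num.max (dist p.1 q.1) (dist p.2 q.2))
    (fun s => (pres X (coord s 0), pres Y (coord s 1))).

Definition qrat (s : nat) : R := (coord s 0)%:R / (coord s 1).+1%:R.

Definition basic_nbhd (X : space R) (s : nat) : set X :=
  [set x | dist x (pres X (coord s 0)) < qrat (coord s 1)].

Definition open_coded (X : space R) (a : baire) : set X :=
  \bigcup_n basic_nbhd X (a n).

Definition closed_coded (X : space R) (a : baire) : set X :=
  ~` open_coded X a.

Definition Sigma01 {X : space R} (P : set X) : Prop :=
  exists2 e : baire, recursive1 e & P = open_coded X e.

Definition Pi01 {X : space R} (P : set X) : Prop := Sigma01 (~` P).

Definition Sigma11 {X : space R} (P : set X) : Prop :=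
  exists2 Q : set (prod_space X baire_space),
    Pi01 Q & P = [set x | exists b : baire, Q (x, b)].

Definition Pi11 {X : space R} (P : set X) : Prop := Sigma11 (~` P).

Definition Delta11 {X : space R} (P : set X) : Prop := Sigma11 P /\ Pi11 P.

Definition Delta11_point (a : baire) : Prop :=
  Delta11 ([set p | a p.1 = p.2] : set (prod_space omega_space omega_space)).

(* {a}(n) is defined and equal to y *)
Definition pfun_at (a : baire) (n : nat) (y : baire) : Prop :=
  unique (fun z : baire => forall s : nat, basic_nbhd baire_space s z <->
    open_coded (prod_space omega_space omega_space) a (n, s)) y.

Inductive convexly_generated {N : nat} : set 'rV[R]_N -> Prop :=
| cg_compact_convex (K : set 'rV[R]_N) : compact K -> convex_set K -> convexly_generated K
| cg_increasing_union (B : nat -> set 'rV[R]_N) :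
    (forall i, convexly_generated (B i)) ->
    (forall i, B i `<=` B i.+1) ->
    convexly_generated (\bigcup_i B i)
| cg_intersection (B : nat -> set 'rV[R]_N) :
    (forall i, convexly_generated (B i)) ->
    convexly_generated (\bigcap_i B i).

Definition wellorder (lt : nat -> nat -> Prop) : Prop :=
  [/\ well_founded lt,
      forall x y z, lt x y -> lt y z -> lt x z
    & forall x y, [\/ lt x y, x = y | lt y x]].

(* For a well-order lt of the natural numbers, whose element xi stands for the
   ordinal of its set of predecessors, CGC_at lt xi a A means that a is in
   CGC^N_xi and pi^N(a) = A. The elements of all such well-orders represent
   exactly the ordinals below omega_1. *)
Inductive CGC_at {N : nat} (lt : nat -> nat -> Prop) :
    nat -> baire -> set 'rV[R]_N -> Prop :=
| CGC_zero (xi : nat) (a : baire) :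
    (forall eta, ~ lt eta xi) ->
    a 0%N = 0%N ->
    compact (closed_coded (euclidean_space N) (shift a) : set 'rV[R]_N) ->
    convex_set (closed_coded (euclidean_space N) (shift a) : set 'rV[R]_N) ->
    CGC_at lt xi a (closed_coded (euclidean_space N) (shift a))
| CGC_step (xi : nat) (a : baire) (b : nat -> nat -> baire)
    (eta : nat -> nat -> nat) (B : nat -> nat -> set 'rV[R]_N) :
    (exists zeta, lt zeta xi) ->
    a 0%N = 1%N ->
    (forall i j, pfun_at (shift a) (seqcode [:: i; j]) (b i j)) ->
    (forall i j, lt (eta i j) xi) ->
    (forall i j, CGC_at lt (eta i j) (b i j) (B i j)) ->
    (forall i i', (i <= i')%N -> \bigcap_j B i j `<=` \bigcap_j B i' j) ->
    CGC_at lt xi a (\bigcup_i \bigcap_j B i j).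

(* a is in CGC^N and pi^N(a) = A *)
Definition convexly_generated_code {N : nat} (a : baire)
    (A : set 'rV[R]_N) : Prop :=
  exists lt xi, wellorder lt /\ CGC_at lt xi a A.

Lemma convexly_generated_code_uniq (N : nat) (a : baire) (A A' : set 'rV[R]_N) :
  convexly_generated_code a A -> convexly_generated_code a A' -> A = A'.
Proof.
move=> [lt [xi [_ cA]]] [lt' [xi' [_ cA']]].
elim: cA lt' xi' A' cA' => {xi a A}.
- move=> xi a _ a0 _ _ lt' xi' A' cA'.
  by case: cA' a0 => // x a' b' eta' B' _ ->.
- move=> xi a b eta B _ a1 ab _ _ IH _ lt' xi' A' cA'.
  case: cA' a1 ab => [x a' _ -> //|].
  move=> x a' b' eta' B' _ _ ab' _ cB' _ _ ab.
  have bb i j : b i j = b' i j by apply: (ab i j).2; exact: (ab' i j).1.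
  have -> // : B = B'.
  apply/funext => i; apply/funext => j; apply: IH.
  by rewrite bb; exact: cB'.
Qed.

End Spaces.

Arguments euclidean_space R N : clear implicits.
Arguments Delta11_point R a : clear implicits.

(* Main.v *)
(* Both hard implications rest on one principle: a function that is the unique
   solution of an analytic condition is a Delta^1_1 point, so effective transfinite
   recursion may be replaced by guessing a whole family of codes or truth values and
   checking it locally.
   (ii) => (i): a point belongs to the coded set iff some (equivalently every) locally
   correct assignment of subcodes and truth values gives the root the value "true".
   (iii) => (ii): Preiss' argument. Let A and its complement be the projections of
   recursively closed sets. At a node, i.e. a finite sequence of bounds on the
   witnesses (the first one bounding the point as well), both sets are approximated by
   finitely many conditions on rational points. The node is a leaf if the rational
   convex hull of the first approximation is at positive distance from the second one.
   By compactness and Caratheodory's theorem, a branch without leaves would give a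
   convex combination of points of A lying outside A. The tree is thus well founded,
   and the sets C_s equal to the closed hull at leaves and to
   U_i (intersection of C_(s,j) over j >= i) elsewhere separate, at each node s, the
   part of A below s from the part of its complement below s. *)

From Pilot Require (* again, because [vector] exports another [coord] *)
Import Defs.
From mathcomp Require Import all_boot all_order all_algebra.
From mathcomp Require Import all_classical all_reals all_analysis.
From mathcomp Require Import ring lra zify.
(* again, because [vector] exports another [coord] *)
Import Defs.
Import Order.TTheory GRing.Theory Num.Theory.
Import numFieldNormedType.Exports.
Set Implicit Arguments.
Unset Strict Implicit.
Unset Printing Implicit Defensive.
Local Open Scope classical_set_scope.
Local Open Scope ring_scope.

(** * Recursive functions *)

Local Open Scope nat_scope.

(** Nothing guessed has to be built effectively: families of codes, evaluations and ranks come from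
    choice and ordinary transfinite recursion, and only the local conditions that pin them down must
    be analytic. This shapes the rest. The conditions mention leaves and hulls, so these must be
    bianalytic; hence hulls consist of rational points obtained by iterated binary means with
    integer weights, and a positive distance is witnessed by some [1 / m.+1]. A point of the
    Euclidean space is not a function on the naturals, so it enters only through the set of balls
    that it avoids; a closed condition can assert avoidance only, and [saturated] recovers
    membership from it. The lower limit [U_i] of the intersections over [j >= i] is forced by the
    nodes: a witness respects the bound [i] from some [i] on, so a point of the set lies in all late
    children, whereas a point of the complement is missed by all late children and so by every
    intersection. The intersections increase with [i], as codes demand. *)

Definition recursive2 (h : nat -> nat -> nat) : Prop :=
  recursive (fun v : 2.-tuple nat => h (tnth v (inord 0)) (tnth v (inord 1))).

Definition recursive3 (h : nat -> nat -> nat -> nat) : Prop :=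
  recursive (fun v : 3.-tuple nat =>
    h (tnth v (inord 0)) (tnth v (inord 1)) (tnth v (inord 2))).

Definition recursive4 (h : nat -> nat -> nat -> nat -> nat) : Prop :=
  recursive (fun v : 4.-tuple nat =>
    h (tnth v (inord 0)) (tnth v (inord 1)) (tnth v (inord 2))
      (tnth v (inord 3))).

Lemma eq_recursive k (f g : k.-tuple nat -> nat) :
  recursive f -> f =1 g -> recursive g.
Proof. by move=> rf /funext <-. Qed.

Section Composition.
Variable k : nat.
Implicit Types f : k.-tuple nat -> nat.

Lemma recursive_comp1 h f :
  recursive1 h -> recursive f -> recursive (fun v => h (f v)).
Proof.
move=> rh rf; have := @recursive_comp k 1 _ (fun _ => f) rh (fun _ => rf).
by move/eq_recursive; apply => v /=; rewrite /thead tnth_mktuple.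
Qed.

Lemma recursive_comp2 h f1 f2 : recursive2 h ->
  recursive f1 -> recursive f2 -> recursive (fun v => h (f1 v) (f2 v)).
Proof.
move=> rh r1 r2.
have r (i : 'I_2) : recursive (nth f1 [:: f1; f2] i).
  by case: i => -[|[|//]].
apply: (eq_recursive (@recursive_comp k 2 _ _ rh r)) => v /=.
by rewrite !tnth_mktuple !inordK.
Qed.

Lemma recursive_comp3 h f1 f2 f3 : recursive3 h ->
  recursive f1 -> recursive f2 -> recursive f3 ->
  recursive (fun v => h (f1 v) (f2 v) (f3 v)).
Proof.
move=> rh r1 r2 r3.
have r (i : 'I_3) : recursive (nth f1 [:: f1; f2; f3] i).
  by case: i => -[|[|[|//]]].
apply: (eq_recursive (@recursive_comp k 3 _ _ rh r)) => v /=.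
by rewrite !tnth_mktuple !inordK.
Qed.

Lemma recursive_S f : recursive f -> recursive (fun v => (f v).+1).
Proof. exact: (recursive_comp1 recursive_succ). Qed.

Lemma recursive_const n : recursive (fun _ : k.-tuple nat => n).
Proof. by elim: n => [|n]; [exact: recursive_zero|exact: recursive_S]. Qed.

End Composition.

Lemma recursive1P h :
  recursive (fun v : 1.-tuple nat => h (tnth v (inord 0))) -> recursive1 h.
Proof. by move/eq_recursive; apply => v; rewrite (ord1 (inord 0)). Qed.

(** Two parameters suffice for every later use: functions with fewer are padded by dummy arguments,
    so primitive recursion unpacks tuples only once. *)
Lemma recursive_prim (g : nat -> nat -> nat) h (f : nat -> nat -> nat -> nat) :
  recursive2 g -> recursive4 h ->
  (forall x y, f 0 x y = g x y) ->
  (forall n x y, f n.+1 x y = h (f n x y) n x y) -> recursive3 f.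
Proof.
move=> rg rh f0 fS; apply: (@recursive_primrec 2 _ _ _ rg rh) => [v|n v].
  by rewrite !(tnth_nth 0) /= !inordK //= f0 !(tnth_nth 0) /= !inordK.
by rewrite !(tnth_nth 0) /= !inordK //= fS !(tnth_nth 0).
Qed.

Lemma recursive_min (g : nat -> nat -> nat -> nat) (f : nat -> nat -> nat) :
  recursive3 g -> (forall x y, g (f x y) x y = 0) ->
  (forall x y m, m < f x y -> g m x y <> 0) -> recursive2 f.
Proof.
move=> rg g0 gmin; apply: (@recursive_mu 2 _ _ rg) => [v|v m].
  by rewrite !(tnth_nth 0) /= !inordK //= g0.
by move/gmin; rewrite !(tnth_nth 0) /= !inordK.
Qed.

Ltac recursive_step :=
  lazy beta delta [recursive2 recursive3 recursive4];
  lazymatch goal with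
  | |- recursive (fun v => tnth v _) => exact: recursive_proj
  | |- recursive (fun v => S (@?f v)) => apply: (@recursive_S _ f)
  | _ => exact: recursive_const
  end.

Ltac recursive_steps := repeat recursive_step.

Lemma recursive_addn : recursive2 addn.
Proof.
have r : recursive3 (fun n x _ => n + x).
  by apply: (@recursive_prim (fun x _ => x) (fun r _ _ _ => r.+1)) => //;
    recursive_steps.
by apply: (@recursive_comp3 _ _ _ _ (fun=> 0) r); recursive_steps.
Qed.

Lemma recursive_muln : recursive2 muln.
Proof.
have r : recursive3 (fun n x _ => n * x).
  apply: (@recursive_prim (fun x _ => 0) (fun r _ x _ => x + r)) => //.
    exact: recursive_const.
  by apply: (recursive_comp2 recursive_addn); recursive_steps.
by apply: (@recursive_comp3 _ _ _ _ (fun=> 0) r); recursive_steps.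
Qed.

Lemma recursive_expn : recursive2 expn.
Proof.
have r : recursive3 (fun n x _ => x ^ n).
  apply: (@recursive_prim (fun x _ => 1) (fun r _ x _ => x * r)) => //.
  - exact: recursive_const.
  - by apply: (recursive_comp2 recursive_muln); recursive_steps.
  - by move=> n x _; rewrite expnS.
by apply: (@recursive_comp3 _ _ _ _ (fun=> 0) r); recursive_steps.
Qed.

Lemma recursive_predn : recursive1 predn.
Proof.
have r : recursive3 (fun n _ _ => n.-1).
  apply: (@recursive_prim (fun _ _ => 0) (fun _ n _ _ => n)) => //.
    exact: recursive_const.
  exact: recursive_proj.
apply/recursive1P; apply: (@recursive_comp3 _ _ _ (fun=> 0) (fun=> 0) r);
  by recursive_steps.
Qed.

Lemma recursive_subn : recursive2 subn.
Proof.
have r : recursive3 (fun n x _ => x - n).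
  apply: (@recursive_prim (fun x _ => x) (fun r _ x _ => r.-1)) => //.
  - exact: recursive_proj.
  - by apply: (recursive_comp1 recursive_predn); recursive_steps.
  - by move=> x; rewrite subn0.
  - by move=> n x _; rewrite subnS.
by apply: (@recursive_comp3 _ _ _ _ (fun=> 0) r); recursive_steps.
Qed.

Section BooleanRecursive.
Variable k : nat.
Implicit Types p q : k.-tuple nat -> bool.

Lemma recursive_negb p : recursive p -> recursive (fun v => ~~ p v).
Proof.
move=> rp; apply: (eq_recursive (recursive_comp2 recursive_subn
  (recursive_const k 1) rp)) => v.
by case: (p v).
Qed.

Lemma recursive_andb p q :
  recursive p -> recursive q -> recursive (fun v => p v && q v).
Proof.
move=> rp rq; apply: (eq_recursive (recursive_comp2 recursive_muln rp rq)) => v.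
by rewrite mulnb.
Qed.

Lemma recursive_if p (f g : k.-tuple nat -> nat) :
  recursive p -> recursive f -> recursive g ->
  recursive (fun v => if p v then f v else g v).
Proof.
move=> rp rf rg; apply: (eq_recursive (recursive_comp2 recursive_addn
  (recursive_comp2 recursive_muln rp rf)
  (recursive_comp2 recursive_muln (recursive_negb rp) rg))) => v.
by case: (p v); rewrite ?mul1n ?addn0.
Qed.

End BooleanRecursive.

Lemma recursive_leq : recursive2 leq.
Proof.
(* With truncated subtraction, [1 - (m - n)] is the truth value of [m <= n]. *)
apply: (eq_recursive (recursive_comp2 recursive_subn (recursive_const 2 1)
  recursive_subn)) => v.
by case: leqP => /=; lia.
Qed.

Lemma recursive_eqn : recursive2 (fun m n => m == n).
Proof.
have := recursive_andb recursive_leq (recursive_comp2 recursive_leq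
  (recursive_proj 2 (inord 1)) (recursive_proj 2 (inord 0))).
by move/eq_recursive; apply => v; rewrite eqn_leq.
Qed.

Ltac recursive_arith_step :=
  lazy beta delta [recursive2 recursive3 recursive4];
  lazymatch goal with
  | |- recursive (fun v => addn (@?f v) (@?g v)) =>
      apply: (@recursive_comp2 _ _ f g recursive_addn)
  | |- recursive (fun v => muln (@?f v) (@?g v)) =>
      apply: (@recursive_comp2 _ _ f g recursive_muln)
  | |- recursive (fun v => subn (@?f v) (@?g v)) =>
      apply: (@recursive_comp2 _ _ f g recursive_subn)
  | |- recursive (fun v => expn (@?f v) (@?g v)) =>
      apply: (@recursive_comp2 _ _ f g recursive_expn)
  | |- recursive (fun v => predn (@?f v)) =>
      apply: (@recursive_comp1 _ _ f recursive_predn)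
  | |- recursive (fun v => nat_of_bool (~~ (@?p v))) =>
      apply: (@recursive_negb _ p)
  | |- recursive (fun v => nat_of_bool ((@?p v) && (@?q v))) =>
      apply: (@recursive_andb _ p q)
  | |- recursive (fun v => nat_of_bool (leq (@?f v) (@?g v))) =>
      apply: (@recursive_comp2 _ _ f g recursive_leq)
  | |- recursive (fun v => nat_of_bool (@?f v == @?g v)) =>
      apply: (@recursive_comp2 _ _ f g recursive_eqn)
  | _ => recursive_step
  end.

Ltac recursive_arith := repeat recursive_arith_step.

Lemma recursive_all (p : nat -> nat -> nat -> bool) :
  recursive3 (fun i x y => p i x y) ->
  recursive3 (fun n x y => all (fun i => p i x y) (iota 0 n)).
Proof.
move=> rp.
apply: (@recursive_prim (fun _ _ => 1) (fun r i x y => r * p i x y)) => //.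
- exact: recursive_const.
- by recursive_arith; apply: (recursive_comp3 rp); recursive_arith.
- by move=> n x y; rewrite -addn1 iotaD all_cat /= andbT add0n mulnb.
Qed.

(** * Divisibility, primes and sequence codes *)

Lemma recursive_dvdn : recursive2 dvdn.
Proof.
have r : recursive3 (fun q n d => ~~ (n == q * d)) by recursive_arith.
(* A bounded search for the quotient: it never exceeds [n], except possibly for [d = 0], where
   [n = 0] and the quotient [0] serves. *)
have := recursive_negb (recursive_comp3 (recursive_all r)
  (recursive_S (recursive_proj 2 (inord 1))) (recursive_proj 2 (inord 1))
  (recursive_proj 2 (inord 0))).
move/eq_recursive; apply => v; move: (tnth v (inord 0)) (tnth v (inord 1)) => d n.
congr nat_of_bool; apply/seq.allPn/dvdnP => [[q _ /negPn/eqP ->]|[q nE]].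
  by exists q.
have [d0|d_gt0] := posnP d.
  by exists 0; rewrite ?mem_iota // nE d0 muln0.
exists q; rewrite ?nE ?eqxx // mem_iota add0n ltnS.
exact: leq_pmulr.
Qed.

Lemma prime_all p :
  prime p = (1 < p) && all (fun d => ~~ ((d %| p) && (1 < d))) (iota 0 p).
Proof.
apply/primeP/andP => -[p_gt1 pP]; split=> //.
  apply/allP => d; rewrite mem_iota => /andP[_ dp].
  by apply/negP => /andP[/pP/orP[]/eqP dE]; lia.
move=> d dp; have d_gt0 : 0 < d by apply: dvdn_gt0 dp; lia.
have := dvdn_leq (ltnW p_gt1) dp; rewrite leq_eqVlt => /predU1P[->|ltdp].
  by rewrite eqxx orbT.
have /allP/(_ d) := pP; rewrite mem_iota dp /= => /(_ ltdp); lia.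
Qed.

Lemma recursive_prime : recursive1 (fun p => prime p).
Proof.
have r : recursive3 (fun d p _ => ~~ ((d %| p) && (1 < d))).
  by recursive_arith; apply: (recursive_comp2 recursive_dvdn); recursive_arith.
have : recursive (fun v : 1.-tuple nat => (1 < tnth v (inord 0)) &&
    all (fun d => ~~ ((d %| tnth v (inord 0)) && (1 < d)))
      (iota 0 (tnth v (inord 0)))).
  recursive_arith; apply: (@recursive_comp3 _ _ _ _ (fun=> 0) (recursive_all r));
  by recursive_arith.
by move/eq_recursive=> h; apply/recursive1P; apply: h => v; rewrite -prime_all.
Qed.

Lemma recursive_next_prime : recursive1 next_prime.
Proof.
have r : recursive2 (fun n _ => next_prime n).
  apply: (@recursive_min (fun m n _ => ~~ ((n < m) && prime m))).
  - by recursive_arith; apply: (recursive_comp1 recursive_prime); recursive_arith.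
  - by move=> n _; rewrite /next_prime; case: ex_minnP => m ->.
  - move=> n _ m; rewrite /next_prime; case: ex_minnP => p _ pmin mp.
    by case: (boolP (_ && _)) => // /pmin; rewrite leqNgt mp.
apply/recursive1P.
by apply: (@recursive_comp2 _ _ _ (fun=> 0) r); recursive_arith.
Qed.

Lemma recursive_nth_prime : recursive1 nth_prime.
Proof.
have r : recursive3 (fun n _ _ => nth_prime n).
  apply: (@recursive_prim (fun _ _ => 2) (fun r _ _ _ => next_prime r)) => //.
    exact: recursive_const.
  by apply: (recursive_comp1 recursive_next_prime); recursive_arith.
apply/recursive1P.
by apply: (@recursive_comp3 _ _ _ (fun=> 0) (fun=> 0) r); recursive_arith.
Qed.

Lemma nth_primeS i : (nth_prime i < nth_prime i.+1) && prime (nth_prime i.+1).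
Proof. by rewrite /nth_prime iterS /next_prime; case: ex_minnP. Qed.

Lemma prime_nth_prime i : prime (nth_prime i).
Proof. by case: i => // i; case/andP: (nth_primeS i). Qed.

Lemma ltn_nth_prime : {mono nth_prime : i j / i < j}.
Proof.
by apply: leqW_mono; apply: leq_mono; apply: homo_ltn => // [? ? ?|i];
  [exact: ltn_trans|case/andP: (nth_primeS i)].
Qed.

Lemma nth_prime_inj : injective nth_prime.
Proof.
move=> i j eq_ij; have := ltn_nth_prime i j; have := ltn_nth_prime j i.
rewrite eq_ij ltnn; lia.
Qed.

Lemma ltn_id_nth_prime i : i < nth_prime i.
Proof. by elim: i => // i IH; apply: leq_ltn_trans IH _; case/andP: (nth_primeS i). Qed.

Lemma nth_prime_surj p : prime p -> exists i, p = nth_prime i.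
Proof.
move=> pp; have ex : exists i, p <= nth_prime i.
  by exists p; exact/ltnW/ltn_id_nth_prime.
case: (ex_minnP ex) => -[|i] pi imin.
  by exists 0; apply/eqP; rewrite eqn_leq pi prime_gt1.
exists i.+1; apply/eqP; rewrite eqn_leq pi /=.
have lt_ip : nth_prime i < p by rewrite ltnNge; apply/negP => /imin; rewrite ltnn.
change (next_prime (nth_prime i) <= p); rewrite /next_prime.
by case: ex_minnP => q _; apply; rewrite lt_ip.
Qed.

Lemma seqcode_rcons (u : seq nat) n :
  seqcode (rcons u n) = seqcode u * nth_prime (size u) ^ n.+1.
Proof.
rewrite /seqcode size_rcons big_ord_recr /= nth_rcons ltnn eqxx; congr (_ * _).
by apply: eq_bigr => i _; rewrite nth_rcons ltn_ord.
Qed.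

Lemma seqcode_gt0 (u : seq nat) : 0 < seqcode u.
Proof.
elim/last_ind: u => [|u n IH]; first by rewrite /seqcode big_ord0.
by rewrite seqcode_rcons muln_gt0 IH expn_gt0 prime_gt0 ?prime_nth_prime.
Qed.

Lemma logn_seqcode (u : seq nat) i : logn (nth_prime i) (seqcode u) =
  if i < size u then (nth 0%N u i).+1 else 0.
Proof.
elim/last_ind: u => [|u n IH]; first by rewrite /seqcode big_ord0 logn1.
rewrite seqcode_rcons lognM ?seqcode_gt0 ?expn_gt0 ?prime_gt0 ?prime_nth_prime//.
rewrite IH lognX logn_prime ?prime_nth_prime // (inj_eq nth_prime_inj).
rewrite size_rcons nth_rcons ltnS; case: (ltngtP i (size u)) => //=; lia.
Qed.

Lemma coord_seqcode (u : seq nat) i : coord (seqcode u) i = nth 0%N u i.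
Proof.
rewrite /coord; case: xgetP => [v _ [u' [uE iu' ->]]|nex].
  have := congr1 (logn (nth_prime i)) uE; rewrite !logn_seqcode iu'.
  by case: ifP => // _ [].
case: (ltnP i (size u)) => iu; last by rewrite nth_default.
by case: (nex (nth 0%N u i)); exists u.
Qed.

(* [s] codes a sequence: the primes dividing it form an initial segment. *)
Definition is_seqcode (s : nat) : bool :=
  (0 < s) && all (fun i => ~~ ((nth_prime i.+1 %| s) && ~~ (nth_prime i %| s))) (iota 0 s).

(** The sequence is read off from the exponents, up to the first prime that does not divide [s].
    Testing indices below [s] is enough because [nth_prime i] exceeds [i], so no later prime divides
    [s]. *)
Lemma is_seqcodeP s : reflect (exists u, s = seqcode u) (is_seqcode s).
Proof.
apply: (iffP andP) => [[s_gt0 sP]|[u ->]]; last first.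
  split; first exact: seqcode_gt0.
  have dvdE i : (nth_prime i %| seqcode u) = (i < size u).
    rewrite -[nth_prime i]expn1 pfactor_dvdn ?prime_nth_prime ?seqcode_gt0//.
    by rewrite logn_seqcode; case: ifP.
  by apply/allP => i _; rewrite !dvdE; lia.
have ex : exists k, ~~ (nth_prime k %| s).
  exists s; apply/negP => /(dvdn_leq s_gt0).
  by rewrite leqNgt ltn_id_nth_prime.
case: (ex_minnP ex) => k kn kmin.
exists (mkseq (fun i => (logn (nth_prime i) s).-1) k).
apply: eqn_from_log => //; first exact: seqcode_gt0.
move=> p; have [/nth_prime_surj[i ->{p}]|np] := boolP (prime p); last first.
  by rewrite /logn (negbTE np).
have lognE i' : (0 < logn (nth_prime i') s) = (nth_prime i' %| s).
  by rewrite -pfactor_dvdn ?prime_nth_prime ?expn1.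
rewrite logn_seqcode size_mkseq; case: ltnP => ik.
  rewrite nth_mkseq // prednK // lognE; apply/negPn/negP => /kmin.
  by rewrite leqNgt ik.
apply/eqP; rewrite -leqn0 leqNgt lognE.
elim: i ik => [|i IH]; first by rewrite leqn0 => /eqP <-.
rewrite leq_eqVlt => /predU1P[<- //|/IH ni].
apply/negP => di; have lt_is : i < s.
  by apply: leq_trans (dvdn_leq s_gt0 di); exact/ltnW/ltn_id_nth_prime.
by have /allP/(_ i) := sP; rewrite di ni mem_iota lt_is => /(_ isT).
Qed.

(** Replaces the choice operator in [coord] by arithmetic, from which recursiveness follows. *)
Lemma coordE s i :
  coord s i = if is_seqcode s then (logn (nth_prime i) s).-1 else 0.
Proof.
case: is_seqcodeP => [[u ->]|nu].
  rewrite coord_seqcode logn_seqcode; case: ltnP => // iu.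
  by rewrite nth_default.
by rewrite /coord; case: xgetP => // v _ [u [sE _ _]]; case: nu; exists u.
Qed.

Lemma recursive_logn_nth_prime : recursive2 (fun i s => logn (nth_prime i) s).
Proof.
(* The guard [0 < s] makes the search stop at once for [s = 0], which every prime power divides and
   where [logn] is [0]. *)
apply: (@recursive_min (fun m i s => (0 < s) && (nth_prime i ^ m.+1 %| s))).
- recursive_arith; apply: (recursive_comp2 recursive_dvdn); recursive_arith.
  by apply: (recursive_comp1 recursive_nth_prime); recursive_arith.
- move=> i s; case: posnP => //= s_gt0.
  by rewrite pfactor_dvdn ?prime_nth_prime ?ltnn.
- move=> i s m; case: (posnP s) => [->|s_gt0]; first by rewrite logn0.
  by rewrite pfactor_dvdn ?prime_nth_prime //= => ->.
Qed.

Lemma recursive_is_seqcode : recursive1 (fun s => is_seqcode s).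
Proof.
have r : recursive3 (fun i s _ => ~~ ((nth_prime i.+1 %| s) && ~~ (nth_prime i %| s))).
  by recursive_arith; apply: (recursive_comp2 recursive_dvdn); recursive_arith;
    apply: (recursive_comp1 recursive_nth_prime); recursive_arith.
apply/recursive1P; rewrite /is_seqcode; recursive_arith.
by apply: (@recursive_comp3 _ _ _ _ (fun=> 0) (recursive_all r)); recursive_arith.
Qed.

Lemma recursive_coord : recursive2 coord.
Proof.
have : recursive2 (fun s i =>
    if is_seqcode s then (logn (nth_prime i) s).-1 else 0).
  apply: recursive_if; recursive_arith.
    by apply: (recursive_comp1 recursive_is_seqcode); recursive_arith.
  by apply: (recursive_comp2 recursive_logn_nth_prime); recursive_arith.
by move/eq_recursive; apply => v; rewrite coordE.
Qed.

Definition pair_code (i j : nat) : nat := seqcode [:: i; j].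

Lemma coord_pair i j :
  (coord (pair_code i j) 0 = i) * (coord (pair_code i j) 1 = j).
Proof. by rewrite /pair_code !coord_seqcode. Qed.

Lemma recursive_pair_code : recursive2 pair_code.
Proof.
have : recursive2 (fun i j => nth_prime 0 ^ i.+1 * nth_prime 1 ^ j.+1).
  by recursive_arith.
by move/eq_recursive; apply => v; rewrite /pair_code /seqcode !big_ord_recl big_ord0 muln1.
Qed.

Lemma recursive_half : recursive1 half.
Proof.
have r : recursive2 (fun x _ => x./2).
  apply: (@recursive_min (fun m x _ => ~~ (x < 2 * m + 2))); first by recursive_arith.
    by move=> x _; case: ltnP => //; lia.
  by move=> x _ m mx; case: ltnP => //; lia.
by apply/recursive1P; apply: (@recursive_comp2 _ _ _ (fun=> 0) r); recursive_arith.
Qed.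

(** * Function-quantifier normal forms *)

(* Coding all contexts by single functions lets one class of terms with an oracle
   serve for every kind and number of parameters. *)
Class context (C : Type) := encode : C -> baire.

#[export] Instance context_nat : context nat := fun n _ => n.
#[export] Instance context_baire : context baire := fun b => b.
#[export] Instance context_prod (C D : Type) `{context C} `{context D} :
  context (C * D) :=
  fun p n => if odd n then encode p.2 n./2 else encode p.1 n./2.

(** Each term makes a fixed number of queries, and recursion is confined to the recursive functions
    inside it. Unbounded use of the oracle is left to the quantifiers of [analytic], so this small
    class is enough and remains easy to approximate. *)
Inductive oracle_term : (baire -> nat) -> Prop :=
| oracle_const n : oracle_term (fun=> n)
| oracle_query T : oracle_term T -> oracle_term (fun b => b (T b))
| oracle_rec2 h T U : recursive2 h -> oracle_term T -> oracle_term U ->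
    oracle_term (fun b => h (T b) (U b)).

Lemma oracle_rec1 h T : recursive1 h -> oracle_term T ->
  oracle_term (fun b => h (T b)).
Proof.
move=> rh oT; apply: (@oracle_rec2 (fun x _ => h x) T T) => //.
by apply: (recursive_comp1 rh); recursive_arith.
Qed.

Ltac oracle_step :=
  lazy beta;
  lazymatch goal with
  | |- oracle_term (fun b => addn (@?f b) (@?g b)) =>
      apply: (@oracle_rec2 addn f g recursive_addn)
  | |- oracle_term (fun b => muln (@?f b) (@?g b)) =>
      apply: (@oracle_rec2 muln f g recursive_muln)
  | |- oracle_term (fun b => subn (@?f b) (@?g b)) =>
      apply: (@oracle_rec2 subn f g recursive_subn)
  | |- oracle_term (fun b => half (@?f b)) =>
      apply: (@oracle_rec1 half f recursive_half)
  | |- oracle_term (fun b => b (@?f b)) => apply: (@oracle_query f)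
  | |- oracle_term _ => first [assumption | exact: oracle_const]
  end.

Ltac oracle := repeat oracle_step.

(** Parity separates the two halves of an encoded pair, so this is the branching that pairs
    require. *)
Lemma oracle_if T A B : oracle_term T -> oracle_term A -> oracle_term B ->
  oracle_term (fun b => if odd (T b) then A b else B b).
Proof.
move=> oT oA oB.
have : oracle_term (fun b => (T b - 2 * (T b)./2) * A b +
    (1 - (T b - 2 * (T b)./2)) * B b) by oracle.
congr oracle_term; apply/funext => b.
have -> : T b - 2 * (T b)./2 = odd (T b).
  by rewrite -{1}(odd_double_half (T b)); lia.
by case: odd; rewrite ?mul1n ?mul0n ?addn0.
Qed.

Lemma encode_pairE (C D : Type) `{context C} `{context D} (p : C * D) n :
  encode p n = if odd n then encode p.2 n./2 else encode p.1 n./2.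
Proof. by []. Qed.

Lemma encode_fst (C D : Type) `{context C} `{context D} (p : C * D) n :
  encode p (2 * n) = encode p.1 n.
Proof. by rewrite encode_pairE mul2n odd_double doubleK. Qed.

Lemma encode_snd (C D : Type) `{context C} `{context D} (p : C * D) n :
  encode p (2 * n + 1) = encode p.2 n.
Proof. by rewrite encode_pairE mul2n addn1 /= odd_double uphalf_double. Qed.

Lemma encode_baire (b : baire) : encode b = b. Proof. by []. Qed.

Lemma oracle_pair K T : oracle_term K -> oracle_term T ->
  oracle_term (fun b : baire => K (encode (b, T b))).
Proof.
move=> oK oT; elim: {K} oK => [n|K oK IH|h K L rh _ IHK _ IHL].
- exact: oracle_const.
- apply: (@oracle_if (fun b => K (encode (b, T b))) T
    (fun b => b (K (encode (b, T b)))./2)) => //.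
  exact/oracle_query/(oracle_rec1 recursive_half).
- exact: (oracle_rec2 rh IHK IHL).
Qed.

(** The engine of composition: an intermediate context becomes an oracle whose answers are computed
    by [K] from the original one. *)
Lemma oracle_subst T K : oracle_term T -> oracle_term K ->
  oracle_term (fun b : baire => T (fun m : nat => K (encode (b, m)))).
Proof.
move=> oT oK; elim: {T} oT => [n|T oT IH|h T U rh _ IHT _ IHU].
- exact: oracle_const.
- exact: (oracle_pair oK IH).
- exact: (oracle_rec2 rh IHT IHU).
Qed.

(** The position [n] is packed into the context, so that a term with an oracle and no further input
    can compute the whole encoding of [phi c]. *)
Definition morph (C D : Type) `{context C} `{context D} (phi : C -> D) : Prop :=
  exists2 T, oracle_term T & forall c (n : nat), encode (phi c) n = T (encode (c, n)).

(** * Closure properties of maps computed by oracle terms *)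

Section Morph.
Context {C : Type} `{context C}.

Lemma oracle_set_snd T t : oracle_term T -> oracle_term t ->
  exists2 U, oracle_term U &
    forall (c : C) (n : nat), U (encode (c, n)) = T (encode (c, t (encode (c, n)))).
Proof.
move=> oT ot.
have ofst : oracle_term (fun b => t (fun j => b (2 * j))).
  have o1 : oracle_term (fun b => b (2 * (2 * b 1))) by oracle.
  have := oracle_subst ot o1; congr oracle_term; apply/funext => b.
  congr t; apply/funext => j; rewrite (encode_fst (b, j)).
  by rewrite (encode_snd (b, j) 0).
(* Here [b 1] is the position queried in the pair: odd positions belong to the second component and
   now answer [t], even ones are passed on unchanged. *)
pose K (b : baire) := if odd (b 1) then t (fun j => b (2 * j)) else b (2 * b 1).
have oK : oracle_term K by apply: oracle_if; oracle.
exists (fun b : baire => T (fun m : nat => K (encode (b, m)))).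
  exact: oracle_subst.
move=> c n; congr T; apply/funext => m; rewrite /K.
rewrite (encode_snd (encode (c, n), m) 0) (encode_fst (encode (c, n), m)).
rewrite [RHS]encode_pairE; case: ifP => modd.
  change (t (fun j : nat => encode (encode (c, n), m) (2 * j)) = t (encode (c, n))).
  by congr t; apply/funext => j; rewrite (encode_fst (encode (c, n), m)).
by rewrite [LHS]encode_pairE /= modd.
Qed.

Lemma morph_id : morph (@id C).
Proof.
exists (fun b => b (2 * b 1)); first by oracle.
by move=> c n; rewrite (encode_fst (c, n)) (encode_snd (c, n) 0).
Qed.

Lemma morph_constn (m : nat) : morph (fun _ : C => m).
Proof. by exists (fun _ : baire => m) => //; oracle. Qed.

Lemma morph_rec1 h (f : C -> nat) :
  recursive1 h -> morph f -> morph (fun c => h (f c)).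
Proof.
move=> rh [T oT TE]; exists (fun b => h (T b)); first exact: oracle_rec1.
by move=> c n; rewrite -TE.
Qed.

Lemma morph_rec2 h (f g : C -> nat) :
  recursive2 h -> morph f -> morph g -> morph (fun c => h (f c) (g c)).
Proof.
move=> rh [T oT TE] [U oU UE].
exists (fun b => h (T b) (U b)); first exact: oracle_rec2.
by move=> c n; rewrite -TE -UE.
Qed.

Lemma morph_app (f : C -> baire) (t : C -> nat) :
  morph f -> morph t -> morph (fun c => f c (t c)).
Proof.
move=> [T oT TE] [U oU UE]; have [V oV VE] := oracle_set_snd oT oU.
by exists V => // c n; rewrite VE -TE -UE.
Qed.

(** A function is its own encoding, so the position asked of [f c] may become the second half of the
    context. The term [K] below rebuilds the encoding of [((c, n), 0)] from that of [(c, n)]. *)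
Lemma morph_lam (f : C -> baire) :
  morph (fun p : C * nat => f p.1 p.2) -> morph f.
Proof.
move=> [T oT TE].
pose K (b : baire) := if odd (b 1) then 0 else b (2 * (b 1)./2).
have oK : oracle_term K by apply: oracle_if; oracle.
exists (fun b : baire => T (fun m : nat => K (encode (b, m)))).
  exact: oracle_subst.
move=> c n; have := TE (c, n) 0; rewrite {1}/encode /context_nat /= => fE.
rewrite {1}/encode /context_baire fE; congr T; apply/funext => m; rewrite /K.
by rewrite (encode_snd (_, m) 0) (encode_fst (_, m)).
Qed.

Lemma morph_rec (f : baire) : recursive1 f -> morph (fun _ : C => f).
Proof.
move=> rf; exists (fun b => f (b 1)); first by apply: oracle_rec1 => //; oracle.
by move=> c n; rewrite (encode_snd (c, n) 0).
Qed.

Context {D E : Type} `{context D} `{context E}.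

Lemma morph_pair (phi : C -> D) (psi : C -> E) :
  morph phi -> morph psi -> morph (fun c => (phi c, psi c)).
Proof.
move=> [T oT TE] [U oU UE].
have oh : oracle_term (fun b => (b 1)./2) by oracle.
have [T' oT' T'E] := oracle_set_snd oT oh.
have [U' oU' U'E] := oracle_set_snd oU oh.
exists (fun b => if odd (b 1) then U' b else T' b); first by apply: oracle_if; oracle.
by move=> c n; rewrite T'E U'E -TE -UE (encode_snd (c, n) 0).
Qed.

End Morph.

Section MorphComp.
Context {C D E : Type} `{context C} `{context D} `{context E}.

Lemma morph_comp (phi : C -> D) (psi : D -> E) :
  morph phi -> morph psi -> morph (fun c => psi (phi c)).
Proof.
move=> [T oT TE] [U oU UE].
(* From the encoding of [(c, n)] and a position [m], [K1] produces the encoding of [(c, m./2)], on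
   which [T] computes [phi c] at [m./2]; [K] then assembles the encoding of [(phi c, n)], the oracle
   expected by [U]. *)
pose K1 (a : baire) := if odd (a 1) then (a (2 * 1))./2 else a (2 * (2 * a 1)).
have oK1 : oracle_term K1 by apply: oracle_if; oracle.
have oT' := oracle_subst oT oK1; set T' := (fun b : baire => T _) in oT'.
pose K (b : baire) := if odd (b 1) then b (2 * 1) else T' b.
have oK : oracle_term K by apply: oracle_if => //; oracle.
exists (fun b : baire => U (fun m : nat => K (encode (b, m)))).
  exact: oracle_subst.
move=> c n; rewrite UE; congr U; apply/funext => m; rewrite /K.
set e := encode (c, n); rewrite (encode_snd (e, m) 0) [LHS]encode_pairE /=.
rewrite /T'; case: ifP => _.
  by rewrite (encode_fst (e, m) 1); exact/esym/(encode_snd (c, n) 0).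
rewrite TE; congr T; apply/funext => j; rewrite /K1 (encode_snd (_, j) 0).
rewrite (encode_fst (_, j) 1) (encode_fst (_, j)) !encode_baire /=.
rewrite (encode_snd (e, m) 0) (encode_fst (e, m)) !encode_baire.
rewrite [LHS]encode_pairE /=; case: ifP => oj //.
by rewrite /e encode_pairE oj.
Qed.

End MorphComp.

Lemma recursive_odd : recursive1 (fun n => odd n).
Proof.
have : recursive (fun v : 1.-tuple nat => tnth v (inord 0) - 2 * half (tnth v (inord 0))).
  by recursive_arith; apply: (recursive_comp1 recursive_half); recursive_arith.
move/eq_recursive => h; apply/recursive1P; apply: h => v.
by have := odd_double_half (tnth v (inord 0)); lia.
Qed.

Section MorphDerived.
Context {C : Type} `{context C}.

Lemma morph_fst {D E : Type} `{context D} `{context E} (f : C -> D * E) :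
  morph f -> morph (fun c => (f c).1).
Proof.
move=> mf; apply: (morph_comp mf); exists (fun b => b (2 * (2 * b 1))).
  by oracle.
by move=> p n; rewrite (encode_snd (p, n) 0) (encode_fst (p, n)) (encode_fst p).
Qed.

Lemma morph_snd {D E : Type} `{context D} `{context E} (f : C -> D * E) :
  morph f -> morph (fun c => (f c).2).
Proof.
move=> mf; apply: (morph_comp mf); exists (fun b => b (2 * (2 * b 1 + 1))).
  by oracle.
by move=> p n; rewrite (encode_snd (p, n) 0) (encode_fst (p, n)) (encode_snd p).
Qed.

Lemma morph_bool_if (p : C -> bool) (f g : C -> nat) :
  morph (fun c => nat_of_bool (p c)) -> morph f -> morph g ->
  morph (fun c => if p c then f c else g c).
Proof.
move=> mp mf mg.
have : morph (fun c => p c * f c + (1 - p c) * g c).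
  by repeat first [ exact: (morph_rec2 recursive_addn) | exact: morph_constn
    | apply: (morph_rec2 recursive_addn) | apply: (morph_rec2 recursive_muln)
    | apply: (morph_rec2 recursive_subn)].
congr morph; apply/funext => c.
by case: (p c); rewrite ?mul1n ?mul0n ?addn0.
Qed.

Lemma morph_andb (p q : C -> bool) :
  morph (fun c => nat_of_bool (p c)) -> morph (fun c => nat_of_bool (q c)) ->
  morph (fun c => nat_of_bool (p c && q c)).
Proof.
move=> mp mq; have := morph_rec2 recursive_muln mp mq.
by congr morph; apply/funext => c; rewrite mulnb.
Qed.

Lemma morph_negb (p : C -> bool) :
  morph (fun c => nat_of_bool (p c)) -> morph (fun c => nat_of_bool (~~ p c)).
Proof.
move=> mp; have := morph_rec2 recursive_subn (morph_constn 1) mp.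
by congr morph; apply/funext => c; case: (p c).
Qed.

Lemma morph_orb (p q : C -> bool) :
  morph (fun c => nat_of_bool (p c)) -> morph (fun c => nat_of_bool (q c)) ->
  morph (fun c => nat_of_bool (p c || q c)).
Proof.
move=> mp mq; have := morph_negb (morph_andb (morph_negb mp) (morph_negb mq)).
by congr morph; apply/funext => c; rewrite negb_and !negbK.
Qed.

Lemma morph_all_ord m (p : 'I_m -> C -> bool) :
  (forall i, morph (fun c => nat_of_bool (p i c))) ->
  morph (fun c => nat_of_bool [forall i, p i c]).
Proof.
move=> mp; have : morph (fun c => nat_of_bool (all (p^~ c) (enum 'I_m))).
  by elim: (enum _) => [|i e IH]; [exact: morph_constn|exact: morph_andb].
congr morph; apply/funext => c; congr nat_of_bool.
apply/allP/forallP => [h i|h i _]; last exact: h.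
by apply: h; rewrite mem_enum.
Qed.

End MorphDerived.

(* A hook, extended below whenever a new operation is shown to be recursive. *)
Ltac morph_extra := fail.

Ltac morph_hyp :=
  lazymatch goal with
  | |- morph (fun x => ?z (@?t x)) =>
    match goal with mz : morph z |- _ =>
      apply: (@morph_comp _ _ _ _ _ _ t z _ mz)
    end
  end.

Ltac morph_hyp2 :=
  lazymatch goal with
  | |- morph (fun x => ?z (@?s x) (@?t x)) =>
    match goal with mz : morph (fun p => z (fst p) (snd p)) |- _ =>
      apply: (@morph_comp _ _ _ _ _ _ (fun x => (s x, t x)) _ _ mz)
    end
  end.

Ltac morph_apply :=
  lazymatch goal with
  | |- @morph ?C _ _ _ ?F =>
    let f := constr:(fun x : C => ltac:(
      let b := eval lazy beta in (F x) in
      lazymatch b with ?g _ => exact (g : baire) end)) in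
    let t := constr:(fun x : C => ltac:(
      let b := eval lazy beta in (F x) in
      lazymatch b with _ ?t => exact t end)) in
    apply: (@morph_app C _ f t)
  end.

Ltac morph_step :=
  lazy beta;
  lazymatch goal with
  | |- morph (fun c => c) => exact: morph_id
  | |- morph fst => exact: (@morph_fst _ _ _ _ _ _ id morph_id)
  | |- morph snd => exact: (@morph_snd _ _ _ _ _ _ id morph_id)
  | |- morph (fun c => (@?f c, @?g c)) => apply: (@morph_pair _ _ _ _ _ _ f g)
  | |- morph (fun c => fst (@?f c)) => apply: (@morph_fst _ _ _ _ _ _ f)
  | |- morph (fun c => snd (@?f c)) => apply: (@morph_snd _ _ _ _ _ _ f)
  | |- morph (fun c => S (@?f c)) => apply: (@morph_rec1 _ _ S f recursive_succ)
  | |- morph (fun c => predn (@?f c)) =>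
      apply: (@morph_rec1 _ _ predn f recursive_predn)
  | |- morph (fun c => nat_of_bool (odd (@?f c))) =>
      apply: (@morph_rec1 _ _ odd f recursive_odd)
  | |- morph (fun c => half (@?f c)) =>
      apply: (@morph_rec1 _ _ half f recursive_half)
  | |- morph (fun c => nth_prime (@?f c)) =>
      apply: (@morph_rec1 _ _ nth_prime f recursive_nth_prime)
  | |- morph (fun c => addn (@?f c) (@?g c)) =>
      apply: (@morph_rec2 _ _ addn f g recursive_addn)
  | |- morph (fun c => muln (@?f c) (@?g c)) =>
      apply: (@morph_rec2 _ _ muln f g recursive_muln)
  | |- morph (fun c => subn (@?f c) (@?g c)) =>
      apply: (@morph_rec2 _ _ subn f g recursive_subn)
  | |- morph (fun c => expn (@?f c) (@?g c)) =>
      apply: (@morph_rec2 _ _ expn f g recursive_expn)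
  | |- morph (fun c => coord (@?f c) (@?g c)) =>
      apply: (@morph_rec2 _ _ coord f g recursive_coord)
  | |- morph (fun c => pair_code (@?f c) (@?g c)) =>
      apply: (@morph_rec2 _ _ pair_code f g recursive_pair_code)
  | |- morph (fun c => nat_of_bool (leq (@?f c) (@?g c))) =>
      apply: (@morph_rec2 _ _ leq f g recursive_leq)
  | |- morph (fun c => nat_of_bool (@eq_op Datatypes_nat__canonical__eqtype_Equality
        (@?f c) (@?g c))) =>
      apply: (@morph_rec2 _ _ (fun m n => m == n) f g recursive_eqn)
  | |- morph (fun c => nat_of_bool (~~ (@?p c))) => apply: (@morph_negb _ _ p)
  | |- morph (fun c => nat_of_bool (@?p c && @?q c)) =>
      apply: (@morph_andb _ _ p q)
  | |- morph (fun c => nat_of_bool (@?p c || @?q c)) =>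
      apply: (@morph_orb _ _ p q)
  | |- morph (fun c n => _) => apply: morph_lam
  | _ => first [ assumption | morph_extra | morph_hyp | morph_hyp2 | morph_apply
     | exact: morph_constn | apply: morph_rec; assumption ]
  end.

Ltac morph := repeat morph_step.

(** The normal form of lightface analytic predicates: one function quantifier, one number quantifier
    and a matrix with boundedly many queries. *)
Definition analytic (C : Type) `{context C} (P : C -> Prop) : Prop :=
  exists2 S : C * baire * nat -> nat, morph S &
    forall c, P c <-> exists d : baire, forall n, S (c, d, n) = 0.

Definition bianalytic (C : Type) `{context C} (P : C -> Prop) : Prop :=
  analytic P /\ analytic (fun c => ~ P c).

(** * Closure of analytic and bianalytic predicates under logical operations *)

Section Analytic.
Context {C : Type} `{context C}.
Implicit Types P Q : C -> Prop.

Lemma analytic_ext P Q : analytic P -> (forall c, P c <-> Q c) -> analytic Q.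
Proof. by move=> [S mS PE] PQ; exists S => // c; rewrite -PQ. Qed.

Lemma analytic_bool (p : C -> bool) :
  morph (fun c => nat_of_bool (p c)) -> analytic (fun c => p c).
Proof.
move=> mp; exists (fun x => ~~ p x.1.1).
  apply: morph_negb; apply: (@morph_comp _ _ _ _ _ _ (fun x => x.1.1) _ _ mp).
  by morph.
by move=> c /=; split=> [pc|[_ /(_ 0)]]; [exists id => n; rewrite pc|case: (p c)].
Qed.

Lemma analytic_subst {D : Type} `{context D} (P : D -> Prop) (phi : C -> D) :
  morph phi -> analytic P -> analytic (fun c => P (phi c)).
Proof.
move=> mphi [S mS PE]; exists (fun x => S (phi x.1.1, x.1.2, x.2)).
  apply: (@morph_comp _ _ _ _ _ _ (fun x => (phi x.1.1, x.1.2, x.2)) S _ mS).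
  by morph; apply: (morph_comp _ mphi); morph.
by move=> c; rewrite PE.
Qed.

Lemma analytic_and P Q :
  analytic P -> analytic Q -> analytic (fun c => P c /\ Q c).
Proof.
move=> [S mS PE] [T mT QE].
(* The two witnesses are interleaved in one function, and a sum of naturals vanishes exactly when
   both terms do. *)
exists (fun x => S (x.1.1, fun n => x.1.2 (2 * n), x.2) +
                 T (x.1.1, fun n => x.1.2 (2 * n + 1), x.2)).
  apply: (morph_rec2 recursive_addn).
    apply: (@morph_comp _ _ _ _ _ _
      (fun x => (x.1.1, (fun n => x.1.2 (2 * n)) : baire, x.2)) S _ mS).
    by morph.
  apply: (@morph_comp _ _ _ _ _ _
    (fun x => (x.1.1, (fun n => x.1.2 (2 * n + 1)) : baire, x.2)) T _ mT).
  by morph.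
move=> c; rewrite PE QE /=; split=> [[[d dS] [e eT]]|[d dST]].
  exists (fun n => if odd n then e n./2 else d n./2) => n.
  have -> : (fun m => if odd (2 * m) then e (2 * m)./2 else d (2 * m)./2) = d.
    by apply/funext => m; rewrite mul2n odd_double doubleK.
  have -> : (fun m => if odd (2 * m + 1) then e (2 * m + 1)./2 else d (2 * m + 1)./2) = e.
    by apply/funext => m; rewrite mul2n addn1 /= odd_double uphalf_double.
  by rewrite dS eT.
split; [exists (fun n => d (2 * n))|exists (fun n => d (2 * n + 1))] => n;
  by have /eqP := dST n; rewrite addn_eq0 => /andP[/eqP ? /eqP].
Qed.

Lemma analytic_ex_baire (P : C -> baire -> Prop) :
  analytic (fun p : C * baire => P p.1 p.2) ->
  analytic (fun c => exists b, P c b).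
Proof.
move=> [S mS PE].
exists (fun x => S (x.1.1, fun n => x.1.2 (2 * n), fun n => x.1.2 (2 * n + 1), x.2)).
  apply: (@morph_comp _ _ _ _ _ _ (fun x => (x.1.1, (fun n => x.1.2 (2 * n)) : baire,
    (fun n => x.1.2 (2 * n + 1)) : baire, x.2)) S _ mS).
  by morph.
move=> c; split=> [[b]|[d dS]]; last first.
  by exists (fun n => d (2 * n)); apply/(PE (_, _)); exists (fun n => d (2 * n + 1)).
move/(PE (_, _)) => [d dS].
exists (fun n => if odd n then d n./2 else b n./2) => n /=.
have -> : (fun m => if odd (2 * m) then d (2 * m)./2 else b (2 * m)./2) = b.
  by apply/funext => m; rewrite mul2n odd_double doubleK.
have -> : (fun m => if odd (2 * m + 1) then d (2 * m + 1)./2 else b (2 * m + 1)./2) = d.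
  by apply/funext => m; rewrite mul2n addn1 /= odd_double uphalf_double.
exact: dS.
Qed.

(** By countable choice, the witnesses for all [m] are stored in one function at the positions
    [pair_code m n]; the two number quantifiers merge into one. *)
Lemma analytic_all (P : C -> nat -> Prop) :
  analytic (fun p : C * nat => P p.1 p.2) -> analytic (fun c => forall m, P c m).
Proof.
move=> [S mS PE].
exists (fun x => S (x.1.1, coord x.2 0, fun n => x.1.2 (pair_code (coord x.2 0) n),
                    coord x.2 1)).
  apply: (@morph_comp _ _ _ _ _ _ (fun x => (x.1.1, coord x.2 0,
    (fun n => x.1.2 (pair_code (coord x.2 0) n)) : baire, coord x.2 1)) S _ mS).
  by morph.
move=> c; split=> [cP|[d dS] m].
  have /choice[d dP] m : exists d : baire, forall n, S (c, m, d, n) = 0.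
    exact/(PE (c, m))/cP.
  exists (fun k => d (coord k 0) (coord k 1)) => n /=.
  have -> : (fun n0 => d (coord (pair_code (coord n 0) n0) 0)
      (coord (pair_code (coord n 0) n0) 1)) = d (coord n 0).
    by apply/funext => j; rewrite !coord_pair.
  exact: dP.
apply/(PE (_, _)); exists (fun n => d (pair_code m n)) => n.
by have := dS (pair_code m n); rewrite /= !coord_pair.
Qed.

End Analytic.

Section AnalyticClosure.
Context {C : Type} `{context C}.
Implicit Types P Q : C -> Prop.

Lemma analytic_ex (P : C -> nat -> Prop) :
  analytic (fun p : C * nat => P p.1 p.2) -> analytic (fun c => exists m, P c m).
Proof.
move=> aP; have : analytic (fun c => exists b : baire, P c (b 0)).
  apply: analytic_ex_baire.
  apply: (@analytic_subst _ _ _ _ _ (fun p : C * baire => (p.1, p.2 0)) _ aP).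
  by morph.
move/analytic_ext; apply => c; split=> [[b]|[m]]; first by exists (b 0).
by exists (fun=> m).
Qed.

(** A guessed number tells which disjunct the witness is for. *)
Lemma analytic_or P Q :
  analytic P -> analytic Q -> analytic (fun c => P c \/ Q c).
Proof.
move=> [S mS PE] [T mT QE].
have mS0 : morph (fun x : C * nat * baire * nat => S (x.1.1.1, x.1.2, x.2)).
  apply: (@morph_comp _ _ _ _ _ _
    (fun x : C * nat * baire * nat => (x.1.1.1, x.1.2, x.2)) S _ mS); by morph.
have mT0 : morph (fun x : C * nat * baire * nat => T (x.1.1.1, x.1.2, x.2)).
  apply: (@morph_comp _ _ _ _ _ _
    (fun x : C * nat * baire * nat => (x.1.1.1, x.1.2, x.2)) T _ mT); by morph.
have : analytic (fun c => exists m : nat, if m == 0 then P c else Q c).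
  apply: analytic_ex; exists (fun x : C * nat * baire * nat =>
      if x.1.1.2 == 0 then S (x.1.1.1, x.1.2, x.2) else T (x.1.1.1, x.1.2, x.2)).
    by apply: morph_bool_if => //; morph.
  by move=> [c [|m]] /=; [exact: PE|exact: QE].
move/analytic_ext; apply => c; split=> [[[|m]]|[Pc|Qc]]; [by left|by right| |].
  by exists 0.
by exists 1.
Qed.

Lemma bianalytic_analytic P : bianalytic P -> analytic P.
Proof. by case. Qed.

Lemma bianalytic_bool (p : C -> bool) :
  morph (fun c => nat_of_bool (p c)) -> bianalytic (fun c => p c).
Proof.
move=> mp; split; first exact: analytic_bool.
apply: (analytic_ext (analytic_bool (morph_negb mp))) => c.
by split=> [/negP|/negP].
Qed.

Lemma bianalytic_eq (f g : C -> nat) :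
  morph f -> morph g -> bianalytic (fun c => f c = g c).
Proof.
move=> mf mg; have [] := @bianalytic_bool (fun c => f c == g c).
  exact: (morph_rec2 recursive_eqn mf mg).
move=> a1 a2; split; [apply: (analytic_ext a1)|apply: (analytic_ext a2)] => c.
  by split=> /eqP.
by split=> h /eqP.
Qed.

Lemma bianalytic_ext P Q : bianalytic P -> (forall c, P c <-> Q c) -> bianalytic Q.
Proof.
move=> [aP aN] PQ; split; first exact: (analytic_ext aP).
by apply: (analytic_ext aN) => c; rewrite PQ.
Qed.

Lemma bianalytic_subst {D : Type} `{context D} (P : D -> Prop) (phi : C -> D) :
  morph phi -> bianalytic P -> bianalytic (fun c => P (phi c)).
Proof.
move=> mphi [aP aN]; split; first exact: (analytic_subst mphi aP).
exact: (analytic_subst mphi aN).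
Qed.

Lemma bianalytic_not P : bianalytic P -> bianalytic (fun c => ~ P c).
Proof.
move=> [aP aN]; split=> //; apply: (analytic_ext aP) => c.
by split=> [? //|/contrapT].
Qed.

Lemma bianalytic_and P Q :
  bianalytic P -> bianalytic Q -> bianalytic (fun c => P c /\ Q c).
Proof.
move=> [aP nP] [aQ nQ]; split; first exact: analytic_and.
by apply: (analytic_ext (analytic_or nP nQ)) => c; rewrite not_andE.
Qed.

Lemma bianalytic_or P Q :
  bianalytic P -> bianalytic Q -> bianalytic (fun c => P c \/ Q c).
Proof.
move=> [aP nP] [aQ nQ]; split; first exact: analytic_or.
by apply: (analytic_ext (analytic_and nP nQ)) => c; rewrite not_orE.
Qed.

Lemma bianalytic_imp P Q :
  bianalytic P -> bianalytic Q -> bianalytic (fun c => P c -> Q c).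
Proof.
move=> bP bQ; apply: (bianalytic_ext (bianalytic_or (bianalytic_not bP) bQ)) => c.
by rewrite implyE.
Qed.

Lemma bianalytic_iff P Q :
  bianalytic P -> bianalytic Q -> bianalytic (fun c => P c <-> Q c).
Proof. by move=> bP bQ; apply: bianalytic_and; exact: bianalytic_imp. Qed.

Lemma bianalytic_all (P : C -> nat -> Prop) :
  bianalytic (fun p : C * nat => P p.1 p.2) ->
  bianalytic (fun c => forall m, P c m).
Proof.
move=> [aP nP]; split; first exact: analytic_all.
apply: (analytic_ext (analytic_ex (P := fun c m => ~ P c m) nP)) => c.
by rewrite existsNP.
Qed.

Lemma bianalytic_ex (P : C -> nat -> Prop) :
  bianalytic (fun p : C * nat => P p.1 p.2) ->
  bianalytic (fun c => exists m, P c m).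
Proof.
move=> [aP nP]; split; first exact: analytic_ex.
apply: (analytic_ext (analytic_all (P := fun c m => ~ P c m) nP)) => c.
by rewrite -forallNP.
Qed.

Lemma analytic_imp P Q :
  bianalytic P -> analytic Q -> analytic (fun c => P c -> Q c).
Proof.
move=> [_ nP] aQ; apply: (analytic_ext (analytic_or nP aQ)) => c.
by rewrite implyE.
Qed.

(* If a function is the unique solution of an analytic condition, then statements
   about it have both an existential and a universal form. *)
Lemma bianalytic_unique (G : C -> baire -> Prop) (f : C -> baire)
    (P : C -> baire -> Prop) :
  analytic (fun p : C * baire => G p.1 p.2) ->
  (forall c b, G c b <-> b = f c) ->
  bianalytic (fun p : C * baire => P p.1 p.2) ->
  bianalytic (fun c => P c (f c)).
Proof.
move=> aG GE [aP nP]; split.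
  apply: (analytic_ext (analytic_ex_baire (P := fun c b => G c b /\ P c b) _)).
    exact: analytic_and.
  by move=> c; split=> [[b [/GE ->]] //|]; exists (f c); split=> //; exact/GE.
apply: (analytic_ext (analytic_ex_baire (P := fun c b => G c b /\ ~ P c b) _)).
  exact: analytic_and.
by move=> c; split=> [[b [/GE ->]] //|]; exists (f c); split=> //; exact/GE.
Qed.

End AnalyticClosure.

Ltac bianalytic_extra := fail.

Ltac bianalytic_step :=
  lazy beta;
  lazymatch goal with
  | |- bianalytic (fun c => (@?P c) /\ (@?Q c)) => apply: (@bianalytic_and _ _ P Q)
  | |- bianalytic (fun c => (@?P c) \/ (@?Q c)) => apply: (@bianalytic_or _ _ P Q)
  | |- bianalytic (fun c => (@?P c) <-> (@?Q c)) => apply: (@bianalytic_iff _ _ P Q)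
  | |- bianalytic (fun c => ~ (@?P c)) => apply: (@bianalytic_not _ _ P)
  | |- bianalytic (fun c => ex (fun x : nat => @?P c x)) =>
      apply: (@bianalytic_ex _ _ P)
  | |- bianalytic (fun c => forall x : nat, @?P c x) =>
      apply: (@bianalytic_all _ _ P)
  | |- bianalytic (fun c => (@?P c) -> (@?Q c)) => apply: (@bianalytic_imp _ _ P Q)
  | |- bianalytic (fun c => @eq nat (@?f c) (@?g c)) =>
      apply: (@bianalytic_eq _ _ f g)
  | |- bianalytic (fun c => is_true (@?p c)) => apply: (@bianalytic_bool _ _ p)
  | |- bianalytic _ => first [assumption | bianalytic_extra]
  | |- morph _ => morph_step
  end.

Ltac bianalytic := repeat bianalytic_step.

Ltac analytic_step :=
  lazy beta;
  lazymatch goal with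
  | |- analytic (fun c => (@?P c) /\ (@?Q c)) => apply: (@analytic_and _ _ P Q)
  | |- analytic (fun c => (@?P c) \/ (@?Q c)) => apply: (@analytic_or _ _ P Q)
  | |- analytic (fun c => ex (fun x : nat => @?P c x)) =>
      apply: (@analytic_ex _ _ P)
  | |- analytic (fun c => ex (fun x : baire => @?P c x)) =>
      apply: (@analytic_ex_baire _ _ P)
  | |- analytic (fun c => forall x : nat, @?P c x) =>
      apply: (@analytic_all _ _ P)
  | |- analytic (fun c => (@?P c) -> (@?Q c)) => apply: (@analytic_imp _ _ P Q)
  | |- analytic _ => first
      [assumption | apply: bianalytic_analytic; bianalytic_step]
  | |- bianalytic _ => bianalytic_step
  | |- morph _ => morph_step
  end.

Ltac analytic := repeat analytic_step.

(** The way back from terms to [recursive]: for numerical contexts the oracle is itself recursive in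
    the parameters, so every query can be eliminated. *)
Lemma oracle_recursive k (T : baire -> nat) (o : k.-tuple nat -> baire) :
  oracle_term T ->
  (forall t, recursive t -> recursive (fun v => o v (t v))) ->
  recursive (fun v => T (o v)).
Proof.
move=> oT ro; elim: {T} oT => [n|T _ IH|h T U rh _ IHT _ IHU].
- exact: recursive_const.
- exact: ro.
- exact: recursive_comp2.
Qed.

(** The final [0] is the position at which the numerical result, encoded as a constant function, is
    read. *)
Definition encode3 (x y z : nat) : baire := encode (x, y, z, 0).

Lemma recursive_morph3 (f : nat -> nat -> nat -> nat) :
  morph (fun p : nat * nat * nat => f p.1.1 p.1.2 p.2) -> recursive3 f.
Proof.
move=> [T oT TE].
have := @oracle_recursive 3 T (fun v => encode3 (tnth v (inord 0)) (tnth v (inord 1))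
    (tnth v (inord 2))) oT.
have rE (x y : 3.-tuple nat -> nat -> nat) :
   (forall t, recursive t -> recursive (fun v => x v (t v))) ->
   (forall t, recursive t -> recursive (fun v => y v (t v))) ->
   forall t, recursive t ->
     recursive (fun v => if odd (t v) then y v (t v)./2 else x v (t v)./2).
  move=> rx ry t rt; have rh := recursive_comp1 recursive_half rt.
  apply: recursive_if; [|exact: ry|exact: rx].
  exact: recursive_comp1 recursive_odd rt.
move=> h; suff rt : forall t, recursive t -> recursive (fun v : 3.-tuple nat =>
    encode3 (tnth v (inord 0)) (tnth v (inord 1)) (tnth v (inord 2)) (t v)).
  by move/eq_recursive: (h rt); apply => v; rewrite /encode3 -TE.
apply: (rE (fun v => encode (tnth v (inord 0), tnth v (inord 1), tnth v (inord 2)))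
  (fun _ _ => 0)); last by move=> t _; recursive_arith.
apply: (rE (fun v => encode (tnth v (inord 0), tnth v (inord 1)))
  (fun v _ => tnth v (inord 2))); last by move=> t _; recursive_arith.
by apply: (rE (fun v _ => tnth v (inord 0)) (fun v _ => tnth v (inord 1))) => t _;
  recursive_arith.
Qed.

Lemma recursive_morph (f : nat -> nat) : morph f -> recursive1 f.
Proof.
move=> mf; have r : recursive3 (fun x _ _ => f x).
  apply: recursive_morph3.
  by apply: (@morph_comp _ _ _ _ _ _ (fun p => p.1.1) f _ mf); morph.
apply/recursive1P.
by apply: (@recursive_comp3 _ _ _ (fun=> 0) (fun=> 0) r); recursive_arith.
Qed.

(** * Metrics of the presentations *)

Local Open Scope ring_scope.

(** Natural numerators with a formal difference for the sign, and a positive denominator by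
    construction: comparing two such reals reduces to comparing naturals. *)
Definition rational_term (R : realType) (C : Type) `{context C} (rho : C -> R) :=
  exists p m d : C -> nat, [/\ morph p, morph m, morph d &
    forall c, rho c = ((p c)%:R - (m c)%:R) / (d c).+1%:R].

Section RationalTerm.
Context {R : realType} {C : Type} `{context C}.
Implicit Types (rho sigma : C -> R).

Let natrS_neq0 (d : nat) : (d.+1%:R : R) != 0. Proof. by rewrite pnatr_eq0. Qed.

Lemma rational_term_nat (f : C -> nat) :
  morph f -> rational_term (fun c => (f c)%:R : R).
Proof.
move=> mf; exists f, (fun=> 0%N), (fun=> 0%N); split=> //; try exact: morph_constn.
by move=> c; rewrite subr0 divr1.
Qed.

Lemma rational_term_inv (f : C -> nat) :
  morph f -> rational_term (fun c => ((f c).+1%:R : R)^-1).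
Proof.
move=> mf; exists (fun=> 1%N), (fun=> 0%N), f; split=> //; try exact: morph_constn.
by move=> c; rewrite subr0 div1r.
Qed.

Lemma rational_term_opp rho :
  rational_term rho -> rational_term (fun c => - rho c).
Proof.
move=> [p [m [d [mp mm md E]]]]; exists m, p, d; split=> // c.
by rewrite E -mulNr opprB.
Qed.

Lemma rational_term_add rho sigma : rational_term rho -> rational_term sigma ->
  rational_term (fun c => rho c + sigma c).
Proof.
move=> [p [m [d [mp mm md E]]]] [p' [m' [d' [mp' mm' md' E']]]].
(* The last witness is the predecessor of the product of [d.+1] and [d'.+1], as denominators are
   stored minus one. *)
exists (fun c => p c * (d' c).+1 + p' c * (d c).+1)%N,
  (fun c => m c * (d' c).+1 + m' c * (d c).+1)%N, (fun c => d c * d' c + d c + d' c)%N.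
split; try by morph.
move=> c; rewrite E E'.
have -> : (d c * d' c + d c + d' c).+1%:R = (d c).+1%:R * (d' c).+1%:R :> R.
  by rewrite -natrM; congr _%:R; lia.
have := natrS_neq0 (d c); have := natrS_neq0 (d' c).
rewrite !natrD !natrM; move: (_.+1%:R) (_.+1%:R) => x y x0 y0.
by field; rewrite x0 y0.
Qed.

Lemma rational_term_mul rho sigma : rational_term rho -> rational_term sigma ->
  rational_term (fun c => rho c * sigma c).
Proof.
move=> [p [m [d [mp mm md E]]]] [p' [m' [d' [mp' mm' md' E']]]].
exists (fun c => p c * p' c + m c * m' c)%N,
  (fun c => p c * m' c + m c * p' c)%N, (fun c => d c * d' c + d c + d' c)%N.
split; try by morph.
move=> c; rewrite E E'.
have -> : (d c * d' c + d c + d' c).+1%:R = (d c).+1%:R * (d' c).+1%:R :> R.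
  by rewrite -natrM; congr _%:R; lia.
have := natrS_neq0 (d c); have := natrS_neq0 (d' c).
rewrite !natrD !natrM; move: (_.+1%:R) (_.+1%:R) => x y x0 y0.
by field; rewrite x0 y0.
Qed.

Lemma rational_term_if (b : C -> bool) rho sigma :
  morph (fun c => nat_of_bool (b c)) ->
  rational_term rho -> rational_term sigma ->
  rational_term (fun c => if b c then rho c else sigma c).
Proof.
move=> mb [p [m [d [mp mm md E]]]] [p' [m' [d' [mp' mm' md' E']]]].
exists (fun c => if b c then p c else p' c), (fun c => if b c then m c else m' c),
  (fun c => if b c then d c else d' c); split; try exact: morph_bool_if.
by move=> c; case: (b c).
Qed.

Lemma morph_le0 rho : rational_term rho ->
  morph (fun c => nat_of_bool (rho c <= 0)).
Proof.
move=> [p [m [d [mp mm md E]]]].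
have : morph (fun c => nat_of_bool (p c <= m c)%N) by morph.
congr morph; apply/funext => c; rewrite E pmulr_lle0 ?invr_gt0 ?ltr0Sn//.
by rewrite subr_le0 ler_nat.
Qed.

Lemma morph_le rho sigma : rational_term rho -> rational_term sigma ->
  morph (fun c => nat_of_bool (rho c <= sigma c)).
Proof.
move=> rr rs; have := morph_le0 (rational_term_add rr (rational_term_opp rs)).
by congr morph; apply/funext => c; rewrite subr_le0.
Qed.

Lemma morph_lt rho sigma : rational_term rho -> rational_term sigma ->
  morph (fun c => nat_of_bool (rho c < sigma c)).
Proof.
move=> rr rs; have := morph_negb (morph_le rs rr).
by congr morph; apply/funext => c; rewrite -ltNge.
Qed.

Lemma rational_term_max rho sigma : rational_term rho -> rational_term sigma ->
  rational_term (fun c => Num.max (rho c) (sigma c)).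
Proof. by move=> rr rs; apply: rational_term_if => //; exact: morph_lt. Qed.

Lemma rational_term_norm rho : rational_term rho ->
  rational_term (fun c => `|rho c|).
Proof.
move=> rr; have := rational_term_max rr (rational_term_opp rr).
by congr rational_term; apply/funext => c; rewrite maxrN.
Qed.

Lemma rational_term_bigmax (I : Type) (s : seq I) (rho : I -> C -> R) :
  (forall i, rational_term (rho i)) ->
  rational_term (fun c => \big[Num.max/0]_(i <- s) rho i c).
Proof.
move=> rr; elim: s => [|i s IH].
  have := @rational_term_nat _ (morph_constn 0).
  by congr rational_term; apply/funext => c; rewrite big_nil.
have := rational_term_max (rr i) IH.
by congr rational_term; apply/funext => c; rewrite big_cons.
Qed.

Lemma rational_term_rat_pres (f : C -> nat) :
  morph f -> rational_term (fun c => @rat_pres R (f c)).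
Proof.
move=> mf; apply: rational_term_mul; last by apply: rational_term_inv; morph.
apply: rational_term_mul; last by apply: rational_term_nat; morph.
have : rational_term (fun c => if odd (coord (f c) 0) then -1 else 1 : R).
  have r1 : rational_term (fun _ : C => 1 : R).
    exact: (@rational_term_nat _ (morph_constn 1)).
  apply: rational_term_if => //; first by morph.
  exact: rational_term_opp.
by congr rational_term; apply/funext => c; rewrite -signr_odd; case: odd.
Qed.

Lemma rational_term_qrat (f : C -> nat) :
  morph f -> rational_term (fun c => @qrat R (f c)).
Proof.
move=> mf; apply: rational_term_mul; last by apply: rational_term_inv; morph.
by apply: rational_term_nat; morph.
Qed.

Lemma rational_term_dist_euclidean N (f g : C -> nat) : morph f -> morph g ->
  rational_term (fun c => `|pres (euclidean_space R N) (f c) -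
                            pres (euclidean_space R N) (g c)|).
Proof.
move=> mf mg.
have : rational_term (fun c => \big[Num.max/0]_(ij : 'I_1 * 'I_N)
    `|@rat_pres R (coord (f c) ij.2) - @rat_pres R (coord (g c) ij.2)|).
  apply: rational_term_bigmax => ij; apply: rational_term_norm.
  apply: rational_term_add; last apply: rational_term_opp;
    by apply: rational_term_rat_pres; morph.
congr rational_term; apply/funext => c.
rewrite [RHS]mx_normrE; apply: eq_bigr => -[i j] _.
by rewrite !mxE.
Qed.

End RationalTerm.

Ltac rational_step :=
  lazy beta;
  lazymatch goal with
  | |- rational_term (fun c => Num.norm (pres (euclidean_space _ _) (@?f c) -
         pres (euclidean_space _ _) (@?g c))) =>
      apply: (@rational_term_dist_euclidean _ _ _ _ f g)
  | |- rational_term (fun c => GRing.add (@?a c) (@?b c)) =>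
      apply: (@rational_term_add _ _ _ a b)
  | |- rational_term (fun c => GRing.mul (@?a c) (@?b c)) =>
      apply: (@rational_term_mul _ _ _ a b)
  | |- rational_term (fun c => GRing.opp (@?a c)) =>
      apply: (@rational_term_opp _ _ _ a)
  | |- rational_term (fun c => GRing.inv (GRing.natmul _ (S (@?f c)))) =>
      apply: (@rational_term_inv _ _ _ f)
  | |- rational_term (fun c => GRing.natmul _ (@?f c)) =>
      apply: (@rational_term_nat _ _ _ f)
  | |- rational_term (fun c => Num.norm (@?a c)) =>
      apply: (@rational_term_norm _ _ _ a)
  | |- rational_term (fun c => Num.max (@?a c) (@?b c)) =>
      apply: (@rational_term_max _ _ _ a b)
  | |- rational_term (fun c => rat_pres (@?f c)) =>
      apply: (@rational_term_rat_pres _ _ _ f)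
  | |- rational_term (fun c => qrat (@?f c)) =>
      apply: (@rational_term_qrat _ _ _ f)
  | |- rational_term (fun c => GRing.one _) =>
      apply: (@rational_term_nat _ _ _ (fun=> 1%N) (morph_constn 1))
  | |- morph _ => morph_step
  end.

Ltac rational := repeat rational_step.

Ltac morph_extra ::=
  lazymatch goal with
  | |- morph (fun c => nat_of_bool (Order.le (@?a c) (@?b c))) =>
      apply: (@morph_le _ _ _ a b); rational
  | |- morph (fun c => nat_of_bool (Order.lt (@?a c) (@?b c))) =>
      apply: (@morph_lt _ _ _ a b); rational
  end.

(** * Membership in basic balls *)

Section Balls.
Context {R : realType}.

Lemma baire_dist_ge0 (x y : baire) : 0 <= @baire_dist R x y.
Proof. by rewrite /baire_dist; case: pselect => // ?; rewrite invr_ge0. Qed.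

Lemma exists_invn_lt (e : R) L0 :
  0 < e -> exists2 L, (L0 <= L)%N & L.+1%:R^-1 < e.
Proof.
move=> e0; exists (L0 + Num.truncn e^-1)%N; first exact: leq_addr.
rewrite invf_plt ?posrE ?ltr0Sn//; apply: (lt_le_trans (truncnS_gt _)).
by rewrite ler_nat ltnS leq_addl.
Qed.

Lemma ler_invS m n : (m <= n)%N -> (n.+1%:R : R)^-1 <= m.+1%:R^-1.
Proof. by move=> mn; rewrite lef_pV2 ?posrE ?ltr0Sn// ler_nat. Qed.

(** The distance is [1 / n.+1] for the first disagreement [n]. Quantifying over a common length [l]
    removes the undecidable case [x = y], where [l] may be taken large. *)
Lemma baire_dist_lt (x y : baire) (q : R) : baire_dist x y < q <->
  exists l, (forall i, (i < l)%N -> x i = y i) /\ l.+1%:R^-1 < q.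
Proof.
rewrite /baire_dist; case: pselect => [ex|nex]; split.
- case: ex_minnP => n _ nmin nq; exists n; split=> // i ilt.
  by apply/eqP/negPn/negP => /nmin; rewrite leqNgt ilt.
- move=> [l [xy lq]]; case: ex_minnP => n xyn _; apply: le_lt_trans lq.
  by apply: ler_invS; rewrite leqNgt; apply/negP => /xy /eqP; rewrite (negbTE xyn).
- move=> q0; have [l _ lq] := @exists_invn_lt q 0 q0; exists l; split=> // i _.
  by apply/eqP/negPn/negP => xyi; apply: nex; exists i.
- by move=> [l [_ lq]]; apply: lt_trans lq; rewrite invr_gt0.
Qed.

(** Agreement must include position [n]: a first disagreement there gives exactly the excluded value
    [1 / n.+1]. *)
Lemma baire_dist_ltS (x y : baire) n : baire_dist x y < (n.+1%:R : R)^-1 <->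
  forall i, (i <= n)%N -> x i = y i.
Proof.
rewrite baire_dist_lt; split=> [[l [xy ln]] i|xy].
  move=> le_in; apply: xy; apply: (leq_ltn_trans le_in); rewrite ltnNge.
  by apply/negP => /ler_invS; rewrite leNgt ln.
by exists n.+1; split=> //; rewrite ltf_pV2 ?posrE ?ltr0Sn// ltr_nat.
Qed.

Lemma qrat_pair m n : @qrat R (pair_code m n) = m%:R / n.+1%:R.
Proof. by rewrite /qrat !coord_pair. Qed.

(** Number [0] codes a ball of radius zero, hence the empty ball; it is the padding used by all
    enumerations of balls below. *)
Lemma qrat0 : @qrat R (coord 0 1) = 0.
Proof. by rewrite coordE /= /qrat !coordE /= mul0r. Qed.

Context {C : Type} `{context C}.

Lemma bianalytic_baire_ball (z : C -> baire) (s : C -> nat) : morph z -> morph s ->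
  bianalytic (fun c => basic_nbhd (baire_space (R := R)) (s c) (z c)).
Proof.
move=> mz ms.
have : bianalytic (fun c => exists l : nat,
    (forall i, (i < l)%N -> z c i = coord (coord (s c) 0) i) /\
    (l.+1%:R : R)^-1 < qrat (coord (s c) 1)).
  bianalytic.
move/bianalytic_ext; apply => c.
by rewrite -(baire_dist_lt (z c) (coord (coord (s c) 0))).
Qed.

Lemma morph_omega_ball (m n s : C -> nat) : morph m -> morph n -> morph s ->
  morph (fun c => nat_of_bool
    (Num.max ((m c != coord (coord (s c) 0) 0)%:R : R)
             (n c != coord (coord (s c) 0) 1)%:R < qrat (coord (s c) 1))).
Proof. move=> mm mn ms; morph. Qed.

End Balls.

(** * Density of the rational points *)

Section Density.
Context {R : realType}.

Lemma rat_pres_dense (x e : R) : 0 < e -> exists c, `|x - rat_pres c| < e.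
Proof.
move=> e0; have [k _ ke] := @exists_invn_lt R e 0 e0.
pose m := Num.truncn (`|x| * k.+1%:R).
exists (seqcode [:: (x < 0)%R : nat; m; k]).
have -> : rat_pres (seqcode [:: (x < 0)%R : nat; m; k]) =
    (-1) ^+ (x < 0)%R * (m%:R / k.+1%:R) :> R.
  by rewrite /rat_pres !coord_seqcode /= mulrA.
rewrite {1}(realEsign (num_real x)) -mulrBr normrM normr_sign mul1r.
apply: le_lt_trans ke; rewrite -[leRHS]mul1r ler_pdivlMr ?ltr0Sn//.
rewrite -[X in _ * X](ger0_norm (ler0n R k.+1)) -normrM mulrBl divfK ?pnatr_eq0//.
have /Num.Theory.truncn_itv : 0 <= `|x| * k.+1%:R by rewrite mulr_ge0.
rewrite -/m => /andP[le_m lt_m]; rewrite ger0_norm ?subr_ge0// lerBlDl.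
by rewrite natr1 ltW.
Qed.

Context {N : nat}.

Lemma euclidean_pres_coord (f : 'I_N -> nat) :
  exists s, forall i, pres (euclidean_space R N) s 0 i = rat_pres (f i).
Proof.
exists (seqcode [seq f i | i <- enum 'I_N]) => i.
rewrite !mxE coord_seqcode (nth_map i) ?size_enum_ord//.
by rewrite nth_ord_enum.
Qed.

Lemma mx_norm_lt (x : 'rV[R]_N) e :
  0 < e -> (forall i, `|x 0 i| < e) -> `|x| < e.
Proof.
move=> e0 xe; rewrite [ltLHS]mx_normrE; apply: bigmax_lt => // -[i j] _ /=.
by rewrite (ord1 i).
Qed.

Lemma le_mx_norm (x : 'rV[R]_N) i : `|x 0 i| <= `|x|.
Proof.
rewrite [leRHS]mx_normrE; apply/bigmax_geP; right.
by exists (0, i).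
Qed.

Lemma euclidean_dense (x : 'rV[R]_N) e :
  0 < e -> exists s, `|x - pres (euclidean_space R N) s| < e.
Proof.
move=> e0; have /choice[f fP] i := @rat_pres_dense (x 0 i) e e0.
have [s sE] := euclidean_pres_coord f; exists s.
by apply: mx_norm_lt => // i; rewrite [X in `|X|]mxE [X in _ + X]mxE sE.
Qed.

End Density.

(** * Effective pointclasses and normal forms *)

Section Boundary.
Context {R : realType}.

(* A term queries only finitely much of its oracle, and a recursive procedure
   decides when an initial segment suffices. *)
Lemma oracle_term_approx (T : baire -> nat) : oracle_term T ->
  exists (v : nat -> nat -> nat) (ok : nat -> nat -> nat -> bool),
  [/\ morph (fun p : nat * nat => v p.1 p.2),
      morph (fun p : nat * nat * nat => nat_of_bool (ok p.1.1 p.1.2 p.2)),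
      forall u L n, ok u L n -> forall b : baire,
        (forall i, (i < L)%N -> b i = coord u i) -> T (encode (b, n)) = v u n &
      forall (b : baire) (n : nat), exists L0, forall L u, (L0 <= L)%N ->
        (forall i, (i < L)%N -> b i = coord u i) -> ok u L n].
Proof.
elim=> [m|{}T _ [v [ok [mv mok okP okE]]]|h {}T U rh _ [v [ok [mv mok okP okE]]]
    _ [v' [ok' [mv' mok' okP' okE']]]].
- exists (fun _ _ => m), (fun _ _ _ => true); split=> //; first by morph.
    exact: (morph_constn 1).
  by move=> b n; exists 0%N.
(* The oracle [encode (b, n)] answers odd queries with [n] and even ones with a value of [b]; the
   latter is known only if the halved query lies below the length [L]. *)
- exists (fun u n => if odd (v u n) then n else coord u (v u n)./2),
    (fun u L n => ok u L n && (odd (v u n) || ((v u n)./2 < L)%N)).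
  have mv1 : morph (fun p : nat * nat * nat => v p.1.1 p.2).
    by apply: (@morph_comp _ _ _ _ _ _ (fun p => (p.1.1, p.2)) _ _ mv); morph.
  split.
  + have mv2 : morph (fun p : nat * nat => nat_of_bool (odd (v p.1 p.2))).
      exact: (morph_rec1 recursive_odd mv).
    by apply: morph_bool_if; morph.
  + by morph.
  + move=> u L n /andP[okn lt_L] b bu; rewrite encode_pairE (okP _ _ _ okn b bu).
    by case: ifP lt_L => // _ /bu.
  + move=> b n; have [L0 L0P] := okE b n.
    exists (maxn L0 (T (encode (b, n))).+1) => L u; rewrite geq_max => /andP[h1 h2] bu.
    have okn := L0P _ _ h1 bu; rewrite okn -(okP _ _ _ okn b bu) /=.
    by apply/orP; right; apply: leq_ltn_trans h2; rewrite leq_half_double; lia.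
- exists (fun u n => h (v u n) (v' u n)), (fun u L n => ok u L n && ok' u L n).
  split.
  + exact: morph_rec2.
  + exact: morph_andb.
  + by move=> u L n /andP[h1 h2] b bu; rewrite (okP _ _ _ h1 b bu) (okP' _ _ _ h2 b bu).
  + move=> b n; have [L0 L0P] := okE b n; have [L1 L1P] := okE' b n.
    exists (maxn L0 L1) => L u; rewrite geq_max => /andP[h1 h2] bu.
    by rewrite (L0P _ _ h1 bu) (L1P _ _ h2 bu).
Qed.

Lemma exists_coord_segment (b : baire) L :
  exists u, forall i, (i < L)%N -> b i = coord u i.
Proof.
by exists (seqcode (mkseq b L)) => i iL; rewrite coord_seqcode nth_mkseq.
Qed.

(* The hypotheses on [sub] say that every basic ball is effectively a union of
   basic balls of arbitrarily small radii [1/(L+1)]: on a product ball, a cylinder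
   determining many values of the second coordinate forces a small radius. *)
Lemma Sigma11_of_analytic (X : space R) (sub : nat -> nat -> nat -> bool)
    (P : set X) (Q : baire -> Prop) :
  morph (fun p : nat * nat * nat => nat_of_bool (sub p.1.1 p.1.2 p.2)) ->
  (forall s c L x, sub s c L -> dist x (pres X c) < L.+1%:R^-1 ->
    basic_nbhd X s x) ->
  (forall s x L0, basic_nbhd X s x -> exists L c,
    [/\ (L0 <= L)%N, sub s c L & dist x (pres X c) < L.+1%:R^-1]) ->
  (forall x L, exists c, dist x (pres X c) < L.+1%:R^-1) ->
  analytic Q ->
  (forall x, P x <-> exists p : baire,
    (forall s, p s = 0%N -> ~ basic_nbhd X s x) /\ Q p) ->
  Sigma11 P.
Proof.
move=> msub sub1 sub2 dense [S mS QE] PE.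
(* The even half of [b] is the list [p] of avoided balls, the odd half is the analytic witness. *)
pose S' (b : baire) n :=
  S ((fun i => b (2 * i)%N) : baire, (fun i => b (2 * i + 1)%N) : baire, n).
have [T oT TE] : morph (S' : baire -> baire).
  apply: morph_lam.
  apply: (@morph_comp _ _ _ _ _ _ (fun p => ((fun i => p.1 (2 * i)%N) : baire,
    (fun i => p.1 (2 * i + 1)%N) : baire, p.2)) S _ mS); morph.
have [v [ok [mv mok okP okE]]] := oracle_term_approx oT.
(* A product ball is removed for one of two reasons: the cylinder of [u] already makes the matrix
   nonzero at [n], or it claims that ball [s] is avoided although the ball around [c] lies inside
   it. *)
pose good c u L n s := ok u L.+1 n && (v u n != 0%N) ||
  [&& coord u (2 * s)%N == 0%N, (2 * s < L.+1)%N & sub s c L].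
pose e m := if good (coord m 0) (coord m 1) (coord m 2) (coord m 3) (coord m 4)
  then pair_code (pair_code (coord m 0) (coord m 1)) (pair_code 1 (coord m 2))
  else 0%N.
have me : recursive1 e.
  apply: recursive_morph; apply: morph_bool_if; last 2 first.
  - by morph.
  - by morph.
  have mv' : morph (fun m => v (coord m 1) (coord m 3)).
    by apply: (@morph_comp _ _ _ _ _ _ (fun m => (coord m 1, coord m 3)) _ _ mv); morph.
  have mok' : morph (fun m => nat_of_bool (ok (coord m 1) (coord m 2).+1 (coord m 3))).
    by apply: (@morph_comp _ _ _ _ _ _ (fun m => (coord m 1, (coord m 2).+1, coord m 3))
      _ _ mok); morph.
  have msub' : morph (fun m => nat_of_bool (sub (coord m 4) (coord m 0) (coord m 2))).
    by apply: (@morph_comp _ _ _ _ _ _ (fun m => (coord m 4, coord m 0, coord m 2))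
      _ _ msub); morph.
  by rewrite /good; morph.
have eP m x b : basic_nbhd (prod_space X baire_space) (e m) (x, b) <->
    [/\ good (coord m 0) (coord m 1) (coord m 2) (coord m 3) (coord m 4),
      dist x (pres X (coord m 0)) < (coord m 2).+1%:R^-1 &
      forall i, (i <= coord m 2)%N -> b i = coord (coord m 1) i].
  rewrite /basic_nbhd /= /e; case: ifP => gd; last first.
    split=> [|[]//]; rewrite qrat0 gt_max => /andP[_].
    by rewrite ltNge baire_dist_ge0.
  rewrite !coord_pair qrat_pair mul1r gt_max; split=> [/andP[xc]|[_ -> bu]].
    by move/baire_dist_ltS.
  exact/baire_dist_ltS.
exists (~` open_coded (prod_space X baire_space) e).
  by exists e => //; rewrite setCK.
have S'E b n : S' b n = T (encode (b, n)) by rewrite -TE.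
have eE x b : open_coded (prod_space X baire_space) e (x, b) <->
    (exists2 s, b (2 * s)%N = 0%N & basic_nbhd X s x) \/ exists n, S' b n <> 0%N.
  split=> [[m _ /eP[gd xc bu]]|[[s bs xs]|[n bn]]].
  - case/orP: gd => [/andP[okn vn]|/and3P[us sL sb]].
      right; exists (coord m 3); rewrite S'E (okP _ _ _ okn b); last first.
        by move=> i; rewrite ltnS; exact: bu.
      exact/eqP.
    left; exists (coord m 4); last exact: sub1 sb xc.
    by rewrite bu ?(eqP us) // -ltnS.
  (* The radius is made small enough for the cylinder, of length [L.+1], to determine the value at
     [2 * s]. *)
  - have [L [c [sL sb xc]]] := sub2 s x (2 * s)%N xs.
    have [u bu] := exists_coord_segment b L.+1.
    exists (seqcode [:: c; u; L; 0%N; s]) => //; apply/eP; rewrite !coord_seqcode /=.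
    split=> //; apply/orP; right; rewrite sb ltnS sL !andbT -bu ?ltnS//.
    exact/eqP.
  - have [L LP] := okE b n; have [c xc] := dense x L.
    have [u bu] := exists_coord_segment b L.+1.
    exists (seqcode [:: c; u; L; n; 0%N]) => //; apply/eP; rewrite !coord_seqcode /=.
    have okn : ok u L.+1 n by apply: LP.
    split=> //; apply/orP; left; rewrite okn -(okP _ _ _ okn b bu) -S'E.
    exact/eqP.
apply/seteqP; split=> x /=.
  move=> /PE[p [px /QE[d dS]]].
  exists (fun i => if odd i then d i./2 else p i./2) => /eE[[s]|[n]].
    by rewrite mul2n odd_double doubleK; exact: px.
  apply; rewrite /S'.
  have -> : (fun m => if odd (2 * m)%N then d (2 * m)./2 else p (2 * m)./2) = p.
    by apply/funext => m; rewrite mul2n odd_double doubleK.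
  have -> : (fun m => if odd (2 * m + 1)%N then d (2 * m + 1)./2
      else p (2 * m + 1)./2) = d.
    by apply/funext => m; rewrite mul2n addn1 /= odd_double uphalf_double.
  exact: dS.
move=> [b /eE/not_orP[h1 h2]]; apply/PE; exists (fun i => b (2 * i)%N); split.
  by move=> s bs xs; apply: h1; exists s.
apply/QE; exists (fun i => b (2 * i + 1)%N) => n.
by apply/eqP/negPn/negP => /eqP h; apply: h2; exists n.
Qed.

Lemma Sigma11_euclidean N (P : set (euclidean_space R N)) (Q : baire -> Prop) :
  analytic Q ->
  (forall x, P x <-> exists p : baire,
    (forall s, p s = 0%N -> ~ basic_nbhd (euclidean_space R N) s x) /\ Q p) ->
  Sigma11 P.
Proof.
pose r := pres (euclidean_space R N).
apply: (@Sigma11_of_analytic (euclidean_space R N) (fun s c L =>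
  (`|r c - r (coord s 0)| + L.+1%:R^-1 <= qrat (coord s 1))%R)).
- by rewrite /r; morph.
- move=> s c L x sb xc; apply: lt_le_trans sb.
  rewrite addrC; apply: le_lt_trans (ler_distD (r c) _ _) _.
  by rewrite ltrD2r.
(* Half of the available room: [1 / L.+1] is spent once on moving the centre from [x] to [r c], and
   once as the radius. *)
- move=> s x L0 xs; have e0 : 0 < (qrat (coord s 1) - `|x - r (coord s 0)|) / 2.
    by rewrite divr_gt0// subr_gt0.
  have [L L0L Le] := exists_invn_lt L0 e0.
  have [c xc] : exists c, `|x - r c| < (L.+1%:R : R)^-1.
    by apply: euclidean_dense; rewrite invr_gt0.
  exists L, c; split=> //.
  have := ler_distD x (r c) (r (coord s 0)); rewrite (distrC (r c) x) => h.
  move: Le xc h; move: (`|x - r c|) (`|x - r (coord s 0)|) => a b.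
  by move: (`|r c - r (coord s 0)|) (qrat _) (_^-1) => u q l; lra.
- by move=> x L; apply: euclidean_dense; rewrite invr_gt0.
Qed.

Let omega2 := prod_space (R := R) omega_space omega_space.

Lemma omega_ballE s m n : basic_nbhd omega2 s (m, n) =
  (Num.max ((m != coord (coord s 0) 0)%:R : R)
           (n != coord (coord s 0) 1)%:R < qrat (coord s 1) : Prop).
Proof. by []. Qed.

Lemma omega_dist_small (m n c L : nat) : (0 < L)%N ->
  dist ((m, n) : omega2) (pres omega2 c) < L.+1%:R^-1 ->
  m = coord c 0 /\ n = coord c 1.
Proof.
move=> L0 /= h; have lt1 : (L.+1%:R : R)^-1 < 1.
  by rewrite invf_lt1 ?ltr0Sn// ltr1n.
have := lt_trans h lt1; rewrite gt_max => /andP[].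
by case: (m =P coord c 0); case: (n =P coord c 1) => //=; rewrite ?ltxx ?andbF.
Qed.

Lemma Sigma11_omega2 (P : nat -> nat -> Prop) :
  analytic (fun p : nat * nat => P p.1 p.2) ->
  Sigma11 ([set p | P p.1 p.2] : set omega2).
Proof.
move=> aP; pose sub s c L := (0 < L)%N &&
  (Num.max ((coord c 0 != coord (coord s 0) 0)%:R : R)
           (coord c 1 != coord (coord s 0) 1)%:R < qrat (coord s 1)).
(* Mere avoidance would not identify the point, so [p] is required to be the exact record of the
   balls avoided by some [(i, j)]. *)
pose Q (p : baire) := exists i, exists j, P i j /\
  forall s, ~~ (Num.max ((i != coord (coord s 0) 0)%:R : R)
           (j != coord (coord s 0) 1)%:R < qrat (coord s 1)) <-> p s = 0%N.
apply: (@Sigma11_of_analytic _ sub _ Q).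
- by rewrite /sub; morph; apply: morph_omega_ball; morph.
- move=> s c L [m n] /andP[L0 sb] /omega_dist_small[]// -> ->.
  by rewrite omega_ballE.
- move=> s [m n] L0 xs; exists L0.+1, (pair_code m n); split=> //.
    by rewrite /sub !coord_pair.
  by rewrite /= !coord_pair !eqxx maxxx invr_gt0.
- move=> [m n] L; exists (pair_code m n).
  by rewrite /= !coord_pair !eqxx maxxx invr_gt0.
- rewrite /Q; analytic.
  + apply: (@analytic_subst _ _ _ _ _ (fun p : baire * nat * nat => (p.1.2, p.2)) _ aP).
    by morph.
  + bianalytic.
move=> [m n]; split=> [Pmn|[p [px [i [j [Pij ijE]]]]]].
  exists (fun s => nat_of_bool (Num.max ((m != coord (coord s 0) 0)%:R : R)
           (n != coord (coord s 0) 1)%:R < qrat (coord s 1))); split.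
    by move=> s h; rewrite omega_ballE => h'; rewrite h' in h.
  by exists m, n; split=> // s; case: (_ < _); split.
(* The ball of radius [1 / 2] around [(m, n)] is a singleton; as [p] cannot claim that it is
   avoided, [(i, j)] must be [(m, n)]. *)
pose s := pair_code (pair_code m n) (pair_code 1 1).
have xs : basic_nbhd omega2 s (m, n).
  by rewrite omega_ballE !coord_pair !eqxx maxxx qrat_pair mul1r invr_gt0.
have : ~~ ~~ (Num.max ((i != coord (coord s 0) 0)%:R : R)
           (j != coord (coord s 0) 1)%:R < qrat (coord s 1)).
  by apply/negP => /ijE /px; apply.
move/negPn; rewrite !coord_pair qrat_pair mul1r => h.
have [] := @omega_dist_small i j (pair_code m n) 1 isT; last first.
  by rewrite !coord_pair => <- <-.
by rewrite /= !coord_pair.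
Qed.

End Boundary.

(** * Effectively Borel points and analytic conditions *)

Section DeltaPoints.
Context {R : realType}.
Local Notation omega2 := (prod_space (R := R) omega_space omega_space).

Lemma Sigma11_closedE (X : space R) (P : set X) : Sigma11 P ->
  exists2 e : baire, recursive1 e & forall x, P x <-> exists b : baire,
    forall k, ~ (dist x (pres X (coord (coord (e k) 0) 0)) < qrat (coord (e k) 1) /\
      exists l, (forall i, (i < l)%N -> b i = coord (coord (coord (e k) 0) 1) i) /\
        (l.+1%:R : R)^-1 < qrat (coord (e k) 1)).
Proof.
move=> [Q [e re QE] ->]; exists e => // x /=.
have QxE b : Q (x, b) <-> ~ open_coded (prod_space X baire_space) e (x, b).
  by rewrite -QE; split=> [? ? //|/contrapT].
split=> -[b]; rewrite ?QxE => bQ; exists b; rewrite ?QxE.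
  move=> k [xk bk]; apply: bQ; exists k => //.
  by rewrite /basic_nbhd /= gt_max xk; exact/baire_dist_lt.
move=> [k _]; rewrite /basic_nbhd /= gt_max => /andP[xk /baire_dist_lt bk].
by apply: (bQ k).
Qed.

Lemma analytic_of_Sigma11_omega2 (P : set omega2) :
  Sigma11 P -> analytic (fun p : nat * nat => P p).
Proof.
move=> /Sigma11_closedE[e re PE].
have : analytic (fun p : nat * nat => exists b : baire, forall k : nat,
    ~ (Num.max ((p.1 != coord (coord (coord (e k) 0) 0) 0)%:R : R)
        (p.2 != coord (coord (coord (e k) 0) 0) 1)%:R < qrat (coord (e k) 1) /\
      exists l : nat, (forall i, (i < l)%N -> b i = coord (coord (coord (e k) 0) 1) i) /\
        (l.+1%:R : R)^-1 < qrat (coord (e k) 1))).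
  analytic.
by move/analytic_ext; apply => p; rewrite PE.
Qed.

Lemma analytic_Delta11_point (a : baire) :
  Delta11_point R a -> analytic (fun f : baire => f = a).
Proof.
move=> [/analytic_of_Sigma11_omega2 aG _].
have : analytic (fun f : baire => forall n : nat, a n = f n).
  apply: analytic_all.
  by apply: (@analytic_subst _ _ _ _ _ (fun p : baire * nat => (p.2, p.1 p.2)) _ aG); morph.
move/analytic_ext; apply => f; split=> [fa|-> //].
by apply/funext => n; rewrite fa.
Qed.

(** Both the graph and its complement are described by the existence of a solution with the wanted
    value. Only the part [phi g] needs to be unique, so [G] may leave irrelevant positions free. *)
Lemma Delta11_point_of_analytic (G : baire -> Prop) (a : baire) (phi : baire -> baire) :
  analytic G -> morph phi -> (exists g, G g) -> (forall g, G g -> phi g = a) ->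
  Delta11_point R a.
Proof.
move=> aG mphi [g0 Gg0] Gphi.
split.
  apply: (@Sigma11_omega2 R (fun m n => a m = n)).
  have : analytic (fun p : nat * nat => exists g : baire, G g /\ phi g p.1 = p.2).
    analytic.
    by apply: (@analytic_subst _ _ _ _ _ (fun p : nat * nat * baire => p.2) _ aG); morph.
  move/analytic_ext; apply => p; split=> [[g [/Gphi ->]] //|ap].
  by exists g0; rewrite (Gphi _ Gg0).
rewrite /Pi11; apply: (@Sigma11_omega2 R (fun m n => ~ a m = n)).
have : analytic (fun p : nat * nat => exists g : baire, G g /\ ~ phi g p.1 = p.2).
  analytic.
  by apply: (@analytic_subst _ _ _ _ _ (fun p : nat * nat * baire => p.2) _ aG); morph.
move/analytic_ext; apply => p; split=> [[g [/Gphi ->]] //|ap].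
by exists g0; rewrite (Gphi _ Gg0).
Qed.

Lemma bianalytic_open_omega2 {C : Type} `{context C} (a : C -> baire) (m n : C -> nat) :
  morph a -> morph m -> morph n ->
  bianalytic (fun c => open_coded omega2 (a c) (m c, n c)).
Proof.
move=> ma mm mn.
have : bianalytic (fun c => exists k : nat,
   Num.max ((m c != coord (coord (a c k) 0) 0)%:R : R)
     (n c != coord (coord (a c k) 0) 1)%:R < qrat (coord (a c k) 1)).
  bianalytic.
by move/bianalytic_ext; apply => c; split=> [[k]|[k _]]; exists k.
Qed.

End DeltaPoints.

Ltac bianalytic_extra ::= first
  [ apply: bianalytic_baire_ball | apply: bianalytic_open_omega2 ].

(** * Evaluating convexly generated codes *)

Section Evaluation.
Context {R : realType} {N : nat}.
Local Notation omega2 := (prod_space (R := R) omega_space omega_space).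
Local Notation nbhdE := (basic_nbhd (euclidean_space R N)).

(* A countable family of codes [B(n, .)], closed under passing to subcodes along the
   pointers [chi], with truth values [tau] for membership in the coded sets. The
   point is only present through the predicate [p s = 0], which says that it lies
   outside the [s]-th ball. *)
Definition evaluation (B tau chi p : baire) : Prop := forall n : nat,
  (B (pair_code n 0) = 0%N ->
    (tau n = 1%N <-> forall t : nat, p (B (pair_code n t.+1)) = 0%N)) /\
  (B (pair_code n 0) = 1%N ->
    (tau n = 1%N <-> exists i : nat, forall j : nat,
       tau (chi (pair_code n (pair_code i j))) = 1%N) /\
    (forall i j s : nat,
      basic_nbhd (baire_space (R := R)) s
        (fun t => B (pair_code (chi (pair_code n (pair_code i j))) t)) <->
      open_coded omega2 (fun t => B (pair_code n t.+1)) (pair_code i j, s))).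

Lemma analytic_evaluation :
  analytic (fun p : baire * baire * baire * baire =>
    evaluation p.1.1.1 p.1.1.2 p.1.2 p.2).
Proof. rewrite /evaluation; analytic. Qed.

Definition outside (p : baire) (x : 'rV[R]_N) : Prop :=
  forall s, p s = 0%N <-> ~ nbhdE s x.

(** Well-foundedness is not asked of the guessed family: the induction follows the derivation of the
    root code, and the uniqueness in [pfun_at] identifies the guessed subcodes with the true
    ones. *)
Lemma evaluation_correct lt xi a (A : set 'rV[R]_N) : CGC_at lt xi a A ->
  forall B tau chi p x n, outside p x -> evaluation B tau chi p ->
  (forall t, B (pair_code n t) = a t) -> tau n = 1%N <-> A x.
Proof.
elim=> {xi a A} [xi a _ a0 _ _|xi a b eta A _ a1 ab _ _ IH _]
    B tau chi p x n px ev Ba.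
  have [/(_ (etrans (Ba _) a0)) -> _] := ev n; split=> [h [t _]|h t].
    by apply/px; rewrite -(h t) Ba.
  by apply/px => xt; apply: h; exists t => //; rewrite /shift -Ba.
have [_ /(_ (etrans (Ba _) a1))[-> chiE]] := ev n.
have tauE i j : tau (chi (pair_code n (pair_code i j))) = 1%N <-> A i j x.
  apply: (IH i j B tau chi p x _ px ev) => t.
  have -> // : b i j = (fun t => B (pair_code (chi (pair_code n (pair_code i j))) t)).
  apply: (ab i j).2 => s; rewrite (chiE i j s).
  by have -> : (fun t => B (pair_code n t.+1)) = shift a by apply/funext => ?.
split=> [[i ti]|[i _ ti]]; exists i => //.
  by move=> j _; exact/tauE.
by move=> j; apply/tauE/ti.
Qed.

(** Evaluations of all subcodes are chosen and glued below a new root. For a code of a closed set,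
    every node is a copy of that code. *)
Lemma evaluation_exists lt xi a (A : set 'rV[R]_N) : CGC_at lt xi a A ->
  forall p x, outside p x -> exists B tau chi,
    evaluation B tau chi p /\ forall t, B (pair_code 0 t) = a t.
Proof.
elim=> {xi a A} [xi a _ a0 _ _|xi a b eta A _ a1 ab _ cA IH _] p x px.
  exists (fun m => a (coord m 1)).
  exists (fun=> nat_of_bool `[< closed_coded (euclidean_space R N) (shift a) x >]).
  exists id; split=> [n|t]; rewrite !coord_pair //; split; last by rewrite a0.
  move=> _; split.
    case: asboolP => // h _ t; rewrite coord_pair; apply/px => xt.
    by apply: h; exists t.
  move=> h; case: asboolP => // -[] [t _ xt].
  by have /px := h t; rewrite coord_pair; apply.
have /choice[F FP] (ij : nat * nat) : exists F : baire * baire * baire,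
    evaluation F.1.1 F.1.2 F.2 p /\ forall t, F.1.1 (pair_code 0 t) = b ij.1 ij.2 t.
  by have [B [tau [chi h]]] := IH ij.1 ij.2 p x px; exists (B, tau, chi).
(* The root is node [0], and [pair_code (pair_code i j) k'] is node [k'] of the evaluation chosen
   for the subcode [(i, j)]; a pair code is never [0], so the two kinds do not clash. *)
pose G k := F (coord (coord k 0) 0, coord (coord k 0) 1).
pose B m := if coord m 0 == 0%N then a (coord m 1)
  else (G (coord m 0)).1.1 (pair_code (coord (coord m 0) 1) (coord m 1)).
pose tau k := if k == 0%N then nat_of_bool `[< (\bigcup_i \bigcap_j A i j) x >]
  else (G k).1.2 (coord k 1).
pose chi m := if coord m 0 == 0%N then pair_code (coord m 1) 0
  else pair_code (coord (coord m 0) 0)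
    ((G (coord m 0)).2 (pair_code (coord (coord m 0) 1) (coord m 1))).
have pn0 i j : (pair_code i j == 0%N) = false.
  by rewrite -leqn0 leqNgt seqcode_gt0.
exists B, tau, chi; split; last by move=> t; rewrite /B !coord_pair.
move=> k; have [->|k0] := eqVneq k 0%N; last first.
  have [evk _] := FP (coord (coord k 0) 0, coord (coord k 0) 1).
  rewrite -/(G k) in evk.
  have Bk t : B (pair_code k t) = (G k).1.1 (pair_code (coord k 1) t).
    by rewrite /B !coord_pair (negbTE k0).
  have chik u : chi (pair_code k u) =
      pair_code (coord k 0) ((G k).2 (pair_code (coord k 1) u)).
    by rewrite /chi !coord_pair (negbTE k0).
  have Gk u : G (pair_code (coord k 0) u) = G k by rewrite /G !coord_pair.
  have tauk u : tau (pair_code (coord k 0) u) = (G k).1.2 u.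
    by rewrite /tau pn0 Gk coord_pair.
  have Bk' u t : B (pair_code (pair_code (coord k 0) u) t) = (G k).1.1 (pair_code u t).
    by rewrite /B !coord_pair pn0 Gk.
  have tk : tau k = (G k).1.2 (coord k 1) by rewrite /tau (negbTE k0).
  have [ev0 ev1] := evk (coord k 1); rewrite Bk tk; split=> [/ev0 ->|/ev1[-> h]].
    by split=> h t; have := h t; rewrite Bk.
  split=> [|i j s].
    by split=> -[i hi]; exists i => j; have := hi j; rewrite chik tauk.
  have -> : (fun t => B (pair_code (chi (pair_code k (pair_code i j))) t)) =
      (fun t => (G k).1.1 (pair_code ((G k).2 (pair_code (coord k 1) (pair_code i j))) t)).
    by apply/funext => t; rewrite chik Bk'.
  have -> : (fun t => B (pair_code k t.+1)) =
      (fun t => (G k).1.1 (pair_code (coord k 1) t.+1)).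
    by apply/funext => t; rewrite Bk.
  exact: h.
have B0 t : B (pair_code 0 t) = a t by rewrite /B !coord_pair.
have chi0 u : chi (pair_code 0 u) = pair_code u 0 by rewrite /chi !coord_pair.
have Gij i j u : G (pair_code (pair_code i j) u) = F (i, j) by rewrite /G !coord_pair.
rewrite B0 a1; split=> // _; split=> [|i j s].
  have tauE i j : tau (chi (pair_code 0 (pair_code i j))) = 1%N <-> A i j x.
    rewrite chi0 /tau pn0 Gij coord_pair; have [ev F0] := FP (i, j).
    exact: (evaluation_correct (cA i j) px ev).
  have -> : tau 0%N = nat_of_bool `[< (\bigcup_i \bigcap_j A i j) x >] by [].
  split; first by case: asboolP => // -[i _ h] _; exists i => j; exact/tauE/h.
  move=> [i h]; case: asboolP => // -[]; exists i => // j _; exact/tauE.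
have -> : (fun t => B (pair_code (chi (pair_code 0 (pair_code i j))) t)) = b i j.
  apply/funext => t; rewrite /B !coord_pair chi0 pn0 Gij coord_pair.
  by have [_ ->] := FP (i, j).
have -> : (fun t => B (pair_code 0 t.+1)) = shift a by apply/funext => t; rewrite B0.
exact: (ab i j).1.
Qed.

Local Notation r := (pres (euclidean_space R N)).

(* Makes the negative information [p s = 0 -> x outside the s-th ball] complete. *)
Definition saturated (p : baire) : Prop := forall s : nat, p s <> 0%N ->
  exists m : nat, forall s' : nat,
    qrat (coord s 1) - (m.+1%:R : R)^-1 + qrat (coord s' 1) <=
      `|r (coord s 0) - r (coord s' 0)| -> p s' = 0%N.

Lemma analytic_saturated : analytic saturated.
Proof. rewrite /saturated; analytic. Qed.

(** If [x] were outside ball [s] while [p s <> 0], a small enough ball around [x] would be disjoint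
    from the shrunken ball [s]. Saturation then marks that small ball as avoided, although it
    contains [x]. *)
Lemma saturated_outside p x : (forall s, p s = 0%N -> ~ nbhdE s x) ->
  saturated p -> outside p x.
Proof.
move=> px sat s; split=> [|xs]; first exact: px.
have [//|/eqP ps] := eqVneq (p s) 0%N; have [m mP] := sat s ps.
have e0 : 0 < (m.+1%:R : R)^-1 / 2 by rewrite divr_gt0 ?invr_gt0.
have [L _ Le] := exists_invn_lt 0 e0.
have [c xc] : exists c, `|x - r c| < (L.+1%:R : R)^-1.
  by apply: euclidean_dense; rewrite invr_gt0.
have /px[] : p (pair_code c (pair_code 1 L)) = 0%N.
  apply: mP; rewrite !coord_pair qrat_pair mul1r.
  have {}xs : qrat (coord s 1) <= `|x - r (coord s 0)|.
    by rewrite leNgt; exact/negP.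
  have := ler_distD (r c) x (r (coord s 0)); rewrite (distrC (r (coord s 0)) (r c)).
  move: Le xc xs; move: (`|x - r c|) (`|x - r (coord s 0)|) (`|r c - r (coord s 0)|).
  by move: (qrat _) (L.+1%:R^-1) (m.+1%:R^-1) => q l m' a b c'; lra.
by rewrite /basic_nbhd !coord_pair qrat_pair mul1r.
Qed.

Lemma outside_saturated p x : outside p x -> saturated p.
Proof.
move=> px s ps; have xs : nbhdE s x by apply: contrapT => h; apply: ps; exact/px.
have e0 : 0 < qrat (coord s 1) - `|x - r (coord s 0)| by rewrite subr_gt0.
have [m _ me] := exists_invn_lt 0 e0; exists m => s' ss'.
apply/px; rewrite /basic_nbhd /= => xs'.
have := ler_distD x (r (coord s 0)) (r (coord s' 0)).
rewrite (distrC (r (coord s 0)) x).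
move: me ss' xs'; rewrite -!/(r _).
move: (`|r (coord s 0) - r (coord s' 0)|) (`|x - r (coord s 0)|) (`|x - r (coord s' 0)|).
by move: (qrat (coord s 1)) (qrat (coord s' 1)) (m.+1%:R^-1) => q q' m' a b c'; lra.
Qed.

Lemma Delta11_of_code (a : baire) (A : set 'rV[R]_N) :
  Delta11_point R a -> convexly_generated_code a A ->
  Delta11 (A : set (euclidean_space R N)).
Proof.
move=> /analytic_Delta11_point aa [lt [xi [_ cA]]].
have ex x : exists p, outside p x.
  exists (fun s => nat_of_bool `[< nbhdE s x >]) => s.
  by case: asboolP => h; split.
(* One formula serves both sides: [v = true] gives the set, [v = false] its complement. *)
have main (v : bool) :
    Sigma11 ([set x | A x <-> v] : set (euclidean_space R N)).
  apply: (@Sigma11_euclidean _ _ _ (fun p => saturated p /\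
    exists B tau chi : baire, (fun t => B (pair_code 0 t)) = a /\
      evaluation B tau chi p /\ (tau 0%N = 1%N <-> v))).
    apply: analytic_and; first exact: analytic_saturated.
    analytic.
    - apply: (@analytic_subst _ _ _ _ _ (fun p : baire * baire * baire * baire =>
        (fun t => p.1.1.2 (pair_code 0 t)) : baire) _ aa); morph.
    - apply: (@analytic_subst _ _ _ _ _ (fun p : baire * baire * baire * baire =>
        (p.1.1.2, p.1.2, p.2, p.1.1.1)) _ analytic_evaluation); morph.
  move=> x; split=> [Axv|[p [px [sp [B [tau [chi [Ba [ev tv]]]]]]]]].
    have [p px] := ex x; have [B [tau [chi [ev Ba]]]] := evaluation_exists cA px.
    exists p; split; first by move=> s /px.
    split; first exact: outside_saturated px.
    exists B, tau, chi; split; first exact/funext.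
    by split=> //; rewrite (evaluation_correct cA px ev Ba).
  rewrite /= -tv; apply: iff_sym.
  by apply: (evaluation_correct cA (saturated_outside px sp) ev) => t; rewrite -Ba.
have mainE (v : bool) (B : set 'rV[R]_N) : (forall x, (A x <-> v) <-> B x) ->
    Sigma11 (B : set (euclidean_space R N)).
  move=> AvB; have := main v; congr Sigma11.
  by apply/funext => x; apply/propext/AvB.
split; [apply: (mainE true)|apply: (mainE false)] => x.
  by split=> [h|Ax]; [apply/h|split].
by split=> [h /h|nAx]; [|split].
Qed.

End Evaluation.

(** * Convex combinations *)

Section ConvexCombinations.
Context {R : realType} {N : nat}.
Implicit Types (S A : set 'rV[R]_N) (x y z : 'rV[R]_N).

Lemma convex_setE A : convex_set A <->
  forall x y (t : R), A x -> A y -> 0 <= t -> t <= 1 -> A (t *: x + (1 - t) *: y).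
Proof.
split=> [cA x y t Ax Ay t0 t1|cA x y l].
  have := cA x y (Itv01 t0 t1); rewrite !inE => /(_ Ax Ay); exact.
rewrite !inE => Ax Ay; exact: cA.
Qed.

Definition combination S (m : nat) z := exists (l : 'rV[R]_m) (X : 'M[R]_(m, N)),
  [/\ forall i, 0 <= l 0 i, \sum_i l 0 i = 1, forall i, S (row i X) & z = l *m X].

Lemma combination1 S z : S z -> combination S 1 z.
Proof.
move=> Sz; exists (const_mx 1), z; split=> [i|||].
- by rewrite mxE.
- by rewrite big_ord1 mxE.
- by move=> i; rewrite (_ : row i z = z) //; apply/rowP => j; rewrite mxE (ord1 i).
- by apply/rowP => j; rewrite mxE big_ord1 mxE mul1r.
Qed.

Lemma combination_mono S S' m z :
  (forall x, S x -> S' x) -> combination S m z -> combination S' m z.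
Proof. by move=> SS' [l [X [l0 l1 SX ->]]]; exists l, X; split=> // i; exact/SS'. Qed.

Lemma combination_join S m n x y (t : R) : 0 <= t -> t <= 1 ->
  combination S m x -> combination S n y ->
  combination S (m + n) (t *: x + (1 - t) *: y).
Proof.
move=> t0 t1 [l [X [l0 l1 SX ->]]] [l' [X' [l0' l1' SX' ->]]].
exists (row_mx (t *: l) ((1 - t) *: l')), (col_mx X X'); split.
- move=> i; case: (splitP i) => j ij.
    have -> : i = lshift n j by exact/val_inj.
    by rewrite row_mxEl mxE mulr_ge0.
  have -> : i = rshift m j by exact/val_inj.
  by rewrite row_mxEr mxE mulr_ge0// subr_ge0.
- rewrite big_split_ord /=.
  under eq_bigr do rewrite row_mxEl mxE.
  under [X in _ + X]eq_bigr do rewrite row_mxEr mxE.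
  by rewrite -!mulr_sumr l1 l1' !mulr1 addrCA subrr addr0.
- move=> i; case: (splitP i) => j ij.
    have -> : i = lshift n j by exact/val_inj.
    by rewrite rowKu.
  have -> : i = rshift m j by exact/val_inj.
  by rewrite rowKd.
- by rewrite mul_row_col -!scalemxAl.
Qed.

(** The remaining weights are rescaled by [1 / (1 - t)]. For [t = 1] they all vanish and cannot be
    normalised, so [y] is then arbitrary and nothing is claimed about it. *)
Lemma combination_split S m z : combination S m.+1 z ->
  exists (t : R) x y, [/\ 0 <= t, t <= 1, S x & z = t *: x + (1 - t) *: y
    /\ (t < 1 -> combination S m y)].
Proof.
move=> [l [X [l0 l1 SX ->]]].
have lX : l *m X = l 0 0 *: row 0 X + \sum_(i < m) l 0 (lift 0 i) *: row (lift 0 i) X.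
  rewrite mulmx_sum_row big_ord_recl; congr (_ + _).
move: l1; rewrite big_ord_recl => l1.
have s0 : 0 <= \sum_(i < m) l 0 (lift 0 i) by apply: sumr_ge0.
pose t := l 0 0; have t1 : t <= 1 by rewrite -l1 lerDl.
have [t1'|t1'] := eqVneq t 1.
  exists t, (row 0 X), 0; split; [exact: l0|exact: t1|exact: SX|].
  split; last by rewrite t1' ltxx.
  rewrite lX scaler0 addr0 big1 ?addr0// => i _.
  have /eqP : \sum_(i < m) l 0 (lift 0 i) = 0.
    by apply: (addrI t); rewrite addr0 [LHS]l1 t1'.
  by rewrite psumr_eq0 // => /allP/(_ i (mem_index_enum _))/eqP ->; rewrite scale0r.
have t10 : 1 - t != 0 by rewrite subr_eq0 eq_sym.
have t1_gt0 : 0 < 1 - t by rewrite subr_gt0 lt_neqAle t1'.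
exists t, (row 0 X), ((1 - t)^-1 *: \sum_(i < m) l 0 (lift 0 i) *: row (lift 0 i) X).
split; [exact: l0|exact: t1|exact: SX|].
split; first by rewrite scalerA divff// scale1r.
move=> _; exists (\row_i ((1 - t)^-1 * l 0 (lift 0 i))), (\matrix_i row (lift 0 i) X).
split.
- by move=> i; rewrite mxE mulr_ge0// invr_ge0 ltW.
- under eq_bigr do rewrite mxE.
  rewrite -mulr_sumr (_ : \sum_i _ = 1 - t) ?mulVf//.
  by apply: (addrI t); rewrite addrCA subrr addr0; exact: l1.
- by move=> i; rewrite rowK.
- rewrite mulmx_sum_row scaler_sumr; apply: eq_bigr => i _.
  by rewrite mxE rowK scalerA.
Qed.

Lemma combination0 S z : ~ combination S 0 z.
Proof. by move=> [l [X [_ + _ _]]]; rewrite big_ord0 => /esym/eqP; rewrite oner_eq0. Qed.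

Lemma combination_convex S A m z : convex_set A -> (forall x, S x -> A x) ->
  combination S m z -> A z.
Proof.
move=> /convex_setE cA SA; elim: m z => [z /combination0//|m IH z].
move=> /combination_split[t [x [y [t0 t1 /SA Ax [-> cy]]]]].
have [t1'|] := eqVneq t 1; first by rewrite t1' subrr scale0r addr0 scale1r.
move=> nt1; apply: cA => //; apply/IH/cy.
by rewrite lt_neqAle nt1.
Qed.

Lemma combinationS S m z : combination S m z -> combination S m.+1 z.
Proof.
case: m => [/combination0//|m] cz.
have [t [x [_ [_ _ Sx _]]]] := combination_split cz.
have := combination_join (lexx 0) ler01 (combination1 Sx) cz.
by rewrite scale0r add0r subr0 scale1r add1n.
Qed.

(* A linear dependency between the points, of total weight zero, is subtracted until
   one of the coefficients vanishes. *)
Lemma combination_drop S m z : (N.+1 < m.+1)%N ->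
  combination S m.+1 z -> combination S m z.
Proof.
move=> Nm [l [X [l0 l1 SX ->]]].
(* The extra column of ones makes a kernel vector have total weight zero; with [N + 1] columns and
   more rows, the kernel is nonzero. *)
pose M := row_mx X (const_mx 1 : 'cV[R]_m.+1).
have /rowV0Pn[v vker v0] : kermx M != 0.
  rewrite -mxrank_eq0 mxrank_ker -lt0n subn_gt0.
  by apply: leq_ltn_trans (rank_leq_col _) _; rewrite addn1.
have {vker} : v *m M == 0 by rewrite -sub_kermx.
rewrite mul_mx_row -row_mx0 => /eqP/eq_row_mx[vX v1].
have vsum : \sum_i v 0 i = 0.
  have /rowP/(_ 0) := v1; rewrite [LHS]mxE [RHS]mxE => vs.
  by rewrite -[RHS]vs; apply: eq_bigr => i _; rewrite mxE mulr1.
have [i0 vi0] : exists i, 0 < v 0 i.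
  apply: contrapT => /forallNP vneg; case/negP: v0; apply/eqP/rowP => i.
  have vle j : 0 <= - v 0 j by rewrite oppr_ge0 leNgt; exact/negP.
  have /eqP : \sum_i - v 0 i = 0 by rewrite sumrN vsum oppr0.
  rewrite psumr_eq0 // => /allP/(_ i (mem_index_enum _)).
  by rewrite oppr_eq0 mxE => /eqP.
(* The smallest ratio over the positive entries of [v] is the largest multiple of [v] that can be
   subtracted while all weights stay nonnegative. *)
have [i vi imin] := @arg_minP _ _ _ i0 [pred i | 0 < v 0 i] (fun i => l 0 i / v 0 i) vi0.
pose t := l 0 i / v 0 i; pose l' := l - t *: v.
have vi' : v 0 i != 0 by rewrite gt_eqF.
have l'i : l' 0 i = 0 by rewrite !mxE /t divfK// subrr.
have l'0 j : 0 <= l' 0 j.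
  rewrite !mxE subr_ge0; have [vj|vj] := ltP 0 (v 0 j).
    by rewrite -ler_pdivlMr//; exact: imin.
  apply: le_trans (l0 j); rewrite mulr_ge0_le0// divr_ge0// ltW//.
have l'1 : \sum_j l' 0 j = 1.
  under eq_bigr do rewrite !mxE.
  by rewrite big_split /= sumrN -mulr_sumr vsum mulr0 subr0.
have l'X : l *m X = l' *m X.
  by rewrite mulmxBl -scalemxAl vX scaler0 subr0.
exists (\row_j l' 0 (lift i j)), (\matrix_j row (lift i j) X); split.
- by move=> j; rewrite mxE.
- under eq_bigr do rewrite mxE.
  by move: l'1; rewrite (bigD1_ord i) //= l'i add0r.
- by move=> j; rewrite rowK.
- rewrite l'X !mulmx_sum_row (bigD1_ord i) //= l'i scale0r add0r.
  by apply: eq_bigr => j _; rewrite mxE rowK.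
Qed.

(** Padding short combinations makes the number of points exactly [N.+1], so that weights and points
    live in spaces of fixed dimension when limits are taken. *)
Lemma caratheodory S m z : combination S m z -> combination S N.+1 z.
Proof.
have [Nm|mN] := leqP N.+1 m.
  rewrite -(subnK Nm); elim: (m - _)%N => [|k IH]; first by rewrite add0n.
  rewrite addSn => /combination_drop h; apply/IH/h.
  by rewrite ltnS leq_addl.
rewrite -(subnK (ltnW mN)); elim: (N.+1 - m)%N => [|k IH]; first by rewrite add0n.
by move=> /IH/combinationS.
Qed.

End ConvexCombinations.

(** * Limits along an ultrafilter *)

Section UltraLimits.
Context {R : realType}.

(** Ultrafilters replace repeated extraction of subsequences: weights, points and digits of
    witnesses all converge along the same [U]. *)
Lemma ultra_bounded_cvg (U : set_system nat) n (f : nat -> 'rV[R]_n) (M : R) :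
  UltraFilter U -> (U [set k | `|f k| <= M]) ->
  exists l : 'rV[R]_n, f @ U --> l.
Proof.
move=> UU fM; have cM : compact [set x : 'rV[R]_n | `|x| <= M].
  apply: bounded_closed_compact.
    by exists M; split; [exact: num_real|move=> y My x /= /le_trans; apply; exact: ltW].
  rewrite (_ : [set x | _] = (fun x : 'rV[R]_n => `|x|) @^-1` [set r : R | r <= M]) //.
  by apply: closed_comp => [x _|]; [exact: norm_continuous|exact: closed_le].
have [l [_ lcl]] := cM (f @ U) _ fM; exists l => V Vl.
have [//|nV] := in_ultra_setVsetC (f @^-1` V) UU.
by have [x [/= nx Vx]] := lcl (~` V) V nV Vl.
Qed.

Lemma ultra_bounded_nat (U : set_system nat) (f : nat -> nat) m :
  UltraFilter U -> (U [set k | (f k <= m)%N]) ->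
  exists2 v, (v <= m)%N & U [set k | f k = v].
Proof.
move=> UU; elim: m => [|m IH] fm.
  by exists 0%N => //; apply: filterS fm => k /=; rewrite leqn0 => /eqP.
have [h|h] := in_ultra_setVsetC [set k | f k = m.+1] UU; first by exists m.+1.
have [|v vm fv] := IH; last by exists v => //; exact: leqW.
apply: filterS2 h fm => k /= /eqP fk; rewrite leq_eqVlt (negbTE fk) /=.
by rewrite ltnS.
Qed.

Lemma cvg_dist_lt (U : set_system nat) (V : normedModType R) (f : nat -> V) (l : V) e
  {UF : Filter U} : f @ U --> l -> 0 < e -> U [set k | `|l - f k| < e].
Proof. by move=> /cvgrPdist_lt h /h. Qed.

Lemma cvg_coord (U : set_system nat) n (f : nat -> 'rV[R]_n) (l : 'rV[R]_n) i
  {UF : Filter U} : f @ U --> l -> (fun k => f k 0 i) @ U --> l 0 i.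
Proof.
move=> fl; apply/cvgrPdist_lt => e e0.
apply: filterS (cvg_dist_lt fl e0) => k /=; apply: le_lt_trans.
by have := le_mx_norm (l - f k) i; rewrite !mxE.
Qed.

Lemma cvg_bigsum (U : set_system nat) (I : Type) (V : normedModType R)
    (f : I -> nat -> V) (l : I -> V) (s : seq I)
  {UF : Filter U} : (forall i, f i @ U --> l i) ->
  (fun k => \sum_(i <- s) f i k) @ U --> \sum_(i <- s) l i.
Proof.
move=> fl; elim: s => [|i s IH].
  rewrite big_nil (_ : (fun k => _) = fun=> 0); first exact: cvg_cst.
  by apply/funext => k; rewrite big_nil.
rewrite big_cons (_ : (fun k => _) = f i + fun k => \sum_(j <- s) f j k).
  exact: cvgD.
by apply/funext => k; rewrite big_cons.
Qed.

Lemma cvg_ge0 (U : set_system nat) (f : nat -> R) (l : R)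
  {UF : ProperFilter U} : f @ U --> l -> (U [set k | 0 <= f k]) -> 0 <= l.
Proof.
move=> fl f0; rewrite leNgt; apply/negP => l0.
have l0' : 0 < - l by rewrite oppr_gt0.
have [k [/= fk]] := filter_ex (filterI f0 (@cvg_dist_lt _ R^o _ _ _ _ fl l0')).
by rewrite ltr_norml opprK => /andP[]; lra.
Qed.

End UltraLimits.

(** * Approximation by finite stages and the compactness argument *)

Section Separation.
Context {R : realType} {N : nat}.
Local Notation r := (pres (euclidean_space R N)).

(* [x] has not been excluded, at stage [k], from the projection of the closed set
   avoiding the balls [e 0, e 1, ...], with witness bounded by [al]. *)
Definition stage (e al : baire) (k : nat) (u : baire) (x : 'rV[R]_N) : Prop :=
  [/\ forall i, (i < k)%N -> (u i <= al i)%N /\ `|x| <= (al 0%N).+1%:R &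
    forall n, (n < k)%N -> ~ ((exists l, [/\ (l <= k)%N,
        forall i, (i < l)%N -> u i = coord (coord (coord (e n) 0) 1) i &
        (l.+1%:R : R)^-1 < qrat (coord (e n) 1)]) /\
      `|x - r (coord (coord (e n) 0) 0)| + k.+1%:R^-1 < qrat (coord (e n) 1))].

Definition in_closed (e b : baire) (x : 'rV[R]_N) : Prop :=
  forall k, ~ (`|x - r (coord (coord (e k) 0) 0)| < qrat (coord (e k) 1) /\
    exists l, (forall i, (i < l)%N -> b i = coord (coord (coord (e k) 0) 1) i) /\
      (l.+1%:R : R)^-1 < qrat (coord (e k) 1)).

(** Each digit of the witnesses is bounded by [al], hence constant on a set in [U]; these constants
    form [b]. A ball excluding the limit pair contains it with room to spare, so it would exclude
    the pairs at large stages too. *)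
Lemma stage_limit (U : set_system nat) (e al : baire) (u : nat -> baire)
    (x : nat -> 'rV[R]_N) (y : 'rV[R]_N) :
  UltraFilter U -> (forall m, U [set k | (m <= k)%N]) ->
  (U [set k | stage e al k (u k) (x k)]) -> x @ U --> y ->
  exists b, in_closed e b y.
Proof.
move=> UU Uinf st xy.
have /choice[b bP] i : exists v, U [set k | u k i = v].
  have [|v _ vP] := @ultra_bounded_nat U (fun k => u k i) (al i) UU.
    by apply: filterS2 (Uinf i.+1) st => k ik [/(_ i ik)[]].
  by exists v.
exists b => n [yn [l [bl lq]]].
have bu m : U [set k | forall i, (i < m)%N -> u k i = b i].
  elim: m => [|m IH]; first exact: filterE.
  apply: filterS2 IH (bP m) => k h1 h2 i; rewrite ltnS leq_eqVlt.
  by case/predU1P => [-> //|]; exact: h1.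
(* Half of the slack pays for moving from [y] to [x k], the other half for the margin [1 / k.+1]
   built into [stage]. *)
pose d := (qrat (coord (e n) 1) - `|y - r (coord (coord (e n) 0) 0)|) / 2.
have d0 : 0 < d by rewrite divr_gt0// subr_gt0.
have [K _ Kd] := exists_invn_lt 0 d0.
have xd : U [set k | `|y - x k| < d] by apply: cvg_dist_lt xy d0.
have [k [k1 k2 k3 stk]] : exists k, [/\ (maxn (maxn l K) n.+1 <= k)%N,
    forall i, (i < l)%N -> u k i = b i, `|y - x k| < d & stage e al k (u k) (x k)].
  have [k [? [? [? ?]]]] := filter_ex (filterI (Uinf (maxn (maxn l K) n.+1))
    (filterI (bu l) (filterI xd st))).
  by exists k; split.
move: k1; rewrite !geq_max => /andP[/andP[lk Kk] nk].
have [_ /(_ n nk)] := stk; apply; split.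
  by exists l; split=> // i il; rewrite k2// bl.
have := ler_distD y (x k) (r (coord (coord (e n) 0) 0)); rewrite (distrC (x k) y).
have := @ler_invS R _ _ Kk; move: Kd k3; rewrite /d.
move: (`|y - x k|) (`|x k - _|) (`|y - _|) (k.+1%:R^-1) (K.+1%:R^-1) (qrat _).
by move=> *; lra.
Qed.

(** The parameter [K] allows the stage to be taken beyond the starting length of a given branch. If
    every stage failed, counterexamples [F k] would converge to a convex combination of points of
    [A] that equals a point of the complement. *)
Lemma separation_stage (A : set 'rV[R]_N) (e e' : baire) (al : baire) (K : nat) :
  convex_set A -> (forall x, A x <-> exists b, in_closed e b x) ->
  (forall x, ~ A x <-> exists b, in_closed e' b x) ->
  exists2 k, (K < k)%N & exists m, forall z u y,
    combination (fun x => exists u, stage e al k u x) N.+1 z -> stage e' al k u y ->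
    m.+1%:R^-1 <= `|z - y|.
Proof.
move=> cA AE nAE; apply: contrapT => nsep.
have /choice[F FP] k : exists p : 'rV[R]_N.+1 * 'M[R]_(N.+1, N) * baire * 'rV[R]_N *
      ('I_N.+1 -> baire), (K < k)%N ->
    [/\ forall i, 0 <= p.1.1.1.1 0 i, \sum_i p.1.1.1.1 0 i = 1,
      forall i, stage e al k (p.2 i) (row i p.1.1.1.2),
      stage e' al k p.1.1.2 p.1.2 &
      `|p.1.1.1.1 *m p.1.1.1.2 - p.1.2| < k.+1%:R^-1].
  have [Kk|] := ltnP K k; last by exists (0, 0, id, 0, fun=> id).
  apply: contrapT => nk; apply: nsep; exists k => //; exists k => z u y.
  move=> [l [X [l0 l1 /choice[w wX] ->]]] sy; rewrite leNgt; apply/negP => lt_zy.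
  by apply: nk; exists (l, X, u, y, w).
pose l k := (F k).1.1.1.1; pose X k := (F k).1.1.1.2; pose y k := (F k).1.2.
have [U [UU UF]] := @ultraFilterLemma nat \oo _.
have Uinf m : U [set k | (m <= k)%N] by apply: UF; exact: nbhs_infty_ge.
have FU (P : set nat) : (forall k, (K < k)%N -> P k) -> U [set k | P k].
  by move=> h; apply: filterS (Uinf K.+1).
have [ll lcv] : exists ll : 'rV[R]_N.+1, l @ U --> ll.
  apply: (@ultra_bounded_cvg _ _ _ _ 1); apply: FU => k Kk.
  have [l0 l1 _ _ _] := FP k Kk.
  rewrite [leLHS]mx_normrE; apply: bigmax_le => // -[i j] _ /=.
  rewrite (ord1 i) ger0_norm; last exact: l0.
  rewrite -l1 (bigD1 j) //= lerDl; apply: sumr_ge0 => ? _; exact: l0.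
have /choice[xx xcv] i : exists xi : 'rV[R]_N, (fun k => row i (X k)) @ U --> xi.
  apply: (@ultra_bounded_cvg _ _ _ _ (al 0%N).+1%:R); apply: FU => k Kk.
  by have [_ _ /(_ i)[/(_ 0%N (leq_ltn_trans (leq0n K) Kk))[]]] := FP k Kk.
have [yy ycv] : exists yy : 'rV[R]_N, y @ U --> yy.
  apply: (@ultra_bounded_cvg _ _ _ _ (al 0%N).+1%:R); apply: FU => k Kk.
  by have [_ _ _ [/(_ 0%N (leq_ltn_trans (leq0n K) Kk))[]]] := FP k Kk.
have zcv : (fun k => l k *m X k) @ U --> \sum_i ll 0 i *: xx i.
  rewrite (_ : (fun k => _) = fun k => \sum_i l k 0 i *: row i (X k)).
    apply: cvg_bigsum => i; apply: cvgZ; last exact: xcv.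
    exact: cvg_coord.
  by apply/funext => k; rewrite mulmx_sum_row.
have zy : \sum_i ll 0 i *: xx i = yy.
  apply: contrapT => /eqP; rewrite -subr_eq0 -normr_gt0 => d0.
  (* One third each for the convergence of the combinations, the convergence of [y], and the gap
     [1 / k.+1] between the two sequences. *)
  have d3 : 0 < `|\sum_i ll 0 i *: xx i - yy| / 3 by rewrite divr_gt0.
  have [M _ Md] := exists_invn_lt 0 d3.
  have [k [k1 [k2 k3]]] := filter_ex (filterI (Uinf (maxn K.+1 M))
    (filterI (cvg_dist_lt zcv d3) (cvg_dist_lt ycv d3))).
  move: k1 k2 k3 => /=; rewrite geq_max => /andP[Kk /(@ler_invS R) k1] k2 k3.
  have [_ _ _ _ lt_k] := FP k Kk; rewrite -/(l k) -/(X k) -/(y k) in lt_k.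
  have h1 := ler_distD (l k *m X k) (\sum_i ll 0 i *: xx i) yy.
  have h2 := ler_distD (y k) (l k *m X k) yy.
  rewrite (distrC (y k) yy) in h2.
  move: Md k1 k2 k3 lt_k h1 h2.
  set Z := \sum_i _; set z := l _ *m _.
  move: (`|Z - yy|) (`|z - yy|) (`|yy - _|) (`|Z - z|) (`|z - _|) (k.+1%:R^-1).
  by move: (_^-1) => *; lra.
have nAyy : ~ A yy.
  apply/nAE; apply: (stage_limit (u := fun k => (F k).1.1.2) UU Uinf _ ycv).
  by apply: FU => k Kk; have [_ _ _ h _] := FP k Kk; exact: h.
apply: nAyy; rewrite -zy.
apply: (@combination_convex _ _ A A N.+1) => //.
exists ll, (\matrix_i xx i); split.
- move=> i; apply: (cvg_ge0 (cvg_coord lcv)).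
  by apply: FU => k Kk; have [h _ _ _ _] := FP k Kk; exact: h.
- have h : (fun k => \sum_i l k 0 i) @ U --> \sum_i ll 0 i.
    by apply: (@cvg_bigsum R U _ R^o) => i; exact: cvg_coord.
  have h1 : (fun k => \sum_i l k 0 i) @ U --> (1 : R).
    apply: (@cvg_near_cst _ R^o); apply: FU => k Kk.
    by have [_ h1 _ _ _] := FP k Kk; exact: h1.
  have PF : ProperFilter ((fun k => \sum_i l k 0 i) @ U) by exact: fmap_proper_filter.
  exact: (@norm_cvg_unique R R^o _ PF _ _ h h1).
- move=> i; rewrite rowK; apply/AE.
  apply: (stage_limit (u := fun k => (F k).2 i) UU Uinf _ (xcv i)).
  by apply: FU => k Kk; have [_ _ h _ _] := FP k Kk; exact: h.
- by rewrite mulmx_sum_row; apply: eq_bigr => i _; rewrite rowK.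
Qed.

End Separation.

(** * Ranks of well-founded relations *)

Section Rank.
Variable lt : nat -> nat -> Prop.
Hypothesis lt_wf : well_founded lt.

(** Comparison of the ordinal ranks in a well-founded relation, expressed without introducing
    ordinals. *)
Inductive rank_le (x y : nat) : Prop :=
  RankLe of forall x', lt x' x -> exists2 y', lt y' y & rank_le x' y'.

Definition rank_lt (x y : nat) : Prop := exists2 y', lt y' y & rank_le x y'.

Lemma rank_le_refl x : rank_le x x.
Proof. by elim/(well_founded_ind lt_wf): x => x IH; split=> x' x'x; exists x'; auto. Qed.

Lemma rank_le_trans x y z : rank_le x y -> rank_le y z -> rank_le x z.
Proof.
elim/(well_founded_ind lt_wf): x y z => x IH y z [xy] [yz]; split=> x' x'x.
have [y' y'y le1] := xy _ x'x; have [z' z'z le2] := yz _ y'y.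
by exists z' => //; exact: IH le1 le2.
Qed.

Lemma rank_le_lt x y z : rank_le x y -> rank_lt y z -> rank_lt x z.
Proof. by move=> xy [z' ? yz']; exists z' => //; exact: rank_le_trans yz'. Qed.

Lemma rank_lt_le x y z : rank_lt x y -> rank_le y z -> rank_lt x z.
Proof.
move=> [y' y'y xy'] [yz]; have [z' ? y'z'] := yz _ y'y.
by exists z' => //; exact: rank_le_trans y'z'.
Qed.

Lemma rank_ltNge x y : ~ rank_le x y -> rank_lt y x.
Proof.
elim/(well_founded_ind lt_wf): x y => x IH y nxy.
have [x' [x'x nx']] : exists x', lt x' x /\ forall y', lt y' y -> ~ rank_le x' y'.
  apply: contrapT => /forallNP h; apply: nxy; split=> x' x'x.
  have /not_andP[//|/existsNP[y' /not_implyP[y'y /contrapT ?]]] := h x'.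
  by exists y'.
exists x' => //; split=> y' y'y; exact: IH (nx' _ y'y).
Qed.

Lemma rank_lt_le_weak x y : rank_lt x y -> rank_le x y.
Proof.
elim/(well_founded_ind lt_wf): x y => x IH y [y' y'y [xy']].
split=> x' x'x; exists y' => //; have [y'' y''y' x'y''] := xy' _ x'x.
by apply: (IH _ x'x); exists y''.
Qed.

Lemma rank_lt_wf : well_founded rank_lt.
Proof.
suff h x y : rank_le y x -> Acc rank_lt y by move=> x; exact: h (rank_le_refl x).
elim/(well_founded_ind lt_wf): x y => x IH y [yx]; split=> z [y' y'y zy'].
have [x' x'x y'x'] := yx _ y'y.
exact: IH x'x _ (rank_le_trans zy' y'x').
Qed.

Lemma rank_leP x y : rank_lt x y \/ rank_le y x.
Proof. by have [yx|/rank_ltNge] := pselect (rank_le y x); [right|left]. Qed.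

(** Elements of equal rank are ordered as numbers, since a [wellorder] must be linear on the
    naturals themselves. *)
Definition rank_lex (x y : nat) : Prop :=
  rank_lt x y \/ [/\ rank_le x y, rank_le y x & (x < y)%N].

Lemma rank_lex_wf : well_founded rank_lex.
Proof.
suff h x : forall y, rank_le x y -> rank_le y x -> Acc rank_lex y.
  by move=> x; apply: h; exact: rank_le_refl.
elim/(well_founded_ind rank_lt_wf): x => x IH y.
elim/(well_founded_ind Wf_nat.lt_wf): y => y IHy xy yx; split=> z [zy|[zy yz ltzy]].
  by apply: (IH z); [exact: rank_lt_le zy yx|exact: rank_le_refl|exact: rank_le_refl].
apply: IHy; [exact/ssrnat.ltP|exact: rank_le_trans yz|exact: rank_le_trans yx].
Qed.

Lemma rank_lex_trans x y z : rank_lex x y -> rank_lex y z -> rank_lex x z.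
Proof.
move=> [xy|[xy yx ltxy]] [yz|[yz zy ltyz]].
- by left; exact: rank_lt_le xy (rank_lt_le_weak yz).
- by left; exact: rank_lt_le xy yz.
- by left; exact: rank_le_lt xy yz.
- right; split; [exact: rank_le_trans yz|exact: rank_le_trans yx|exact: ltn_trans ltyz].
Qed.

Lemma rank_lex_total x y : [\/ rank_lex x y, x = y | rank_lex y x].
Proof.
have [xy|yx] := rank_leP x y; first by constructor 1; left.
have [yx'|xy] := rank_leP y x; first by constructor 3; left.
case: (ltngtP x y) => [xlty|yltx|->]; last by constructor 2.
  by constructor 1; right.
by constructor 3; right.
Qed.

Lemma wellorder_rank (leaf : nat -> Prop) :
  exists (ord : nat -> nat -> Prop) (rho : nat -> nat),
  [/\ wellorder ord, forall n, leaf n -> forall m, ~ ord m (rho n) &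
      forall m n, ~ leaf n -> lt m n -> ord (rho m) (rho n)].
Proof.
(* A new least element [0] is put below the copies [n.+1] of all [n]. Codes of closed sets sit at
   ordinal zero exactly, so every leaf is sent there, whatever its rank. *)
pose ord a b := match a, b with
  | 0%N, b.+1 => True | a.+1, b.+1 => rank_lex a b | _, _ => False end.
exists ord, (fun n => if `[< leaf n >] then 0%N else n.+1); split.
- split.
  + have acc0 : Acc ord 0%N by split=> -[].
    have accS n : Acc ord n.+1.
      elim/(well_founded_ind rank_lex_wf): n => n IH; split=> -[//|m]; exact: IH.
    by case.
  + by move=> [|x] [|y] [|z] //; exact: rank_lex_trans.
  + move=> [|x] [|y]; [by constructor 2|by constructor 1|by constructor 3|].
    by have [] := rank_lex_total x y;
      [constructor 1|move=> ->; constructor 2|constructor 3].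
- by move=> n ln m; rewrite asboolT//; case: m => [|m] [].
- move=> m n nln mn; rewrite (asboolF nln); case: asboolP => // _.
  by left; exists m => //; exact: rank_le_refl.
Qed.

End Rank.

(** * Rational convex hulls *)

Section RationalHull.
Context {R : realType} {N : nat}.
Local Notation r := (pres (euclidean_space R N)).

Lemma rat_pres_int c : exists (z : int) (k : nat), rat_pres c = z%:~R / k.+1%:R :> R.
Proof.
exists ((-1) ^+ coord c 0 * (coord c 1)%:Z), (coord c 2).
by rewrite intrM rmorphXn /= rmorphN1.
Qed.

Lemma rat_pres_surj (z : int) k : exists c, rat_pres c = z%:~R / k.+1%:R :> R.
Proof.
exists (seqcode [:: (z < 0)%R : nat; `|z|%N; k]).
rewrite /rat_pres !coord_seqcode /=; congr (_ / _).
rewrite {3}[z]intEsign intrM rmorphXn /= rmorphN1.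
by [].
Qed.

(** The mean of [r i] and [r j] with weights proportional to [p] and [q]; clearing the denominator
    leaves a decidable equality of rationals. *)
Definition rational_mean (p q i j z : nat) : bool :=
  [forall c : 'I_N, (p + q)%:R * @rat_pres R (coord z c) ==
     p%:R * rat_pres (coord i c) + q%:R * rat_pres (coord j c)].

Lemma rational_meanP p q i j z : reflect
  ((p + q)%:R *: r z = p%:R *: r i + q%:R *: r j) (rational_mean p q i j z).
Proof.
apply: (iffP forallP) => [h|/rowP h c]; last by have := h c; rewrite !mxE => ->.
by apply/rowP => c; rewrite !mxE; apply/eqP/h.
Qed.

Lemma rational_mean_exists p q i j : (0 < p + q)%N -> exists z, rational_mean p q i j z.
Proof.
move=> pq; have /choice[f fP] (c : 'I_N) : exists k, (p + q)%:R * @rat_pres R k =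
    p%:R * rat_pres (coord i c) + q%:R * rat_pres (coord j c).
  have [z [k ->]] := rat_pres_int (coord i c).
  have [z' [k' ->]] := rat_pres_int (coord j c).
  have [k'' kE] := rat_pres_surj (p%:Z * z * k'.+1%:Z + q%:Z * z' * k.+1%:Z)
    ((p + q) * (k.+1 * k'.+1)).-1.
  exists k''; rewrite kE prednK ?muln_gt0 ?pq// !natrM.
  have pq0 : (p + q)%:R != 0 :> R by rewrite pnatr_eq0 -lt0n.
  have k0 : k.+1%:R != 0 :> R by rewrite pnatr_eq0.
  have k'0 : k'.+1%:R != 0 :> R by rewrite pnatr_eq0.
  rewrite !(intrD, intrM) -!pmulrn.
  move: (k.+1%:R) (k'.+1%:R) ((p + q)%:R) k0 k'0 pq0 => a b c' a0 b0 c0.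
  by field; rewrite a0 b0 c0.
have [z zE] := @euclidean_pres_coord R N f.
exists z; apply/forallP => c; apply/eqP.
by rewrite -fP -zE mxE.
Qed.

(** Iterated binary means reach the rational combinations while each level remains arithmetical in
    the previous one, which is what [bianalytic_hull] needs. *)
Fixpoint hull_level (H : nat -> Prop) (m z : nat) : Prop :=
  if m is m'.+1 then exists i j p q, [/\ hull_level H m' i, hull_level H m' j,
    (0 < p + q)%N & rational_mean p q i j z]
  else H z.

Definition hull (H : nat -> Prop) (z : nat) : Prop := exists m, hull_level H m z.

Variable H : nat -> Prop.

Lemma hull_levelS m n z : (m <= n)%N -> hull_level H m z -> hull_level H n z.
Proof.
move=> /subnK <-; elim: (n - m)%N z => // k IH z /IH hz.
exists z, z, 1%N, 0%N; split=> //; apply/rational_meanP.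
by rewrite addn0 scale1r scale0r addr0.
Qed.

Lemma hull_mean p q i j z : hull H i -> hull H j -> (0 < p + q)%N ->
  rational_mean p q i j z -> hull H z.
Proof.
move=> [m hi] [n hj] pq mz; exists (maxn m n).+1, i, j, p, q; split=> //.
  by apply: hull_levelS hi; rewrite leq_maxl.
by apply: hull_levelS hj; rewrite leq_maxr.
Qed.

Lemma hull_combination z : hull H z ->
  exists n, combination [set x | exists2 j, H j & x = r j] n (r z).
Proof.
move=> [m]; elim: m z => [|m IH] z.
  by move=> Hz; exists 1%N; apply: combination1; exists z.
move=> [i [j [p [q [/IH[n ci] /IH[n' cj] pq /rational_meanP zE]]]]].
have pq0 : 0 < (p + q)%:R :> R by rewrite ltr0n.
pose t : R := p%:R / (p + q)%:R.
have t1 : 1 - t = q%:R / (p + q)%:R.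
  apply: (mulIf (lt0r_neq0 pq0)); rewrite mulrBl !divfK ?gt_eqF// mul1r natrD.
  by rewrite addrAC subrr add0r.
exists (n + n')%N; rewrite (_ : r z = t *: r i + (1 - t) *: r j).
  apply: combination_join => //; first by rewrite divr_ge0.
  by rewrite -subr_ge0 t1 divr_ge0.
apply: (scalerI (lt0r_neq0 pq0)); rewrite zE t1 scalerDr !scalerA.
by rewrite !(mulrC (p + q)%:R) !divfK ?gt_eqF.
Qed.

Definition hull_closure : set 'rV[R]_N :=
  [set x | forall e, 0 < e -> exists2 z, hull H z & `|x - r z| < e].

(** The real weight [t] must be replaced by a fraction [p / n.+1]. The error is [e / 4] for each
    endpoint and [e / 4] for the weight, whose change is multiplied by a distance at most [M]. *)
Lemma hull_closure_convex : convex_set hull_closure.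
Proof.
apply/convex_setE => x y t hx hy t0 t1 e e0.
have e4 : 0 < e / 4 by rewrite divr_gt0.
have [i hi xi] := hx _ e4; have [j hj yj] := hy _ e4.
pose M := `|r i| + `|r j| + 1.
have M0 : 0 < M by rewrite ltr_wpDl// addr_ge0.
have [n _ nM] := exists_invn_lt 0 (divr_gt0 e4 M0).
pose p := Num.truncn (t * n.+1%:R).
have tn0 : 0 <= t * n.+1%:R by rewrite mulr_ge0.
have /andP[p1 p2] := Num.Theory.truncn_itv tn0; rewrite -/p in p1 p2.
have pn : (p <= n.+1)%N.
  rewrite -(ler_nat R); apply: le_trans p1 _.
  by rewrite ler_piMl.
have pq : (p + (n.+1 - p) = n.+1)%N by rewrite subnKC.
have pq0 : (0 < p + (n.+1 - p))%N by rewrite pq.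
have [z mz] := @rational_mean_exists _ _ i j pq0.
exists z; first by apply: hull_mean mz => //; rewrite pq.
have {mz}/rational_meanP := mz; rewrite pq => zE.
have n0 : (n.+1%:R : R) != 0 by rewrite pnatr_eq0.
pose s : R := p%:R / n.+1%:R.
have s1 : (n.+1 - p)%:R / n.+1%:R = 1 - s :> R.
  by rewrite natrB// mulrBl divff.
have rz : r z = s *: r i + (1 - s) *: r j.
  apply: (scalerI n0); rewrite zE -s1 scalerDr !scalerA.
  by rewrite !(mulrC n.+1%:R) !divfK.
have st : `|t - s| < e / 4 / M.
  apply: le_lt_trans nM; rewrite -(ler_pM2r (ltr0Sn R n)) mulVf//.
  rewrite -[X in _ * X](ger0_norm (ler0n R n.+1)) -normrM mulrBl divfK//.
  rewrite ger0_norm ?subr_ge0// lerBlDl.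
  by rewrite natr1 ltW.
have -> : t *: x + (1 - t) *: y - r z =
    t *: (x - r i) + (1 - t) *: (y - r j) + (t - s) *: (r i - r j).
  rewrite rz; apply/rowP => k; rewrite !mxE; ring.
apply: le_lt_trans (ler_normD _ _) _.
have h1 : `|t *: (x - r i) + (1 - t) *: (y - r j)| <= e / 4 + e / 4.
  apply: le_trans (ler_normD _ _) _; rewrite !normrZ.
  apply: lerD; rewrite -[leRHS]mul1r; apply: ler_pM => //; try exact: ltW.
    by rewrite ger0_norm.
  by rewrite ger0_norm ?subr_ge0// gerBl.
have h2 : `|(t - s) *: (r i - r j)| <= e / 4.
  rewrite normrZ; apply: le_trans (_ : e / 4 / M * M <= _); last by rewrite divfK// gt_eqF.
  apply: ler_pM => //; first exact: ltW.
  apply: le_trans (ler_normB _ _) _; by rewrite /M lerDl.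
by move: h1 h2; move: (`|_|) (`|_|) => a b; lra.
Qed.

Lemma ball_convex (M : R) : convex_set [set x : 'rV[R]_N | `|x| <= M].
Proof.
apply/convex_setE => x y t /= xM yM t0 t1; apply: le_trans (ler_normD _ _) _.
have -> : M = t * M + (1 - t) * M by rewrite -mulrDl addrCA subrr addr0 mul1r.
rewrite !normrZ !ger0_norm ?subr_ge0//.
by apply: lerD; apply: ler_wpM2l => //; rewrite subr_ge0.
Qed.

Lemma basic_nbhd_open s : open (basic_nbhd (euclidean_space R N) s : set 'rV[R]_N).
Proof.
rewrite openE => x; rewrite /basic_nbhd /= -/(r _) -subr_gt0 => xs.
apply/nbhs_ballP; exists (qrat (coord s 1) - `|x - r (coord s 0)|) => // y.
rewrite -ball_normE /= => xy; apply: le_lt_trans (ler_distD x _ _) _.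
by rewrite (distrC y) -ltrBrDr.
Qed.

(** Every ball that misses the hull is listed, and the empty ball [0] stands in for the others. A
    point at distance at least [e] from the hull lies in a listed ball of radius below [e / 2]. *)
Lemma closed_coded_hull (a : baire) :
  (forall n, (forall z, hull H z -> ~ basic_nbhd (euclidean_space R N) n (r z)) ->
     a n = n) ->
  (forall n, ~ (forall z, hull H z -> ~ basic_nbhd (euclidean_space R N) n (r z)) ->
     a n = 0%N) ->
  closed_coded (euclidean_space R N) a = hull_closure.
Proof.
move=> an a0; apply/seteqP; split=> x; last first.
  move=> hx [n _]; have [nh|nh] := pselect (forall z, hull H z ->
      ~ basic_nbhd (euclidean_space R N) n (r z)).
    rewrite an// => xn; have e0 : 0 < qrat (coord n 1) - `|x - r (coord n 0)|.
      by rewrite subr_gt0.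
    have [z hz xz] := hx _ e0; apply: (nh z hz).
    apply: le_lt_trans (ler_distD x _ _) _; rewrite (distrC (r z)).
    by rewrite -ltrBrDr.
  rewrite a0// /basic_nbhd /= qrat0 => h.
  by have := le_lt_trans (normr_ge0 _) h; rewrite ltxx.
move=> xn e e0; apply: contrapT => nz; apply: xn.
have e2 : 0 < e / 2 by rewrite divr_gt0.
have [L _ Le] := exists_invn_lt 0 e2.
have [c xc] : exists c, `|x - r c| < (L.+1%:R : R)^-1.
  by apply: euclidean_dense; rewrite invr_gt0.
exists (pair_code c (pair_code 1 L)) => //; rewrite an.
  by rewrite /basic_nbhd !coord_pair qrat_pair mul1r.
move=> z hz; rewrite /basic_nbhd !coord_pair qrat_pair mul1r /= => zc.
apply: nz; exists z => //; apply: le_lt_trans (ler_distD (r c) _ _) _.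
rewrite (distrC (r c) (r z)).
by move: xc zc Le; move: (`|_|) (`|_|) (_^-1) => *; lra.
Qed.

Lemma closed_coded_closed (a : baire) :
  closed (closed_coded (euclidean_space R N) a : set 'rV[R]_N).
Proof. by apply: open_closedC; apply: bigcup_open => n _; exact: basic_nbhd_open. Qed.

Lemma hull_closure_compact (a : baire) (M : R) :
  closed_coded (euclidean_space R N) a = hull_closure ->
  (forall j, H j -> `|r j| <= M) -> compact hull_closure.
Proof.
move=> aE HM; apply: bounded_closed_compact; last first.
  by rewrite -aE; exact: closed_coded_closed.
exists (M + 1); split; first exact: num_real.
move=> y My x hx /=; have [z hz xz] := hx 1 ltr01.
have [n cz] := hull_combination hz.
have zM : `|r z| <= M.
  apply: (@combination_convex _ _ _ [set x | `|x| <= M] _ _ _ _ cz).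
    exact: ball_convex.
  by move=> _ [j Hj ->]; exact: HM.
apply: ltW; apply: le_lt_trans My; rewrite -[x](subrK (r z)).
by apply: le_trans (ler_normD _ _) _; rewrite addrC lerD// ltW.
Qed.

End RationalHull.

(** * Convexly generated sets are convex *)

Section ConvexlyGenerated.
Context {R : realType} {N : nat}.

Lemma convexly_generated_convex (A : set 'rV[R]_N) :
  convexly_generated A -> convex_set A.
Proof.
elim=> {A} [//|B _ IH BS|B _ IH]; apply/convex_setE => x y t.
  move=> [i _ Bx] [j _ By] t0 t1; exists (maxn i j) => //.
  have mono m n : (m <= n)%N -> B m `<=` B n.
    move=> /subnK <-; elim: (n - m)%N => // k IHk z /IHk; exact: BS.
  have /convex_setE := IH (maxn i j); apply=> //.
    exact: mono (leq_maxl _ _) _ Bx.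
  exact: mono (leq_maxr _ _) _ By.
move=> Bx By t0 t1 i _; have /convex_setE := IH i; apply=> //.
  exact: Bx.
exact: By.
Qed.

Lemma code_convexly_generated (a : baire) (A : set 'rV[R]_N) :
  convexly_generated_code a A -> convexly_generated A.
Proof.
move=> [lt [xi [_]]]; elim=> {xi a A} [xi a _ _ cpt cvx|xi a b eta B _ _ _ _ _ IH mono].
  exact: cg_compact_convex.
apply: cg_increasing_union => [i|i]; first exact: cg_intersection.
exact: mono.
Qed.

End ConvexlyGenerated.

(** * Effective separation *)

(* The node [n = <k, w>] stands for the sequence of the first [k] digits of [w]. The
   later digits of [w] are irrelevant, and [child] extends the sequence by [i] plus
   the (usually zero) exponent already present, which is why nodes need not be
   normalised: along every path the digits stabilise. *)
Definition digit (w i : nat) : nat := (logn (nth_prime i) w).-1.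

Definition child (n i : nat) : nat :=
  pair_code (coord n 0).+1 (coord n 1 * nth_prime (coord n 0) ^ i.+1)%N.

Lemma recursive_digit : recursive2 digit.
Proof.
have : recursive2 (fun w i => (logn (nth_prime i) w).-1).
  recursive_arith; apply: (recursive_comp2 recursive_logn_nth_prime); recursive_arith.
by [].
Qed.

Lemma child_stage n i : coord (child n i) 0 = (coord n 0).+1.
Proof. by rewrite coord_pair. Qed.

Lemma child_gt0 n i : (0 < coord n 1)%N -> (0 < coord (child n i) 1)%N.
Proof.
by move=> n0; rewrite coord_pair muln_gt0 n0 expn_gt0 prime_gt0 ?prime_nth_prime.
Qed.

Lemma digit_child n i j : j != coord n 0 ->
  digit (coord (child n i) 1) j = digit (coord n 1) j.
Proof.
move=> jn; rewrite coord_pair /digit; case: (posnP (coord n 1)) => [->|n0].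
  by rewrite mul0n.
have p0 : (0 < nth_prime (coord n 0) ^ i.+1)%N.
  by rewrite expn_gt0 prime_gt0 ?prime_nth_prime.
rewrite lognM// lognX.
rewrite [logn _ (nth_prime _)]logn_prime ?prime_nth_prime//.
by rewrite (inj_eq nth_prime_inj) (negbTE jn) muln0 addn0.
Qed.

(** Only an inequality, since the exponent already present is added to [i]; digits serve as upper
    bounds, so this is all that is needed. *)
Lemma digit_child_ge n i : (0 < coord n 1)%N ->
  (i <= digit (coord (child n i) 1) (coord n 0))%N.
Proof.
move=> n0; rewrite coord_pair /digit.
have p0 : (0 < nth_prime (coord n 0) ^ i.+1)%N.
  by rewrite expn_gt0 prime_gt0 ?prime_nth_prime.
rewrite lognM// lognX.
rewrite [logn _ (nth_prime _)]logn_prime ?prime_nth_prime// eqxx muln1 addnS /=.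
exact: leq_addl.
Qed.

Lemma not_wf_path (T : Type) (lt : T -> T -> Prop) :
  ~ well_founded lt -> exists f : nat -> T, forall k, lt (f k.+1) (f k).
Proof.
move=> nwf; have [x0 nx0] : exists x, ~ Acc lt x by apply/existsNP.
have /choice[g gP] (x : {x | ~ Acc lt x}) : exists y : {x | ~ Acc lt x},
    lt (sval y) (sval x).
  case: x => x nx /=; apply: contrapT => h; apply: nx; split=> y yx.
  by apply: contrapT => ny; apply: h; exists (exist _ y ny).
exists (fun k => sval (iter k g (exist _ x0 nx0))) => k.
exact: gP.
Qed.

Lemma morph_child {C : Type} `{context C} (n i : C -> nat) :
  morph n -> morph i -> morph (fun c => child (n c) (i c)).
Proof. by move=> mn mi; rewrite /child; morph. Qed.

Ltac morph_extra ::=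
  lazymatch goal with
  | |- morph (fun c => nat_of_bool (Order.le (@?a c) (@?b c))) =>
      apply: (@morph_le _ _ _ a b); rational
  | |- morph (fun c => nat_of_bool (Order.lt (@?a c) (@?b c))) =>
      apply: (@morph_lt _ _ _ a b); rational
  | |- morph (fun c => digit (@?f c) (@?g c)) =>
      apply: (@morph_rec2 _ _ digit f g recursive_digit)
  | |- morph (fun c => child (@?f c) (@?g c)) =>
      apply: (@morph_child _ _ f g)
  end.

Section EffectiveSeparation.
Context {R : realType} {N : nat}.
Local Notation r := (pres (euclidean_space R N)).
Local Notation omega2 := (prod_space (R := R) omega_space omega_space).

Lemma morph_rational_mean {C : Type} `{context C} (p q i j z : C -> nat) :
  morph p -> morph q -> morph i -> morph j -> morph z ->
  morph (fun c => nat_of_bool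
    (@rational_mean R N (p c) (q c) (i c) (j c) (z c))).
Proof.
move=> mp mq mi mj mz; apply: morph_all_ord => k.
have : morph (fun c => nat_of_bool
   (((p c + q c)%:R * @rat_pres R (coord (z c) k) <=
     (p c)%:R * rat_pres (coord (i c) k) + (q c)%:R * rat_pres (coord (j c) k)) &&
   ((p c)%:R * rat_pres (coord (i c) k) + (q c)%:R * rat_pres (coord (j c) k) <=
     (p c + q c)%:R * @rat_pres R (coord (z c) k)))).
  morph.
by congr morph; apply/funext => c; rewrite eq_le.
Qed.

(** The recursion on levels is undone by guessing the truth table [S] of all levels at once: the
    local condition [G] has exactly one solution, the bound [S n <= 1] removing the remaining
    freedom. *)
Lemma bianalytic_hull {C : Type} `{context C} (D : C -> nat -> Prop) :
  bianalytic (fun p : C * nat => D p.1 p.2) ->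
  bianalytic (fun p : C * nat => hull (R := R) (N := N) (D p.1) p.2).
Proof.
move=> bD.
pose G (p : C * nat) (S : baire) := forall n : nat, (S n <= 1)%N /\
  (coord n 0 = 0%N -> (S n = 1%N <-> D p.1 (coord n 1))) /\
  (forall m : nat, coord n 0 = m.+1 -> (S n = 1%N <->
    exists i : nat, exists j : nat, exists a : nat, exists b : nat,
      S (pair_code m i) = 1%N /\ S (pair_code m j) = 1%N /\ (0 < a + b)%N /\
      rational_mean (R := R) (N := N) a b i j (coord n 1))).
pose f (p : C * nat) : baire := fun n =>
  nat_of_bool `[< hull_level (R := R) (N := N) (D p.1) (coord n 0) (coord n 1) >].
have fE p n : f p n = 1%N <-> hull_level (R := R) (N := N) (D p.1) (coord n 0) (coord n 1).
  by rewrite /f; case: asboolP.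
apply: (bianalytic_ext (P := fun p => exists m, f p (pair_code m p.2) = 1%N)); last first.
  by move=> p; split=> -[m]; exists m; move: (fE p (pair_code m p.2));
    rewrite !coord_pair => h; exact/h.
apply: (@bianalytic_unique _ _ G f (fun p S => exists m, S (pair_code m p.2) = 1%N)).
- rewrite /G; analytic.
  + apply: (@bianalytic_subst _ _ _ _ _ (fun p : C * nat * baire * nat =>
      (p.1.1.1, coord p.2 1)) _ bD); morph.
  + by apply: morph_rational_mean; morph.
- move=> p S; split=> [GS|->]; last first.
    move=> n; split; first by rewrite /f; case: asboolP.
    split=> [n0|m nm]; first by rewrite fE n0.
    rewrite fE nm /=; split=> -[i [j [a [b]]]].
      move=> [hi hj ab hm]; exists i, j, a, b.
      split; first by apply/fE; rewrite !coord_pair.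
      by split=> //; apply/fE; rewrite !coord_pair.
    move=> [/fE hi [/fE hj [ab hm]]]; exists i, j, a, b; split=> //.
      by rewrite !coord_pair in hi.
    by rewrite !coord_pair in hj.
  have SE m : forall n, coord n 0 = m ->
      (S n = 1%N <-> hull_level (R := R) (N := N) (D p.1) m (coord n 1)).
    elim: m => [|m IH] n nm; have [_ [G0 G1]] := GS n; first exact: G0.
    rewrite (G1 _ nm); split=> -[i [j [a [b]]]].
      move=> [hi [hj [ab hm]]]; exists i, j, a, b; split=> //.
        by have := IH (pair_code m i); rewrite !coord_pair => h; apply/h.
      by have := IH (pair_code m j); rewrite !coord_pair => h; apply/h.
    move=> [hi hj ab hm]; exists i, j, a, b.
    split; first by apply/IH; rewrite coord_pair.
    by split=> //; apply/IH; rewrite coord_pair.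
  apply/funext => n; have [Sn _] := GS n; have := SE _ n erefl.
  rewrite -fE; have : (f p n <= 1)%N by rewrite /f; case: asboolP.
  move: Sn; case: (S n) => [|[|//]] _; case: (f p n) => [|[|//]] _ // [] h1 h2.
    by have := h2 erefl.
  by have := h1 erefl.
- bianalytic.
Qed.

Lemma rational_term_norm_pres {C : Type} `{context C} (f : C -> nat) : morph f ->
  rational_term (fun c => `|r (f c)|).
Proof.
move=> mf.
have : rational_term (fun c => \big[Num.max/0]_(ij : 'I_1 * 'I_N)
    `|@rat_pres R (coord (f c) ij.2)|).
  apply: rational_term_bigmax => ij; apply: rational_term_norm.
  by apply: rational_term_rat_pres; morph.
congr rational_term; apply/funext => c.
by rewrite [RHS]mx_normrE; apply: eq_bigr => -[i j] _; rewrite !mxE.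
Qed.

(** Only finitely many digits of a witness matter at a node, so a number [u] can code it and no
    function quantifier arises. *)
Definition approximant (e : baire) (n j : nat) : Prop :=
  exists u, stage e (digit (coord n 1)) (coord n 0) (coord u) (r j).

Lemma bianalytic_approximant {C : Type} `{context C} (e : baire) (n j : C -> nat) :
  recursive1 e -> morph n -> morph j ->
  bianalytic (fun c => approximant e (n c) (j c)).
Proof.
move=> re mn mj.
have : bianalytic (fun c => exists u : nat,
    (forall i : nat, (i < coord (n c) 0)%N ->
      (coord u i <= digit (coord (n c) 1) i)%N /\
      `|r (j c)| <= (digit (coord (n c) 1) 0).+1%:R) /\
    (forall m : nat, (m < coord (n c) 0)%N ->
      ~ ((exists l : nat, (l <= coord (n c) 0)%N /\
        (forall i : nat, (i < l)%N -> coord u i = coord (coord (coord (e m) 0) 1) i) /\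
        (l.+1%:R : R)^-1 < qrat (coord (e m) 1)) /\
      `|r (j c) - r (coord (coord (e m) 0) 0)| + (coord (n c) 0).+1%:R^-1 <
        qrat (coord (e m) 1)))).
  bianalytic.
  by apply: rational_term_norm_pres; morph.
move/bianalytic_ext; apply => c; split=> -[u [h1 h2]]; exists u; split=> //.
  move=> m mk [[l [lk ul lq]] mq]; apply: (h2 m mk); split=> //.
  by exists l.
move=> m mk [[l [lk [ul lq]]] mq]; apply: (h2 m mk); split=> //.
by exists l.
Qed.

Lemma stage_ext (e al al' u u' : baire) k (x : 'rV[R]_N) :
  (forall i, (i < k)%N -> al i = al' i) -> (forall i, (i < k)%N -> u i = u' i) ->
  stage e al k u x -> stage e al' k u' x.
Proof.
move=> alE uE [h1 h2]; split=> [i ik|n nk [[l [lk ul lq]] xq]].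
  have k0 : (0 < k)%N by apply: leq_ltn_trans ik.
  by rewrite -uE// -alE// -(alE 0%N)//; exact: h1.
apply: (h2 n nk); split=> //; exists l; split=> // i il.
by rewrite uE ?ul//; exact: leq_trans lk.
Qed.

Definition bounded_point (e : baire) (n : nat) (x : 'rV[R]_N) : Prop :=
  exists2 b, in_closed e b x & forall i, (i < coord n 0)%N ->
    (b i <= digit (coord n 1) i)%N /\ `|x| <= (digit (coord n 1) 0)%:R.

(** The tolerances of [stage] are meant for this: the margin [1 / k.+1] and the successor in the
    norm bound absorb the passage from [x] to a nearby rational point. *)
Lemma stage_near (e al b : baire) k (x x' : 'rV[R]_N) : in_closed e b x ->
  (forall i, (i < k)%N -> (b i <= al i)%N /\ `|x| <= (al 0%N)%:R) ->
  `|x - x'| < k.+1%:R^-1 -> stage e al k b x'.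
Proof.
move=> bx xal xx'; split=> [i ik|n nk [[l [lk ul lq]] xq]].
  have [bi xi] := xal i ik; split=> //.
  have k1 : k.+1%:R^-1 <= 1 :> R by rewrite invf_le1 ?ltr0Sn// ler1n.
  have := ler_normB x (x - x'); rewrite subKr => h; apply: le_trans h _.
  by rewrite -natr1; move: xi k1 xx'; move: (`|x|) (`|x - x'|) (_^-1) => *; lra.
apply: (bx n); split; last by exists l.
apply: le_lt_trans (ler_distD x' _ _) _; apply: le_lt_trans xq.
by rewrite addrC lerD2l ltW.
Qed.

Lemma approximant_near (e : baire) n (x : 'rV[R]_N) d : 0 < d -> bounded_point e n x ->
  exists2 j, approximant e n j & `|x - r j| < d.
Proof.
move=> d0 [b bx xn].
have k0 : 0 < ((coord n 0).+1%:R : R)^-1 by rewrite invr_gt0.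
have m0 : 0 < Num.min d (coord n 0).+1%:R^-1 by rewrite lt_min d0.
have [j] := euclidean_dense x m0; rewrite lt_min => /andP[xd xk].
exists j => //; have [u bu] := exists_coord_segment b (coord n 0).
by exists u; apply: stage_ext (stage_near bx xn xk).
Qed.

(** Any [i] above the next value of the witness works. The norm of [x] matters only at length [0],
    where the new digit becomes the bound on the point. *)
Lemma bounded_point_child (e : baire) n (x : 'rV[R]_N) : (0 < coord n 1)%N ->
  bounded_point e n x ->
  exists i0, forall i, (i0 <= i)%N -> bounded_point e (child n i) x.
Proof.
move=> n0 [b bx xn]; exists (maxn (b (coord n 0)) (Num.truncn `|x|).+1) => i.
rewrite geq_max => /andP[bi xi].
have {}xi : `|x| <= i%:R.
  by apply: le_trans (ltW (truncnS_gt _)) _; rewrite ler_nat.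
exists b => // j; rewrite child_stage ltnS => jk; split.
  move: jk; rewrite leq_eqVlt => /predU1P[->|jk].
    by apply: leq_trans bi _; exact: digit_child_ge.
  by rewrite digit_child ?neq_ltn ?jk//; have [] := xn j jk.
have [k0|k0] := posnP (coord n 0).
  by apply: le_trans xi _; rewrite ler_nat -{2}k0; exact: digit_child_ge.
by rewrite digit_child ?neq_ltn ?k0//; have [] := xn 0%N k0.
Qed.

(** One inclusion suffices: the balls of radius [1 / i.+1] containing [z] already fix the values up
    to [i]. *)
Lemma baire_ball_ext (y z : baire) : (forall s, basic_nbhd (baire_space (R := R)) s z ->
  basic_nbhd (baire_space (R := R)) s y) -> y = z.
Proof.
move=> zy; apply/funext => i; have [u zu] := exists_coord_segment z i.+1.
have yu : basic_nbhd (baire_space (R := R)) (pair_code u (pair_code 1 i)) y.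
  apply: zy; rewrite /basic_nbhd !coord_pair qrat_pair mul1r; exact/baire_dist_ltS.
move: yu; rewrite /basic_nbhd !coord_pair qrat_pair mul1r => /baire_dist_ltS ->//.
by rewrite zu.
Qed.

(** * The tree of nodes and the codes attached to it *)

Section Construction.
Variables (A : set 'rV[R]_N) (e e' : baire).
Hypotheses (re : recursive1 e) (re' : recursive1 e') (cA : convex_set A).
Hypothesis AE : forall x, A x <-> exists b, in_closed e b x.
Hypothesis nAE : forall x, ~ A x <-> exists b, in_closed e' b x.

Local Notation hull := (hull (R := R) (N := N)).

(** At length [0] the approximants carry no norm bound; excluding it keeps the hull at a leaf
    bounded, hence its closure compact. *)
Definition leaf (n : nat) : Prop := (0 < coord n 0)%N /\
  exists m : nat, forall z : nat, hull (approximant e n) z ->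
    forall j : nat, approximant e' n j -> (m.+1%:R : R)^-1 <= `|r z - r j|.

Definition below (m n : nat) : Prop := ~ leaf n /\ exists i, m = child n i.

(** An infinite branch has stabilising digits [al]. At the stage provided by [separation_stage] its
    node would be a leaf, because a hull point is a combination of approximants, which
    Caratheodory's theorem shortens to [N.+1] points. *)
Lemma below_wf : well_founded below.
Proof.
apply: contrapT => /not_wf_path[f fP].
have fk k : coord (f k) 0 = (coord (f 0%N) 0 + k)%N.
  elim: k => [|k IH]; first by rewrite addn0.
  by have [_ [i ->]] := fP k; rewrite child_stage IH addnS.
have dS j k : (j < coord (f k) 0)%N ->
    digit (coord (f k.+1) 1) j = digit (coord (f k) 1) j.
  by move=> jk; have [_ [i ->]] := fP k; rewrite digit_child// neq_ltn jk.
(* The node [f j.+1] has length greater than [j], so its digit [j] is already final. *)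
pose al j := digit (coord (f j.+1) 1) j.
have alE k j : (j < coord (f k) 0)%N -> digit (coord (f k) 1) j = al j.
  have h m : (j < coord (f m) 0)%N -> forall d,
      digit (coord (f (m + d)%N) 1) j = digit (coord (f m) 1) j.
    move=> jm; elim=> [|d IH]; first by rewrite addn0.
    by rewrite addnS dS// fk; apply: leq_trans jm _; rewrite fk addnA leq_addr.
  move=> jk; have j1 : (j < coord (f j.+1) 0)%N by rewrite fk addnS ltnS leq_addl.
  by rewrite /al -(h _ jk j.+1) -(h _ j1 k) addnC.
have [k Kk [m mP]] := @separation_stage R N A e e' al (coord (f 0%N) 0) cA AE nAE.
pose n := f (k - coord (f 0%N) 0)%N.
have nk : coord n 0 = k by rewrite fk subnKC// ltnW.
have [nl _] := fP (k - coord (f 0%N) 0)%N; apply: nl; rewrite -/n; split.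
  by rewrite nk; apply: leq_ltn_trans Kk.
have st ee j : approximant ee n j -> exists u, stage ee al k u (r j).
  move=> [u]; rewrite nk => su; exists (coord u); apply: stage_ext su => // i ik.
  by apply: alE; rewrite -/n nk.
exists m => z hz j /st[u su]; apply: (mP _ u) => //.
have [q cz] := hull_combination hz; apply: (@caratheodory _ _ _ q).
by apply: combination_mono cz => x [i /st[v sv] ->]; exists v.
Qed.

Lemma bianalytic_hull_approximant : bianalytic (fun p : nat * nat =>
  hull (approximant e p.1) p.2).
Proof.
apply: (@bianalytic_hull nat _ (fun n => approximant e n)).
by apply: bianalytic_approximant => //; morph.
Qed.

Lemma bianalytic_leaf : bianalytic leaf.
Proof.
rewrite /leaf; bianalytic.
- apply: (@bianalytic_subst _ _ _ _ _ (fun p : nat * nat * nat => (p.1.1, p.2)) _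
    bianalytic_hull_approximant); morph.
- by apply: bianalytic_approximant => //; morph.
Qed.

Definition misses (n t : nat) : Prop := forall z : nat, hull (approximant e n) z ->
  ~ (`|r z - r (coord t 0)| < qrat (coord t 1)).

Lemma bianalytic_misses : bianalytic (fun p : nat * nat => misses p.1 p.2).
Proof.
rewrite /misses; bianalytic.
apply: (@bianalytic_subst _ _ _ _ _ (fun p : nat * nat * nat => (p.1.1, p.2)) _
    bianalytic_hull_approximant); morph.
Qed.

(* [t] stands for the pair of [u] and [s], where [u] is the index [<i,j>] of the
   subcode attached to the child [i+j], and [s] is a ball of the Baire space. *)
Definition subcode_index (n t : nat) : nat :=
  child n (coord (coord t 0) 0 + coord (coord t 0) 1).

(** At a leaf, the balls missing the hull are enumerated. Elsewhere, the ball
    [pair_code t (pair_code 1 1)] has radius [1 / 2] and isolates the pair coded by [t]: the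
    enumeration lists the pairs of an index and a Baire ball containing the subcode with that index.
    The empty ball [0] pads both lists. *)
Definition code_family (G : baire) : Prop := forall n : nat,
  (leaf n -> G (pair_code n 0) = 0%N /\ forall t : nat,
    (misses n t -> G (pair_code n t.+1) = t) /\
    (~ misses n t -> G (pair_code n t.+1) = 0%N)) /\
  (~ leaf n -> G (pair_code n 0) = 1%N /\ forall t : nat,
    (basic_nbhd (baire_space (R := R)) (coord t 1)
       (fun i => G (pair_code (subcode_index n t) i)) ->
     G (pair_code n t.+1) = pair_code t (pair_code 1 1)) /\
    (~ basic_nbhd (baire_space (R := R)) (coord t 1)
       (fun i => G (pair_code (subcode_index n t) i)) ->
     G (pair_code n t.+1) = 0%N)).

Lemma analytic_code_family : analytic code_family.
Proof.
have bl (C : Type) (cC : context C) (f : C -> nat) :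
    morph f -> bianalytic (fun c => leaf (f c)).
  move=> mf; exact: (bianalytic_subst mf bianalytic_leaf).
have bm (C : Type) (cC : context C) (f g : C -> nat) :
    morph f -> morph g -> bianalytic (fun c => misses (f c) (g c)).
  by move=> mf mg; apply: (bianalytic_subst (morph_pair mf mg) bianalytic_misses).
apply: bianalytic_analytic; rewrite /code_family /subcode_index.
by bianalytic; try (by apply: bl; morph); apply: bm; morph.
Qed.

(** The recursion along [below] decides leaves and ball membership classically; effectivity of the
    result is due to the uniqueness below, not to this construction. *)
Lemma code_family_exists : exists G, code_family G.
Proof.
pose body n (rec : forall m, below m n -> baire) : baire :=
  match pselect (leaf n) with
  | left _ => fun t => if t is t'.+1 then
      if `[< misses n t' >] then t' else 0%N else 0%N
  | right nl => fun t => if t is t'.+1 then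
      if `[< basic_nbhd (baire_space (R := R)) (coord t' 1)
        (rec (subcode_index n t') (conj nl (ex_intro _ _ erefl))) >]
      then pair_code t' (pair_code 1 1) else 0%N else 1%N
  end.
pose F := Fix below_wf (fun=> baire) body.
have FE n : F n = body n (fun m _ => F m).
  rewrite /F Fix_eq // => x f g fg; congr body.
  by apply/functional_extensionality_dep => y; apply/functional_extensionality_dep.
exists (fun m => F (coord m 0) (coord m 1)) => n; split=> ln.
  rewrite !coord_pair FE /body; case: pselect => // _; split=> // t.
  by rewrite !coord_pair FE /body; case: pselect => // _; case: asboolP.
rewrite !coord_pair FE /body; case: pselect => // nl; split=> // t.
rewrite !coord_pair (FE n) /body; case: pselect => // nl'.
have -> : (fun i => F (coord (pair_code (subcode_index n t) i) 0)
    (coord (pair_code (subcode_index n t) i) 1)) = F (subcode_index n t).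
  by apply/funext => i; rewrite !coord_pair.
by case: asboolP.
Qed.

(** Agreement is claimed at pair codes only, since [code_family] leaves the other positions free. *)
Lemma code_family_unique (G G' : baire) : code_family G -> code_family G' ->
  forall n t, G (pair_code n t) = G' (pair_code n t).
Proof.
move=> cG cG'; elim/(well_founded_ind below_wf) => n IH t.
have [Gl Gn] := cG n; have [Gl' Gn'] := cG' n.
have [ln|nl] := pselect (leaf n).
  have [G0 GS] := Gl ln; have [G0' GS'] := Gl' ln.
  case: t => [|t]; first by rewrite G0 G0'.
  have [h1 h2] := GS t; have [h1' h2'] := GS' t.
  by have [m|m] := pselect (misses n t); [rewrite h1// h1'|rewrite h2// h2'].
have [G0 GS] := Gn nl; have [G0' GS'] := Gn' nl.
case: t => [|t]; first by rewrite G0 G0'.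
have [h1 h2] := GS t; have [h1' h2'] := GS' t.
have E : (fun i => G (pair_code (subcode_index n t) i)) =
         (fun i => G' (pair_code (subcode_index n t) i)).
  by apply/funext => i; apply: IH; split=> //; eexists.
rewrite -E in h1' h2'.
have [m|m] := pselect (basic_nbhd (baire_space (R := R)) (coord t 1)
    (fun i => G (pair_code (subcode_index n t) i))).
  by rewrite h1// h1'.
by rewrite h2// h2'.
Qed.

Section Family.
Variable G : baire.
Hypothesis GP : code_family G.

Let a (n : nat) : baire := fun t => G (pair_code n t).

(** The subcode of index [(i, j)] belongs to the child [i + j], so that intersecting over [j] means
    intersecting over all children from [i] on. *)
Lemma pfun_subcode n i j : ~ leaf n ->
  pfun_at (R := R) (shift (a n)) (seqcode [:: i; j]) (a (child n (i + j))).
Proof.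
move=> nl; have [_ /(_ nl)[_ aS]] := GP n.
have aP s : basic_nbhd (baire_space (R := R)) s (a (child n (i + j))) <->
    open_coded omega2 (shift (a n)) (pair_code i j, s).
  split=> [sa|[t _]].
    exists (pair_code (pair_code i j) s) => //.
    have [h _] := aS (pair_code (pair_code i j) s).
    rewrite /shift /a h; last by rewrite /subcode_index !coord_pair.
    by rewrite omega_ballE !coord_pair !eqxx maxxx qrat_pair mul1r invr_gt0.
  have [h1 h2] := aS t; rewrite /shift /a.
  have [m|m] := pselect (basic_nbhd (baire_space (R := R)) (coord t 1)
    (fun i => G (pair_code (subcode_index n t) i))); last first.
    rewrite h2// omega_ballE qrat0 gt_max => /andP[].
    by rewrite ltNge ler0n.
  rewrite h1// omega_ballE !coord_pair qrat_pair mul1r => tij.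
  have [] := @omega_dist_small R (pair_code i j) s t 1 isT tij.
  by move: m; rewrite /subcode_index => + tE ->; rewrite -tE !coord_pair.
split; first exact: aP.
move=> z zP; apply: baire_ball_ext => s /zP/aP; exact.
Qed.

(** Induction along [below]. A point bounded at [n] is bounded at all late children, so points of
    the first kind enter the lower limit and those of the second are kept out of every intersection.
    The second component of [n] must be positive, as otherwise its digits would stay [0] at all
    descendants. *)
Lemma code_at_separates ord rho : wellorder ord ->
  (forall n, leaf n -> forall m, ~ ord m (rho n)) ->
  (forall m n, ~ leaf n -> below m n -> ord (rho m) (rho n)) ->
  forall n, (0 < coord n 1)%N -> exists C : set 'rV[R]_N,
  [/\ CGC_at ord (rho n) (a n) C, forall x, bounded_point e n x -> C x &
    forall x, bounded_point e' n x -> ~ C x].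
Proof.
move=> ordW rho0 rhoS; elim/(well_founded_ind below_wf) => n IH n0.
have [ln|nl] := pselect (leaf n).
  have [/(_ ln)[a0 aS] _] := GP n.
  have aE : closed_coded (euclidean_space R N) (shift (a n)) =
      hull_closure (R := R) (N := N) (approximant e n).
    apply: closed_coded_hull => t tP; have [h1 h2] := aS t.
      exact: h1.
    exact: h2.
  have [k0 [m mP]] := ln; exists (hull_closure (R := R) (approximant e n)); split.
  - rewrite -aE; apply: CGC_zero => //.
    + exact: rho0.
    + rewrite aE; apply: (hull_closure_compact
        (M := (digit (coord n 1) 0).+1%:R) aE) => j [u [/(_ 0%N k0)[]]].
      by [].
    + rewrite aE; exact: hull_closure_convex.
  - move=> x xn d d0; have [j aj xj] := approximant_near d0 xn.
    by exists j => //; exists 0%N.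
  (* A common point would be within half the separation of both a hull point and an approximant of
     the complement. *)
  - move=> x xn xC; have d0 : 0 < (m.+1%:R : R)^-1 / 2 by rewrite divr_gt0 ?invr_gt0.
    have [j aj xj] := approximant_near d0 xn; have [z hz xz] := xC _ d0.
    have := mP z hz j aj; apply/negP; rewrite -ltNge.
    apply: le_lt_trans (ler_distD x _ _) _; rewrite (distrC (r z)).
    by rewrite [ltRHS]splitr ltrD.
have /choice[C CP] i : exists C : set 'rV[R]_N,
    [/\ CGC_at ord (rho (child n i)) (a (child n i)) C,
      forall x, bounded_point e (child n i) x -> C x &
      forall x, bounded_point e' (child n i) x -> ~ C x].
  by apply: IH; [split=> //; exists i|exact: child_gt0].
have [_ /(_ nl)[a0 _]] := GP n.
have lt_child i : ord (rho (child n i)) (rho n) by apply: rhoS => //; split=> //; exists i.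
exists (\bigcup_i \bigcap_j C (i + j)%N); split.
- apply: (@CGC_step _ _ _ _ _ (fun i j => a (child n (i + j)))
    (fun i j => rho (child n (i + j)))) => //.
  + by exists (rho (child n 0)).
  + by move=> i j; exact: pfun_subcode.
  + by move=> i j; have [] := CP (i + j)%N.
  + move=> i i' ii' x xC j _.
    by have := xC (i' - i + j)%N I; rewrite addnA subnKC.
- move=> x /(bounded_point_child n0)[i0 i0P]; exists i0 => // j _.
  by have [_ h _] := CP (i0 + j)%N; apply/h/i0P; exact: leq_addr.
- move=> x /(bounded_point_child n0)[i0 i0P] [i _ xC].
  have [_ _ h] := CP (i + i0)%N; apply: (h x); last exact: xC.
  by apply: i0P; exact: leq_addl.
Qed.

End Family.

Lemma Delta11_code : exists c, Delta11_point R c /\ convexly_generated_code c A.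
Proof.
have [G GP] := code_family_exists.
(* The root is the empty sequence, with second component [1], all of whose exponents vanish. At
   length [0] nothing is bounded, so all of [A] and of its complement is separated there, and the
   set coded at the root is [A]. *)
exists (fun t => G (pair_code (pair_code 0 1) t)); split.
  apply: (@Delta11_point_of_analytic R code_family _
    (fun g t => g (pair_code (pair_code 0 1) t))).
  - exact: analytic_code_family.
  - by morph.
  - by exists G.
  - by move=> g gP; apply/funext => t; exact: code_family_unique.
have [ord [rho [ordW rho0 rhoS]]] := wellorder_rank below_wf leaf.
exists ord, (rho (pair_code 0 1)); split=> //.
have [|C [cC CA CB]] := @code_at_separates G GP ord rho ordW rho0 rhoS (pair_code 0 1).
  by rewrite coord_pair.
suff -> : A = C by [].
apply/seteqP; split=> x.
  move=> /AE[b bx]; apply: CA; exists b => // i.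
  by rewrite coord_pair.
move=> xC; apply: contrapT => /nAE[b bx]; apply: (CB x) => //; exists b => // i.
by rewrite coord_pair.
Qed.

End Construction.

Lemma convex_Delta11_code (A : set 'rV[R]_N) :
  Delta11 (A : set (euclidean_space R N)) -> convex_set A ->
  exists c, Delta11_point R c /\ convexly_generated_code c A.
Proof.
move=> [/Sigma11_closedE[e re AE] /Sigma11_closedE[e' re' nAE]] cA.
exact: (Delta11_code re re' cA AE nAE).
Qed.

End EffectiveSeparation.

Theorem corollary1p6 (R : realType) (N : nat) (hN : (0 < N)%N)
    (A : set 'rV[R]_N) :
  ((Delta11 (A : set (euclidean_space R N)) /\ convexly_generated A) <->
     (exists a : baire, Delta11_point R a /\ convexly_generated_code a A)) /\
  ((exists a : baire, Delta11_point R a /\ convexly_generated_code a A) <->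
     (Delta11 (A : set (euclidean_space R N)) /\ convex_set A)).
Proof.
have i_iii : convexly_generated A -> convex_set A by exact: convexly_generated_convex.
have ii_i (a : baire) : Delta11_point R a -> convexly_generated_code a A ->
    Delta11 (A : set (euclidean_space R N)) /\ convexly_generated A.
  by move=> da ca; split; [exact: Delta11_of_code ca|exact: code_convexly_generated ca].
split; split.
- by move=> [dA /i_iii cA]; exact: convex_Delta11_code.
- by move=> [a [da ca]]; exact: ii_i ca.
- by move=> [a [da ca]]; have [dA /i_iii] := ii_i a da ca.
- by move=> [dA cA]; exact: convex_Delta11_code.
Qed.
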